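(* Let $\Omega\subset\mathbb{R}^{2d}$ be compact with Lebesgue measure $|\Omega|>0$, and let $S$ be a positive trace class operator on $L^2(\mathbb{R}^d)$ with $\operatorname{tr}(S)=1$. Then $$\log|\Omega| + \mathrm{ALC}(\tilde S,\Omega)\;\le\; H_{vN}\!\left(\frac{\chi_\Omega}{|\Omega|}\star S\right)\;\le\; H\!\left(\frac{\chi_\Omega}{|\Omega|}\ast\tilde S\right).$$
   Context: For $z=(x,\omega)\in\mathbb{R}^{2d}$, $\pi(z)$ is the unitary time-frequency shift on $L^2(\mathbb{R}^d)$, $\pi(z)f(t)=e^{2\pi i t\cdot\omega}f(t-x)$. For an operator $S$ on $L^2(\mathbb{R}^d)$, $\alpha_z(S)=\pi(z)S\pi(z)^*$ and $\check S=PSP$, where $Pf(x)=f(-x)$. For $f\in L^1(\mathbb{R}^{2d})$ and $S$ trace class, $f\star S=\int_{\mathbb{R}^{2d}} f(z)\alpha_z(S)\,dz$ (a trace class operator; Bochner or weak integral). For trace class $S,T$, $S\star T$ is the function $S\star T(z)=\operatorname{tr}(S\,\alpha_z(\check T))$ on $\mathbb{R}^{2d}$. The total correlation function of $S$ is $\tilde S=S\star\check S$, i.e. $\tilde S(z)=\operatorname{tr}(S\,\alpha_z(S))$; it is non-negative with integral $1$ when $S$ is positive with $\operatorname{tr}(S)=1$. $\ast$ is the usual convolution of functions on $\mathbb{R}^{2d}$, and $\chi_\Omega$ is the indicator function of $\Omega$. The average lack of concentration is $$\mathrm{ALC}(\tilde S,\Omega)=\frac{1}{|\Omega|}\int_\Omega\Big(1-\int_{\Omega-z}\tilde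 S(z')\,dz'\Big)dz,\qquad \Omega-z=\{w-z:w\in\Omega\}.$$ For a positive trace class operator $A$ with $\operatorname{tr}(A)=1$ and eigenvalues $(\mu_k)$ (with multiplicity), the von Neumann entropy is $H_{vN}(A)=-\operatorname{tr}(A\log A)=-\sum_k\mu_k\log\mu_k\in[0,\infty]$. For a probability density $f$ on $\mathbb{R}^{2d}$, the differential entropy is $H(f)=-\int_{\mathbb{R}^{2d}}f(z)\log f(z)\,dz$. The convention $0\log 0=0$ is used; the density $\frac{\chi_\Omega}{|\Omega|}\ast\tilde S$ takes values in $[0,1]$, so its differential entropy is well defined in $[0,\infty]$. *)

(* Defs.v *)
From HB Require Import structures.
From mathcomp Require Import all_boot all_order all_algebra.
From mathcomp Require Import complex.
From mathcomp Require Import all_classical all_reals all_analysis.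
Import numFieldNormedType.Exports.
Import Order.TTheory GRing.Theory Num.Theory.

Set Implicit Arguments.
Unset Strict Implicit.
Unset Printing Implicit Defensive.

Local Open Scope classical_set_scope.
Local Open Scope ring_scope.
Local Open Scope complex_scope.

Section measurable_rV.
Context {d} {T : measurableType d} (n : nat).

Let coors : 'I_n -> 'rV[T]_n -> T := fun i x => x ord0 i.

Let rV_set0 : g_sigma_preimage coors set0.
Proof. exact: sigma_algebra0. Qed.

Let rV_setC A : g_sigma_preimage coors A -> g_sigma_preimage coors (~` A).
Proof. exact: sigma_algebraC. Qed.

Let rV_bigcup (F : _^nat) : (forall i, g_sigma_preimage coors (F i)) ->
  g_sigma_preimage coors (\bigcup_i (F i)).
Proof. exact: sigma_algebra_bigcup. Qed.

(* The sigma-algebra generated by the coordinates; for T = R it is the Borel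
   sigma-algebra of R^n. *)
HB.instance Definition _ := @isMeasurable.Build (measure_tuple_display d)
  'rV[T]_n (g_sigma_preimage coors) rV_set0 rV_setC rV_bigcup.

Lemma measurable_coord (i : 'I_n) :
  measurable_fun [set: 'rV[T]_n] (fun x : 'rV[T]_n => x ord0 i).
Proof.
move=> _ Y mY; rewrite setTI; apply: sub_sigma_algebra => /=.
rewrite -bigcup_seq/=; exists i => /=; first by rewrite mem_index_enum.
by exists Y => //; rewrite setTI.
Qed.

Lemma measurable_fun_coordP d' (T' : measurableType d') (f : T' -> 'rV[T]_n) :
  (forall i, measurable_fun [set: T'] (fun x => f x ord0 i)) ->
  measurable_fun [set: T'] f.
Proof.
move=> mf; have : g_sigma_preimage coors `<=` image_set_system setT f measurable.
  apply: smallest_sub.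
    by apply: sigma_algebra_image; exact: sigma_algebra_measurable.
  rewrite -bigcup_seq/=; apply: bigcup_sub => i _ A [B mB <-] /=.
  rewrite /image_set_system/= setTI.
  by have := mf i measurableT B mB; rewrite !setTI.
by move=> sub _ A mA; exact: sub.
Qed.

End measurable_rV.

(* The library has this only as a section-local fact, and its canonical
   sigma-finite structure on [\x] is restricted to subprobabilities. *)
Lemma product_sigma_finite d1 d2 (T1 : measurableType d1)
    (T2 : measurableType d2) (R : realType)
    (m1 : {sigma_finite_measure set T1 -> \bar R})
    (m2 : {sigma_finite_measure set T2 -> \bar R}) :
  sigma_finite setT (m1 \x m2)%E.
Proof.
have /sigma_finiteP[F [TF ndF Foo]] := sigma_finiteT m1.
have /sigma_finiteP[G [TG ndG Goo]] := sigma_finiteT m2.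
exists (fun n => F n `*` G n).
  rewrite -setXTT TF TG; apply/seteqP; split => [[x y]|].
    move=> [/= [n _ Fnx] [k _ Gky]]; exists (maxn n k) => //; split.
    - by move: x Fnx; exact/subsetPset/ndF/leq_maxl.
    - by move: y Gky; exact/subsetPset/ndG/leq_maxr.
  by move=> [x y] [n _ []/= ? ?]; split; exists n.
move=> k; have [? ?] := Foo k; have [? ?] := Goo k.
split; first exact: measurableX.
by rewrite product_measure1E// lte_mul_pinfty// ge0_fin_numE.
Qed.

Section lebesgue_rV.
Context {R : realType}.

Definition rV_cons n (p : measurableTypeR R * 'rV[R]_n) : 'rV[R]_n.+1 :=
  \row_i oapp (p.2 ord0) p.1 (unlift ord0 i).

Let rV_uncons n (x : 'rV[R]_n.+1) :
    measurableTypeR R * 'rV[R]_n :=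
  (x ord0 ord0, \row_i x ord0 (lift ord0 i)).

Lemma measurable_rV_cons n :
  measurable_fun [set: (measurableTypeR R * 'rV[R]_n)%type] (@rV_cons n).
Proof.
apply: measurable_fun_coordP => i.
under eq_fun do rewrite mxE.
case: unliftP => [j|] _ //=.
apply: (@measurableT_comp _ _ _ _ _ _ (fun x : 'rV[R]_n => x ord0 j)) => //.
  exact: measurable_coord.
exact: measurable_fst.
Qed.

Let measurable_rV_uncons n : measurable_fun [set: 'rV[R]_n.+1] (@rV_uncons n).
Proof.
apply: measurable_fun_pair; first exact: measurable_coord.
apply: measurable_fun_coordP => i.
under eq_fun do rewrite mxE.
exact: measurable_coord.
Qed.

Let rV_consK n : cancel (@rV_cons n) (@rV_uncons n).
Proof.
move=> [a x]; rewrite /rV_uncons /rV_cons mxE unlift_none /=; congr pair.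
by apply/rowP => i; rewrite !mxE liftK.
Qed.

Section step.
Variables (n : nat) (mu : {sigma_finite_measure set 'rV[R]_n -> \bar R}).

(* Lebesgue measure on R^(n+1), as the image of the product of those on R and
   on R^n; see [lebesgue_rV_box]. *)
Definition lebesgue_rV_step : set 'rV[R]_n.+1 -> \bar R :=
  pushforward (@lebesgue_measure R \x mu)%E (@rV_cons n).

Let pushforward_measure : {measure set 'rV[R]_n.+1 -> \bar R} :=
  measure_function_pushforward__canonical__measure_function_Measure
    (@lebesgue_measure R \x mu)%E (@measurable_rV_cons n).

Let lebesgue_rV_step0 : lebesgue_rV_step set0 = 0%E.
Proof. exact: (measure0 pushforward_measure). Qed.

Let lebesgue_rV_step_ge0 A : (0 <= lebesgue_rV_step A)%E.
Proof. exact: (measure_ge0 pushforward_measure). Qed.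

Let lebesgue_rV_step_sigma_additive : semi_sigma_additive lebesgue_rV_step.
Proof. exact: (@measure_semi_sigma_additive _ _ _ pushforward_measure). Qed.

HB.instance Definition _ := isMeasure.Build _ _ _ lebesgue_rV_step
  lebesgue_rV_step0 lebesgue_rV_step_ge0 lebesgue_rV_step_sigma_additive.

Let lebesgue_rV_step_sigma_finite : sigma_finite setT lebesgue_rV_step.
Proof.
have [F TF mF] := @product_sigma_finite _ _ _ _ _ (@lebesgue_measure R) mu.
exists (fun k => @rV_uncons n @^-1` F k).
  by rewrite -preimage_bigcup -TF preimage_setT.
move=> k; have [mFk Fk] := mF k; split.
  by rewrite -[X in measurable X]setTI; exact: measurable_rV_uncons.
rewrite /lebesgue_rV_step /pushforward -comp_preimage.
by rewrite (_ : _ \o _ = id) //; apply/funext => p /=; rewrite rV_consK.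
Qed.

HB.instance Definition _ := @Measure_isSigmaFinite.Build _ _ _
  lebesgue_rV_step lebesgue_rV_step_sigma_finite.

End step.

Fixpoint lebesgue_rV n : {sigma_finite_measure set 'rV[R]_n -> \bar R} :=
  match n return {sigma_finite_measure set 'rV[R]_n -> \bar R} with
  | 0 => \d_(0 : 'rV[R]_0)
  | m.+1 => lebesgue_rV_step (lebesgue_rV m)
  end.

Lemma lebesgue_rV_box n (A : 'I_n -> set R) :
  (forall i, measurable (A i)) ->
  lebesgue_rV n [set x | forall i, A i (x ord0 i)] =
    (\prod_(i < n) lebesgue_measure (A i))%E.
Proof.
elim: n A => [|n IHn] A mA.
  by rewrite big_ord0 /= diracE mem_set// => -[].
pose B := [set x : 'rV[R]_n | forall i, A (lift ord0 i) (x ord0 i)].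
have mB : measurable B.
  rewrite [X in measurable X](_ : _ = \bigcap_(i in [set: 'I_n])
      ((fun x : 'rV[R]_n => x ord0 i) @^-1` A (lift ord0 i))).
    apply: (@fin_bigcap_measurable _ 'rV[R]_n) => [|i _].
      exact: finite_finset.
    have := @measurable_coord _ R n i measurableT _ (mA (lift ord0 i)).
    by rewrite setTI.
  by apply/seteqP; split => x /= Ax i; [move=> _; exact: Ax|exact: Ax].
rewrite big_ord_recl -IHn//= /lebesgue_rV_step /pushforward.
transitivity ((@lebesgue_measure R \x lebesgue_rV n)%E (A ord0 `*` B)); last first.
  by apply: product_measure1E; [exact: mA|exact: mB].
congr (_ _); apply/seteqP; split => [[a x]|[a x] [/= Aa Ax] i].
  move=> /= Aax; split => /=; first by have := Aax ord0; rewrite mxE unlift_none.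
  by move=> i; have := Aax (lift ord0 i); rewrite mxE liftK.
by rewrite mxE; case: unliftP => [j|] ->.
Qed.

End lebesgue_rV.

(* z = (x, omega) in R^d x R^d = R^(2d). *)
Notation phase_space R d := ('rV[R]_d * 'rV[R]_d)%type.

Section L2.
Context {R : realType} {d : nat}.
Local Notation E := 'rV[R]_d.
Local Notation C := R[i].
Local Notation mu := (@lebesgue_rV R d).

Definition csum (u : nat -> C) (s : C) : Prop :=
  series (fun k => complex.Re (u k)) @ \oo --> complex.Re s /\
  series (fun k => complex.Im (u k)) @ \oo --> complex.Im s.

(* Elements of L^2(R^d) are handled through their representatives: functions
   satisfying [L2], up to equality almost everywhere. *)
Definition L2 (f : E -> C) : Prop :=
  [/\ measurable_fun [set: E] (fun x => complex.Re (f x)),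
      measurable_fun [set: E] (fun x => complex.Im (f x)) &
      (\int[mu]_x (complex.Re (f x) ^+ 2 + complex.Im (f x) ^+ 2)%:E < +oo)%E].

Definition cintegral d' (T : measurableType d')
    (nu : {measure set T -> \bar R}) (f : T -> C) : C :=
  (\int[nu]_x complex.Re (f x)) +i* (\int[nu]_x complex.Im (f x)).

(* Linear in the first argument. *)
Definition inner (f g : E -> C) : C :=
  cintegral mu (fun x => f x * conjc (g x)).

Definition l2norm (f : E -> C) : R := Num.sqrt (complex.Re (inner f f)).

(* An operator on L^2(R^d) acts on representatives, and its values outside [L2]
   are irrelevant. A [bounded_op] sends a.e. equal functions to a.e. equal
   functions, because it is linear and bounded for the L^2 seminorm. *)
Definition operator := (E -> C) -> (E -> C).

HB.instance Definition _ := Choice.on operator.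

Definition bounded_op (T : operator) : Prop :=
  [/\ forall f, L2 f -> L2 (T f),
      forall (a : C) f g, L2 f -> L2 g ->
        T (fun x => a * f x + g x) = (fun x => a * T f x + T g x) %[ae mu] &
      exists M : R, forall f, L2 f -> l2norm (T f) <= M * l2norm f].

(* The order of R[i] makes [0 <= c] say that c is real and non-negative. *)
Definition positive_op (T : operator) : Prop :=
  bounded_op T /\ forall f, L2 f -> 0 <= inner (T f) f.

Definition orthonormal (I : eqType) (e : I -> E -> C) : Prop :=
  (forall k, L2 (e k)) /\ forall j k, inner (e j) (e k) = (j == k)%:R.

(* For d > 0 the space L^2(R^d) is separable and of infinite dimension, so that
   its orthonormal bases are sequences. *)
Definition orthonormal_basis (e : nat -> E -> C) : Prop :=
  orthonormal e /\
  forall f, L2 f -> (forall k, inner f (e k) = 0) -> f = cst 0 %[ae mu].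

(* Q = |T|, the positive operator with Q^2 = T^* T. *)
Definition absolute_value (T Q : operator) : Prop :=
  positive_op Q /\
  forall f g, L2 f -> L2 g -> inner (Q f) (Q g) = inner (T f) (T g).

Definition trace_class (T : operator) : Prop :=
  bounded_op T /\
  exists Q e, [/\ absolute_value T Q, orthonormal_basis e &
    (\sum_(0 <= k <oo) (complex.Re (inner (Q (e k)) (e k)))%:E < +oo)%E].

(* The common value of sum_k <T e_k, e_k> over all orthonormal bases. *)
Definition tr (T : operator) : C :=
  xget 0 [set c | forall e, orthonormal_basis e ->
    csum (fun k => inner (T (e k)) (e k)) c].

(* The dimension of ker (T - m), possibly +oo. *)
Definition multiplicity (T : operator) (m : R) : \bar R :=
  ereal_sup [set (n%:R)%:E | n in [set n | exists e : 'I_n -> E -> C,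
    orthonormal e /\
    forall k, T (e k) = (fun x => m%:C * e k x) %[ae mu]]].

(* - sum_k mu_k log mu_k, each eigenvalue m being counted [multiplicity A m]
   times. As ln 0 = 0 and +oo * 0 = 0, the kernel of A contributes 0. *)
Definition von_neumann_entropy (A : operator) : \bar R :=
  (\esum_(m in [set: R]) (multiplicity A m * (- (m * ln m))%:E))%E.

Definition dot (s t : E) : R := \sum_(i < d) s ord0 i * t ord0 i.

Definition cis (a : R) : C := cos a +i* sin a.

Definition tf_shift (z : phase_space R d) : operator :=
  fun f t => cis (2 * pi * dot t z.2) * f (t - z.1).

(* pi(z) is unitary: its adjoint is its inverse. *)
Definition tf_shift_adj (z : phase_space R d) : operator :=
  fun f t => cis (- (2 * pi * dot (t + z.1) z.2)) * f (t + z.1).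

Lemma cisNK (a : R) : cis a * cis (- a) = 1.
Proof.
rewrite /cis cosN sinN; apply/eqP; rewrite eq_complex /=.
by rewrite !mulrN opprK -!expr2 cos2Dsin2 eqxx/= mulrC addNr.
Qed.

Lemma tf_shiftK z : cancel (tf_shift z) (tf_shift_adj z).
Proof.
move=> f; apply/funext => t; rewrite /tf_shift /tf_shift_adj addrK mulrA.
by rewrite [X in X * _]mulrC cisNK mul1r.
Qed.

Lemma tf_shift_adjK z : cancel (tf_shift_adj z) (tf_shift z).
Proof.
move=> f; apply/funext => t; rewrite /tf_shift /tf_shift_adj subrK mulrA.
by rewrite cisNK mul1r.
Qed.

Definition alpha (z : phase_space R d) (S : operator) : operator :=
  tf_shift z \o S \o tf_shift_adj z.

Definition parity : operator := fun f t => f (- t).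

Definition check_op (S : operator) : operator := parity \o S \o parity.

Definition lebesgue_phase : set (phase_space R d) -> \bar R := (mu \x mu)%E.

HB.instance Definition _ := Measure.on lebesgue_phase.

HB.instance Definition _ := @Measure_isSigmaFinite.Build _ _ _
  lebesgue_phase (product_sigma_finite mu mu).

(* f * S as a weak integral: <(f * S) g, h> = int f(z) <alpha_z(S) g, h> dz.
   This determines the operator up to a.e. equality of its values. *)
Definition fun_op_conv (f : phase_space R d -> R) (S : operator) : operator :=
  xget (cst (cst 0) : operator) [set A | bounded_op A /\
    forall g h, L2 g -> L2 h ->
      inner (A g) h =
      cintegral lebesgue_phase (fun z => (f z)%:C * inner (alpha z S g) h)].

Definition op_conv (S T : operator) (z : phase_space R d) : C :=
  tr (S \o alpha z (check_op T)).

(* tr (S alpha_z(S)) is real when S is positive. *)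
Definition total_correlation (S : operator) (z : phase_space R d) : R :=
  complex.Re (op_conv S (check_op S) z).

Definition fun_conv (f g : phase_space R d -> R) (z : phase_space R d) : R :=
  \int[lebesgue_phase]_w (f w * g (z - w)).

Definition volume (O : set (phase_space R d)) : R := fine (lebesgue_phase O).

Definition ALC (f : phase_space R d -> R) (O : set (phase_space R d)) : R :=
  (volume O)^-1 * \int[lebesgue_phase]_(z in O)
    (1 - \int[lebesgue_phase]_(z' in [set w - z | w in O]) f z').

Definition differential_entropy (f : phase_space R d -> R) : \bar R :=
  (\int[lebesgue_phase]_z (- (f z * ln (f z)))%:E)%E.

Definition uniform_density (O : set (phase_space R d)) :
    phase_space R d -> R :=
  fun z => \1_O z / volume O.

End L2.

(* Main.v *)
From HB Require Import structures.
From mathcomp Require Import all_boot all_order all_algebra.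
From mathcomp Require Import finmap complex.
From mathcomp Require Import all_classical all_reals all_analysis.
From mathcomp Require Import measurable_realfun.
From mathcomp Require Import ring lra.
Require Import Defs.

(** Write S = sum_i s_i <., u_i> u_i with sum_i s_i = 1, let f be the normalized
    indicator function of Omega, A = f * S, and let pi(z) be the time-frequency
    shifts. With the forms q_z(g) = <S pi(z)^* g, pi(z)^* g>, which are equal to
    sum_j s_j |<g, pi(z) u_j>|^2, one has <A g, g> = int f(z) q_z(g) dz; in
    particular A is positive, has trace 1, and A <= 1. The trace of a product of
    positive operators ([trace_product]) gives the total correlation function
    as sum_j s_j <S pi(z) u_j, pi(z) u_j>. Since pi(w)^* pi(z) is pi(z - w) up to
    a phase, its convolution with f is
        x(z) = sum_j s_j <A pi(z) u_j, pi(z) u_j>       ([fun_conv_orbit]).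

    Let v_i be finitely many orthonormal eigenvectors of A, with eigenvalues
    m_i, and put w_i(z) = q_z(v_i). Splitting each pi(z) u_j into its projection
    on the span of the v_i and the rest, on which 0 <= A <= 1, gives
        0 <= x(z) - sum_i w_i(z) m_i <= 1 - sum_i w_i(z)  ([conv_eigen_gap]).
    Both bounds follow from this.

    Upper bound. With eta(t) = -t log t, concavity yields
    sum_i w_i(z) eta(m_i) <= eta(x(z)) ([ent_jensen]). Integrating over z, each
    w_i has integral at least 1, so sum_i eta(m_i) <= H(x); the von Neumann
    entropy is the supremum of the left-hand sides ([entropy_le]). That
    int w_i >= 1 is one half of Moyal's identity
    int |<v, pi(z) u>|^2 dz = |v|^2 |u|^2 ([moyal_ge]). It comes from Plancherel
    for integrable functions of L^2, again as an inequality: the transform is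
    damped by a product of exponentials, whose transform is a Poisson kernel
    concentrating at the origin, where the autocorrelation is continuous because
    translations are continuous in L^2 ([plancherel_ge]).

    Lower bound. From log t <= t - 1 one gets
    eta(m) >= (log |Omega| + 1) m - |Omega| m^2. Summing over the spectrum (m_k)
    of A, whose total is 1, leaves log |Omega| + 1 - |Omega| sum_k m_k^2. The
    first inequality of [conv_eigen_gap], integrated against f, gives
    sum_k m_k^2 <= int f x ([spectral_square_le]), and |Omega| int f x is
    1 - ALC, by a change of variables and the evenness of the correlation
    function ([ALC_overlap]).

    The spectral theorem ([spectral_decomposition]) is proved for positive
    operators of finite trace on a complete semi-definite space: powers of a
    positive contraction converge to vectors that it fixes, and finiteness of
    the trace keeps some of these limits away from 0. *)

Import numFieldNormedType.Exports.
Import Order.TTheory GRing.Theory Num.Theory.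
Set Implicit Arguments.
Unset Strict Implicit.
Unset Printing Implicit Defensive.
Local Open Scope classical_set_scope.
Local Open Scope ring_scope.
Local Open Scope complex_scope.

Local Notation Re := complex.Re.
Local Notation Im := complex.Im.

(** * Squared moduli of complex numbers *)

Section complex_modulus.
Context {R : realType}.
Implicit Types c : R[i].

Definition sqm c : R := Re c ^+ 2 + Im c ^+ 2.

Lemma cReD c c' : Re (c + c') = Re c + Re c'. Proof. by case: c c' => ? ? [? ?]. Qed.
Lemma cImD c c' : Im (c + c') = Im c + Im c'. Proof. by case: c c' => ? ? [? ?]. Qed.
Lemma cReN c : Re (- c) = - Re c. Proof. by case: c. Qed.
Lemma cImN c : Im (- c) = - Im c. Proof. by case: c. Qed.
Lemma cReM c c' : Re (c * c') = Re c * Re c' - Im c * Im c'.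
Proof. by case: c c' => ? ? [? ?]. Qed.
Lemma cImM c c' : Im (c * c') = Re c * Im c' + Im c * Re c'.
Proof. by case: c c' => ? ? [? ?]. Qed.
Lemma cReJ c : Re (conjc c) = Re c. Proof. by case: c. Qed.
Lemma cImJ c : Im (conjc c) = - Im c. Proof. by case: c. Qed.
Definition ReIm := (cReD, cImD, cReN, cImN, cReM, cImM, cReJ, cImJ).

Lemma Re_sum I (r : seq I) (P : pred I) (F : I -> R[i]) :
  Re (\sum_(i <- r | P i) F i) = \sum_(i <- r | P i) Re (F i).
Proof. by elim/big_rec2: _ => // i y1 y2 _ <-; rewrite cReD. Qed.
Lemma Im_sum I (r : seq I) (P : pred I) (F : I -> R[i]) :
  Im (\sum_(i <- r | P i) F i) = \sum_(i <- r | P i) Im (F i).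
Proof. by elim/big_rec2: _ => // i y1 y2 _ <-; rewrite cImD. Qed.

Lemma eq_ReIm c c' : Re c = Re c' -> Im c = Im c' -> c = c'.
Proof. by case: c c' => ? ? [? ?] /= -> ->. Qed.

Lemma conjcD c c' : conjc (c + c') = conjc c + conjc c'.
Proof. by apply: eq_ReIm; rewrite !ReIm // opprD. Qed.
Lemma conjcM c c' : conjc (c * c') = conjc c * conjc c'.
Proof. by apply: eq_ReIm; rewrite !ReIm; ring. Qed.
Lemma conjcN c : conjc (- c) = - conjc c.
Proof. by apply: eq_ReIm; rewrite !ReIm. Qed.

Lemma conjcB c c' : conjc (c - c') = conjc c - conjc c'.
Proof. by rewrite conjcD conjcN. Qed.

Lemma sqm_ge0 c : 0 <= sqm c. Proof. by rewrite addr_ge0 ?sqr_ge0. Qed.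
Lemma sqm0 : sqm 0 = 0. Proof. by rewrite /sqm /= expr0n addr0. Qed.
Lemma sqmM c c' : sqm (c * c') = sqm c * sqm c'.
Proof. by rewrite /sqm !ReIm; ring. Qed.
Lemma sqmJ c : sqm (conjc c) = sqm c. Proof. by rewrite /sqm !ReIm sqrrN. Qed.
Lemma sqmN c : sqm (- c) = sqm c. Proof. by rewrite /sqm !ReIm !sqrrN. Qed.
Lemma sqm_real (x : R) : sqm x%:C = x ^+ 2.
Proof. by rewrite /sqm /= expr0n addr0. Qed.
Lemma sqm_eq0 c : sqm c = 0 -> c = 0.
Proof.
move=> /eqP; rewrite paddr_eq0 ?sqr_ge0// !sqrf_eq0 => /andP[/eqP ? /eqP ?].
exact: eq_ReIm.
Qed.
Lemma mulcJ c : c * conjc c = (sqm c)%:C.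
Proof. by apply: eq_ReIm; rewrite !ReIm /sqm /=; ring. Qed.
Lemma Re_sqr_le c : Re c ^+ 2 <= sqm c. Proof. by rewrite lerDl sqr_ge0. Qed.
Lemma Im_sqr_le c : Im c ^+ 2 <= sqm c. Proof. by rewrite lerDr sqr_ge0. Qed.
End complex_modulus.

(** * Semi-definite Hermitian forms *)
Section hermitian_form.
Context {R : realType} {V : lmodType R[i]}.
Local Notation C := R[i].

(** Positivity is not definiteness: on functions defined everywhere, the inner
    product of L^2 vanishes on functions that vanish almost everywhere, and
    equality of vectors is only ever tested against the form. *)
Record hermitian (ip : V -> V -> C) : Prop := Hermitian {
  herm_lin : forall a f g h, ip (a *: f + g) h = a * ip f h + ip g h;
  herm_conj : forall f g, ip g f = conjc (ip f g);
  herm_ge0 : forall f, 0 <= Re (ip f f) }.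

Variable ip : V -> V -> C.
Hypothesis H : hermitian ip.
Implicit Types f g h : V.

Definition qf f : R := Re (ip f f).

Lemma ip0l h : ip 0 h = 0.
Proof.
have := herm_lin H 1 0 0 h; rewrite scaler0 addr0 mul1r => /eqP.
by rewrite -subr_eq0 opprD addrA subrr add0r oppr_eq0 => /eqP.
Qed.
Lemma ipDl f g h : ip (f + g) h = ip f h + ip g h.
Proof. by rewrite -[f]scale1r herm_lin// mul1r scale1r. Qed.
Lemma ipZl a f h : ip (a *: f) h = a * ip f h.
Proof. by rewrite -[a *: f]addr0 herm_lin// ip0l addr0. Qed.
Lemma ipNl f h : ip (- f) h = - ip f h.
Proof. by rewrite -scaleN1r ipZl mulN1r. Qed.
Lemma ipBl f g h : ip (f - g) h = ip f h - ip g h.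
Proof. by rewrite ipDl ipNl. Qed.
Lemma ip_suml I (r : seq I) (P : pred I) (F : I -> V) h :
  ip (\sum_(i <- r | P i) F i) h = \sum_(i <- r | P i) ip (F i) h.
Proof.
by elim/big_rec2: _ => [|i y1 y2 _ <-]; rewrite ?ip0l// ipDl.
Qed.
Lemma ip0r h : ip h 0 = 0.
Proof. by rewrite herm_conj// ip0l conjc0. Qed.
Lemma ipDr f g h : ip h (f + g) = ip h f + ip h g.
Proof. by rewrite (herm_conj H) ipDl conjcD -!(herm_conj H). Qed.
Lemma ipZr a f h : ip h (a *: f) = conjc a * ip h f.
Proof. by rewrite (herm_conj H) ipZl conjcM -(herm_conj H). Qed.
Lemma ipNr f h : ip h (- f) = - ip h f.
Proof. by rewrite (herm_conj H) ipNl conjcN -(herm_conj H). Qed.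
Lemma ipBr f g h : ip h (f - g) = ip h f - ip h g.
Proof. by rewrite ipDr ipNr. Qed.
Lemma ip_sumr I (r : seq I) (P : pred I) (F : I -> V) h :
  ip h (\sum_(i <- r | P i) F i) = \sum_(i <- r | P i) ip h (F i).
Proof.
by elim/big_rec2: _ => [|i y1 y2 _ <-]; rewrite ?ip0r// ipDr.
Qed.

Lemma qf_ge0 f : 0 <= qf f. Proof. exact: herm_ge0. Qed.
Lemma qfE f : ip f f = (qf f)%:C.
Proof.
apply: eq_ReIm => //=; have /(congr1 (@Im R)) := herm_conj H f f.
by rewrite cImJ; lra.
Qed.
Lemma sqm_ipC f g : sqm (ip f g) = sqm (ip g f).
Proof. by rewrite (herm_conj H) sqmJ. Qed.
Lemma Re_ipC f g : Re (ip f g) = Re (ip g f).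
Proof. by rewrite (herm_conj H) cReJ. Qed.
Lemma qf0 : qf 0 = 0. Proof. by rewrite /qf ip0l. Qed.
Lemma qfZ a f : qf (a *: f) = sqm a * qf f.
Proof. by rewrite /qf ipZl ipZr mulrA mulcJ qfE -rmorphM. Qed.
Lemma qfN f : qf (- f) = qf f.
Proof. by rewrite /qf ipNl ipNr opprK. Qed.
Lemma qfBC f g : qf (f - g) = qf (g - f).
Proof. by rewrite -qfN opprB. Qed.
Lemma qfD f g : qf (f + g) = qf f + qf g + 2 * Re (ip f g).
Proof.
by rewrite /qf !(ipDl, ipDr) !cReD (Re_ipC g f); ring.
Qed.
Lemma qfB f g : qf (f - g) = qf f + qf g - 2 * Re (ip f g).
Proof. by rewrite qfD qfN ipNr cReN; ring. Qed.

Lemma cauchy_schwarz f g : sqm (ip f g) <= qf f * qf g.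
Proof.
set m := sqm _.
have key (s : R) : 0 <= qf f - 2 * s * m + s ^+ 2 * m * qf g.
  have := qf_ge0 (f - (s%:C * ip f g) *: g).
  rewrite qfB qfZ ipZr sqmM sqm_real conjcM conjc_real.
  have -> : Re (s%:C * conjc (ip f g) * ip f g) = s * m.
    by rewrite -mulrA (mulrC (conjc _)) mulcJ -rmorphM.
  rewrite -/m; lra.
have m0 : 0 <= m by exact: sqm_ge0.
have := qf_ge0 f; have := qf_ge0 g; rewrite le_eqVlt => /predU1P[g0|g0] f0.
  rewrite -g0 mulr0; move: m0; rewrite le_eqVlt => /predU1P[<-//|m0].
  have := key ((qf f + 1) / (2 * m)); rewrite -g0 mulr0 addr0.
  have -> : 2 * ((qf f + 1) / (2 * m)) * m = qf f + 1 by field; lra.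
  lra.
have := key (qf g)^-1.
have -> : qf f - 2 * (qf g)^-1 * m + (qf g)^-1 ^+ 2 * m * qf g =
  qf f - m / qf g by field; lra.
by rewrite subr_ge0 ler_pdivrMr.
Qed.

Lemma ip_eq0 f g : qf f = 0 -> ip f g = 0.
Proof.
move=> f0; apply: sqm_eq0; apply/eqP; rewrite eq_le sqm_ge0 andbT.
by rewrite (le_trans (cauchy_schwarz f g))// f0 mul0r.
Qed.

Section orthonormal_finite.
Variables (I : finType) (v : I -> V).
Hypothesis vON : forall i j, ip (v i) (v j) = (i == j)%:R.

Definition proj f := \sum_i ip f (v i) *: v i.

Lemma ip_projl f g : ip (proj f) g = \sum_i ip f (v i) * ip (v i) g.
Proof. by rewrite ip_suml; apply: eq_bigr => i _; rewrite ipZl. Qed.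

Lemma ip_proj f j : ip (proj f) (v j) = ip f (v j).
Proof.
rewrite ip_projl (bigD1 j)//= vON eqxx mulr1 big1 ?addr0// => i ij.
by rewrite vON (negbTE ij) mulr0.
Qed.

Lemma qf_proj f : qf (proj f) = \sum_i sqm (ip f (v i)).
Proof.
rewrite /qf ip_projl Re_sum; apply: eq_bigr => i _.
by rewrite (herm_conj H (proj f)) ip_proj mulcJ.
Qed.

(** Pythagoras. *)
Lemma qf_subproj f : qf (f - proj f) = qf f - \sum_i sqm (ip f (v i)).
Proof.
have E : Re (ip f (proj f)) = \sum_i sqm (ip f (v i)).
  rewrite (herm_conj H) cReJ ip_projl Re_sum; apply: eq_bigr => i _.
  by rewrite (herm_conj H f) mulcJ.
by rewrite qfB qf_proj E; lra.
Qed.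

Lemma bessel f : \sum_i sqm (ip f (v i)) <= qf f.
Proof. by have := qf_ge0 (f - proj f); rewrite qf_subproj subr_ge0. Qed.
End orthonormal_finite.
End hermitian_form.

(** * Limits of vectors, orthonormal bases *)

Section real_sequences.
Context {R : realType}.
Implicit Types x y : nat -> R.

Lemma cvg_sqr_le0 x y : (forall n, x n ^+ 2 <= y n) ->
  y n @[n --> \oo] --> 0 -> x n @[n --> \oo] --> 0.
Proof.
move=> xy y0; apply/cvgr0Pnorm_lt => e e0.
have e2 : 0 < e ^+ 2 by rewrite exprn_gt0.
move/cvgr0Pnorm_lt : y0 => /(_ _ e2); apply: filterS => n yn.
rewrite -(@ltr_pXn2r _ 2%N)// ?nnegrE//; last exact: ltW.
rewrite real_normK ?num_real//; apply: le_lt_trans (xy n) _.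
exact: le_lt_trans (ler_norm _) yn.
Qed.

Lemma nnseries_cvgP x (l : R) : (forall n, 0 <= x n) ->
  (\sum_(k < n) x k @[n --> \oo] --> l) <->
  (\sum_(0 <= k <oo) (x k)%:E = l%:E)%E.
Proof.
move=> x0; have E : (fun n => \sum_(0 <= k < n) (x k)%:E)%E =
    EFin \o (fun n => \sum_(k < n) x k).
  by apply/funext => n; rewrite /= big_mkord sumEFin.
split => [xl|]; first by rewrite /= E; apply/cvg_lim => //; apply: cvg_EFin => //; exact: nearW.
rewrite E => xl; have : (EFin \o (fun n => \sum_(k < n) x k)) n @[n --> \oo] --> l%:E.
  rewrite -xl -E; apply: is_cvg_nneseries => n _ _; by rewrite lee_fin.
by move/fine_cvgP => [_]; exact.
Qed.

Lemma nneseries_le (x : nat -> R) (l : \bar R) : (forall n, 0 <= x n) ->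
  (forall n, ((\sum_(k < n) x k)%:E <= l)%E) ->
  (\sum_(0 <= k <oo) (x k)%:E <= l)%E.
Proof.
move=> x0 xl; apply: lime_le; first by apply: is_cvg_nneseries => n _ _; rewrite lee_fin.
by apply: nearW => n; rewrite big_mkord sumEFin.
Qed.

Lemma le_nneseries (x : nat -> R) n : (forall n, 0 <= x n) ->
  ((\sum_(k < n) x k)%:E <= \sum_(0 <= k <oo) (x k)%:E)%E.
Proof.
move=> x0; rewrite -sumEFin -(big_mkord xpredT (fun k => (x k)%:E)).
by apply: nneseries_lim_ge => k _ _; rewrite lee_fin.
Qed.

End real_sequences.

Section complete_space.
Context {R : realType} {V : lmodType R[i]}.
Local Notation C := R[i].
Variable ip : V -> V -> C.
Hypothesis H : hermitian ip.
Local Notation Q := (qf ip).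
Implicit Types f g h : V.

Definition complete_form := forall u : nat -> V,
  (forall e : R, 0 < e -> exists N, forall m n, (N <= m)%N -> (N <= n)%N ->
     Q (u m - u n) <= e) ->
  exists l, Q (u n - l) @[n --> \oo] --> 0.

Lemma cvg_Re_ip (u : nat -> V) l h : Q (u n - l) @[n --> \oo] --> 0 ->
  Re (ip (u n) h) @[n --> \oo] --> Re (ip l h).
Proof.
move=> ul; apply/subr_cvg0.
apply: (@cvg_sqr_le0 _ _ (fun n => Q (u n - l) * Q h)).
  move=> n; apply: le_trans (cauchy_schwarz H _ _); rewrite ipBl//.
  by apply: le_trans (Re_sqr_le _); rewrite cReD cReN.
by rewrite -(mul0r (Q h)); apply: cvgMr_tmp.
Qed.

Lemma cvg_Im_ip (u : nat -> V) l h : Q (u n - l) @[n --> \oo] --> 0 ->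
  Im (ip (u n) h) @[n --> \oo] --> Im (ip l h).
Proof.
move=> ul; apply/subr_cvg0.
apply: (@cvg_sqr_le0 _ _ (fun n => Q (u n - l) * Q h)).
  move=> n; apply: le_trans (cauchy_schwarz H _ _); rewrite ipBl//.
  by apply: le_trans (Im_sqr_le _); rewrite cImD cImN.
by rewrite -(mul0r (Q h)); apply: cvgMr_tmp.
Qed.

Lemma cvg_qf (u : nat -> V) l : Q (u n - l) @[n --> \oo] --> 0 ->
  Q (u n) @[n --> \oo] --> Q l.
Proof.
move=> ul; have E n : Q (u n) = Q (u n - l) + 2 * Re (ip (u n) l) - Q l.
  by rewrite qfB//; lra.
have E2 : 0 + 2 * Re (ip l l) - Q l = Q l by rewrite /qf; lra.
rewrite (eq_cvg _ _ E) -{2}E2.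
apply: cvgB; last exact: cvg_cst.
by apply: cvgD => //; apply: cvgMl_tmp; exact: cvg_Re_ip.
Qed.

Definition symmetric (T : V -> V) := forall f g, ip (T f) g = ip f (T g).
Definition positive (T : V -> V) := forall f, 0 <= Re (ip (T f) f).

Lemma positive_hermitian T : symmetric T -> positive T ->
  hermitian (fun f g => ip (T f) g).
Proof.
move=> sT pT; split => [a f g h|f g|]; last exact: pT.
- by rewrite !sT; exact: herm_lin.
- by rewrite sT; exact: herm_conj.
Qed.

(** Cauchy--Schwarz for the form of [T], applied to [f] and [T f]. *)
Lemma qf_op_le T (M : R) f : symmetric T -> positive T ->
  (forall g, Re (ip (T g) g) <= M * Q g) -> Q (T f) <= M * Re (ip (T f) f).
Proof.
move=> sT pT TM.
have le1 : Q (T f) ^+ 2 <= Re (ip (T f) f) * Re (ip (T (T f)) (T f)).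
  have := cauchy_schwarz (positive_hermitian sT pT) f (T f).
  by rewrite (qfE H (T f)) sqm_real.
have pf := pT f; have Qf := qf_ge0 H f; have le2 := TM (T f); have le3 := TM f.
have := qf_ge0 H (T f); rewrite le_eqVlt => /predU1P[E|Q0].
  rewrite -E; have [M0|M0] := leP 0 M; first by rewrite mulr_ge0.
  suff -> : Re (ip (T f) f) = 0 by rewrite mulr0.
  apply/eqP; rewrite eq_le pf andbT (le_trans le3)//.
  by rewrite mulr_le0_ge0// ltW.
rewrite -(ler_pM2r Q0); apply: le_trans (_ : _ <= Re (ip (T f) f) * (M * Q (T f))) _.
  by rewrite -expr2 (le_trans le1)// ler_wpM2l.
by rewrite mulrA (mulrC M).
Qed.

Section onb.
Variable e : nat -> V.
Hypothesis eON : forall i j, ip (e i) (e j) = (i == j)%:R.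

Lemma ord_ON n (i j : 'I_n) : ip (e i) (e j) = (i == j)%:R.
Proof. exact: eON. Qed.

Definition projn n f := proj ip (fun i : 'I_n => e i) f.

Lemma qf_projnB f m n : (n <= m)%N ->
  Q (projn m f - projn n f) =
  \sum_(k < m) sqm (ip f (e k)) - \sum_(k < n) sqm (ip f (e k)).
Proof.
move=> nm; rewrite qfB// !(qf_proj H (@ord_ON _)).
have -> : Re (ip (projn m f) (projn n f)) = \sum_(k < n) sqm (ip f (e k)).
  rewrite [ip _ _](herm_conj H) cReJ (ip_projl H) Re_sum.
  apply: eq_bigr => i _; rewrite [ip (e i) _](herm_conj H).
  have := ip_proj H (@ord_ON m) f (widen_ord nm i); rewrite /= => ->.
  by rewrite mulcJ.
lra.
Qed.

Hypothesis cV : complete_form.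
Hypothesis ecomplete : forall f, (forall k, ip f (e k) = 0) -> Q f = 0.

(** The partial sums are Cauchy by Bessel; their limit has the coefficients of
    [f], so that completeness of the basis identifies it with [f]. *)
Lemma projn_cvg f : Q (projn n f - f) @[n --> \oo] --> 0.
Proof.
pose x k := sqm (ip f (e k)).
have bx n : \sum_(k < n) x k <= Q f by exact: (bessel H (@ord_ON n)).
have x0 n : 0 <= x n by exact: sqm_ge0.
have ndx : nondecreasing_seq (fun n => \sum_(k < n) x k).
  by apply/nondecreasing_seqP => n; rewrite big_ord_recr lerDl.
have cx : cvgn (fun n => \sum_(k < n) x k).
  by apply: nondecreasing_is_cvgn => //; exists (Q f) => _ [n _ <-].
have [|l ul] := cV (u := fun n => projn n f).
  move=> eps eps0; have /cvgrPdist_le /(_ eps eps0)[N _ xN] := cx.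
  exists N.
  have key m n : (N <= n)%N -> (n <= m)%N -> Q (projn m f - projn n f) <= eps.
    move=> Nn nm; rewrite qf_projnB//.
    have := xN _ Nn; have := nondecreasing_cvgn_le ndx cx m.
    rewrite ler_norml => ? /andP[? ?]; rewrite /x in cx *; lra.
  move=> m n Nm Nn; have [nm|mn] := leqP n m; first exact: key.
  by rewrite qfBC//; apply: key => //; exact: ltnW.
have fl : Q (f - l) = 0.
  apply: ecomplete => k; apply: eq_ReIm => /=.
    rewrite ipBl// cReD cReN; apply/eqP; rewrite subr_eq0; apply/eqP.
    apply/esym/(cvg_unique _ (cvg_Re_ip (h := e k) ul)) => //.
    apply: cvg_near_cst; exists k.+1 => // n /= kn.
    by have := ip_proj H (@ord_ON n) f (Ordinal kn) => /= ->.
  rewrite ipBl// cImD cImN; apply/eqP; rewrite subr_eq0; apply/eqP.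
  apply/esym/(cvg_unique _ (cvg_Im_ip (h := e k) ul)) => //.
  apply: cvg_near_cst; exists k.+1 => // n /= kn.
  by have := ip_proj H (@ord_ON n) f (Ordinal kn) => /= ->.
have E n : Q (projn n f - f) = Q (projn n f - l).
  have -> : projn n f - f = (projn n f - l) - (f - l).
    by rewrite opprB addrA subrK.
  rewrite [LHS]qfB// fl (herm_conj H) (ip_eq0 H) //= ; lra.
by rewrite (eq_cvg _ _ E).
Qed.

Lemma parseval f : (\sum_(0 <= k <oo) (sqm (ip f (e k)))%:E = (Q f)%:E)%E.
Proof.
apply/nnseries_cvgP => [n|]; first exact: sqm_ge0.
have := cvg_qf (projn_cvg f); apply: cvg_trans; apply: near_eq_cvg.
by apply: nearW => n; rewrite (qf_proj H (@ord_ON n)).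
Qed.
End onb.
End complete_space.

(** * The spectral theorem for positive operators of finite trace *)

Section spectral.
Context {R : realType} {V : lmodType R[i]}.
Local Notation C := R[i].
Variable ip : V -> V -> C.
Hypothesis H : hermitian ip.
Hypothesis cV : complete_form ip.
Local Notation Q := (qf ip).
Local Notation symmetric := (symmetric ip).
Local Notation positive := (positive ip).
Implicit Types f g h : V.

Lemma iter_symmetric T n m f g : symmetric T ->
  ip (iter n T f) (iter m T g) = ip (iter (n + m) T f) g.
Proof.
by move=> sT; elim: m n => [|m IH] n; rewrite ?addn0// iterS -sT -iterS IH addSnnS.
Qed.

Lemma symmetricB T f g h : symmetric T ->
  ip (T (f - g)) h = ip (T f) h - ip (T g) h.
Proof. by move=> sT; rewrite !sT ipBl. Qed.

Lemma symmetricZ T a f h : symmetric T -> ip (T (a *: f)) h = a * ip (T f) h.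
Proof. by move=> sT; rewrite !sT ipZl. Qed.

Section contraction.
Variable T : V -> V.
Hypotheses (sT : symmetric T) (pT : positive T).
Hypothesis T1 : forall f, Re (ip (T f) f) <= Q f.

Definition moment n f := Re (ip (iter n T f) f).

Lemma moment_double n f : moment n.*2 f = Q (iter n T f).
Proof. by rewrite /moment -addnn -iter_symmetric. Qed.

Lemma moment_doubleS n f :
  moment n.*2.+1 f = Re (ip (T (iter n T f)) (iter n T f)).
Proof. by rewrite /moment -addnn -addSn -iter_symmetric. Qed.

Lemma moment_ge0 n f : 0 <= moment n f.
Proof.
rewrite -(odd_double_half n); case: (odd n).
  by rewrite add1n moment_doubleS.
by rewrite add0n moment_double qf_ge0.
Qed.

Lemma moment_leS n f : moment n.+1 f <= moment n f.
Proof.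
rewrite -(odd_double_half n); case: (odd n); rewrite ?add1n ?add0n.
  rewrite -doubleS moment_double moment_doubleS.
  have := @qf_op_le _ _ _ H T 1 (iter n./2 T f) sT pT; rewrite mul1r; apply.
  by move=> g; rewrite mul1r.
by rewrite moment_double moment_doubleS.
Qed.

Lemma moment_nincr f : nonincreasing_seq (moment^~ f).
Proof. by apply/nonincreasing_seqP => n; exact: moment_leS. Qed.

Lemma moment_cvg f : cvgn (moment^~ f).
Proof.
apply: nonincreasing_is_cvgn; first exact: moment_nincr.
by exists 0 => _ [n _ <-]; exact: moment_ge0.
Qed.

(** The moments <T^n f, f> decrease, and
    |T^m f - T^n f|^2 is a combination of the moments 2m, 2n and m + n: hence
    the powers of a positive contraction converge. *)
Lemma iter_cvg f : exists2 g, Q (iter n T f - g) @[n --> \oo] --> 0 &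
  Q g = limn (moment^~ f).
Proof.
have cm := @moment_cvg f; have ndm := @moment_nincr f.
have [|g fg] := cV (u := fun n => iter n T f).
  move=> e e0; have e2 : 0 < e / 2 by rewrite divr_gt0.
  have /cvgrPdist_le /(_ _ e2)[N _ mN] := cm.
  exists N => m n Nm Nn; rewrite qfB// -!moment_double.
  have -> : Re (ip (iter m T f) (iter n T f)) = moment (m + n) f.
    by rewrite iter_symmetric.
  have l k : (N <= k)%N ->
      limn (moment^~ f) <= moment k f <= limn (moment^~ f) + e / 2.
    move=> Nk; rewrite (nonincreasing_cvgn_ge ndm cm) /=.
    by have := mN _ Nk; rewrite /= distrC ler_norml => /andP[_]; rewrite lerBlDl.
  have /andP[_ a1] : limn (moment^~ f) <= moment m.*2 f <= limn (moment^~ f) + e / 2.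
    by apply: l; rewrite -addnn (leq_trans Nm)// leq_addr.
  have /andP[_ a2] : limn (moment^~ f) <= moment n.*2 f <= limn (moment^~ f) + e / 2.
    by apply: l; rewrite -addnn (leq_trans Nn)// leq_addr.
  have /andP[a3 _] : limn (moment^~ f) <= moment (m + n) f <= limn (moment^~ f) + e / 2.
    by apply: l; rewrite (leq_trans Nm)// leq_addr.
  lra.
exists g => //; have := cvg_qf H fg.
rewrite (eq_cvg _ _ (fun n => esym (moment_double n f))) => c1.
apply: (cvg_unique _ c1) => //.
apply: (@cvg_comp _ _ _ double (moment^~ f) _ \oo) => //.
by apply/cvgnyPge => A; exists A => // n /= An; rewrite -addnn (leq_trans An)// leq_addr.
Qed.

Lemma iter_cvg_fixed f g : Q (iter n T f - g) @[n --> \oo] --> 0 ->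
  forall h, ip (T g) h = ip g h.
Proof.
move=> fg h; rewrite sT.
have E n : ip (iter n T f) (T h) = ip (iter n.+1 T f) h by rewrite iterS sT.
apply: eq_ReIm.
  have := cvg_Re_ip H (h := T h) fg.
  rewrite (eq_cvg _ _ (fun n => congr1 (@Re R) (E n))) => c1.
  apply: (cvg_unique _ c1) => //.
  by have := cvg_Re_ip H (h := h) fg; rewrite -(cvg_shiftS (fun n => Re (ip (iter n T f) h))).
have := cvg_Im_ip H (h := T h) fg.
rewrite (eq_cvg _ _ (fun n => congr1 (@Im R) (E n))) => c1.
apply: (cvg_unique _ c1) => //.
by have := cvg_Im_ip H (h := h) fg; rewrite -(cvg_shiftS (fun n => Im (ip (iter n T f) h))).
Qed.

(** The second difference of the moments is the form of [T], or of the
    identity, at [T g - g] for an iterate [g] of [f]. *)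
Lemma moment_convex n f :
  moment n f - moment n.+1 f <= moment 0 f - moment 1 f.
Proof.
elim: n => // n IH; apply: le_trans IH.
suff : 0 <= moment n.+2 f + moment n f - 2 * moment n.+1 f by lra.
rewrite -(odd_double_half n); case: (odd n); rewrite ?add1n ?add0n.
  have HT := positive_hermitian H sT pT; set m := n./2.
  have := qf_ge0 HT (T (iter m T f) - iter m T f).
  rewrite (qfB HT) /qf -!iterS -moment_doubleS.
  have -> : Re (ip (iter m.+2 T f) (iter m.+1 T f)) = moment m.*2.+3 f.
    by rewrite iter_symmetric// addSnnS addSn !addnS addnn.
  have -> : Re (ip (iter m.+2 T f) (iter m T f)) = moment m.*2.+2 f.
    by rewrite iter_symmetric// addSn addSn addnn.
  by lra.
set m := n./2; have := qf_ge0 H (T (iter m T f) - iter m T f).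
rewrite (qfB H) -!iterS -!moment_double doubleS.
by have -> : Re (ip (iter m.+1 T f) (iter m T f)) = moment m.*2.+1 f;
  first by rewrite iter_symmetric// addSn addnn.
Qed.

Lemma moment_lower n f : moment 0 f - n%:R * (moment 0 f - moment 1 f) <= moment n f.
Proof.
elim: n => [|n IH]; first by rewrite mul0r subr0.
have := moment_convex n f; rewrite -natr1; lra.
Qed.

Variable e : nat -> V.
Hypothesis eON : forall i j, ip (e i) (e j) = (i == j)%:R.
Hypothesis ecomplete : forall f, (forall k, ip f (e k) = 0) -> Q f = 0.

(** Parseval: the coefficients of [T^n f] are at most the norms of the
    [T^n e_k]. *)
Lemma qf_iter_le n f (B : R) : Q f <= 1 ->
  (forall m, \sum_(k < m) Q (iter n T (e k)) <= B) -> Q (iter n T f) <= B.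
Proof.
move=> f1 TB; rewrite -lee_fin -(parseval H eON cV ecomplete).
apply: nneseries_le => [k|m]; first exact: sqm_ge0.
rewrite lee_fin (le_trans _ (TB m))//; apply: ler_sum => k _.
have -> : ip (iter n T f) (e k) = ip f (iter n T (e k)).
  by rewrite -[e k]/(iter 0 T (e k)) iter_symmetric// addn0 -[f in RHS]/(iter 0 T f) iter_symmetric.
rewrite (le_trans (cauchy_schwarz H _ _))//.
by rewrite -[leRHS]mul1r ler_wpM2r// qf_ge0.
Qed.

(** Power iteration in place of compactness. If [T^n e_k] tended to 0 for every
    [k], then so would the sum over [k] of the squared norms, which the trace
    dominates; by [qf_iter_le] the squared norm of [T^n] on the unit ball would
    then fall below 1/2. But a unit vector with <T f, f> close to 1 has all its
    moments up to any given order close to 1, by convexity. So some [T^n e_k]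
    has a non-zero limit, which [T] fixes. *)
Lemma fixed_vector (t : R) :
  (forall m, \sum_(k < m) Re (ip (T (e k)) (e k)) <= t) ->
  (forall d : R, 0 < d -> exists2 f, Q f <= 1 & 1 - d < Re (ip (T f) f)) ->
  exists2 g, Q g = 1 & forall h, ip (T g) h = ip g h.
Proof.
move=> tT supT.
suff [k k0] : exists k, 0 < limn (moment^~ (e k)).
  have [g eg gE] := iter_cvg (e k); have Tg := iter_cvg_fixed eg.
  have g0 : 0 < Q g by rewrite gE.
  exists ((Num.sqrt (Q g))^-1%:C *: g).
    by rewrite (qfZ H) sqm_real exprVn sqr_sqrtr ?qf_ge0// mulVf// gt_eqF.
  by move=> h; rewrite sT !(ipZl H) -sT Tg.
apply: contrapT => noK.
have lim0 k : moment n (e k) @[n --> \oo] --> 0.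
  have := @moment_cvg (e k); suff -> : limn (moment^~ (e k)) = 0 by [].
  apply/eqP; rewrite eq_le limr_ge; [|exact: moment_cvg|by apply: nearW => n; exact: moment_ge0].
  by rewrite andbT leNgt; apply/negP => k0; apply: noK; exists k.
pose x k := moment 1 (e k).
have ndx : nondecreasing_seq (fun n => \sum_(k < n) x k).
  by apply/nondecreasing_seqP => n; rewrite big_ord_recr lerDl moment_ge0.
have cx : cvgn (fun n => \sum_(k < n) x k).
  by apply: nondecreasing_is_cvgn => //; exists t => _ [n _ <-]; exact: tT.
have q0 : (0 : R) < 4^-1 by rewrite invr_gt0.
have /cvgrPdist_le /(_ _ q0)[K _ xK] := cx.
have tail n : (K <= n)%N -> \sum_(k < n) x k - \sum_(k < K) x k <= 4^-1.
  move=> Kn; have := xK _ (leqnn K); have := nondecreasing_cvgn_le ndx cx n.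
  by rewrite /= ler_norml => ? /andP[? ?]; lra.
have [N N0 N4] : exists2 N, (0 < N)%N & \sum_(k < K) moment N.*2 (e k) < 4^-1.
  have : \sum_(k < K) moment n (e k) @[n --> \oo] --> \sum_(k < K) (0 : R).
    by apply: cvg_big => [|k _]; [exact: add_continuous|exact: lim0].
  rewrite big1// => /cvgr0Pnorm_lt /(_ _ q0)[N _ NP]; exists N.+1 => //.
  apply: le_lt_trans (NP N.+1.*2 _); first exact: ler_norm.
  by rewrite /= -addnn addSn leqW// leq_addr.
have [d d0 dN] : exists2 d : R, 0 < d & d + (N.*2)%:R * d = 2^-1.
  (* the value of d for which the 2N-th moment of f loses at most 1/2 in total *)
  exists (2 * (N.*2.+1)%:R)^-1; first by rewrite invr_gt0 mulr_gt0// ltr0n.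
  rewrite -(natr1 N.*2); have := ler0n R N.*2; move: (N.*2)%:R => n n0.
  by field; lra.
have [f f1 Tf] := supT d d0.
have {}Tf : 1 - d < moment 1 f by [].
have {}f1 : moment 0 f <= 1 by [].
have low := moment_lower N.*2 f.
have : Q (iter N T f) <= \sum_(k < K) moment N.*2 (e k) + 4^-1.
  apply: qf_iter_le => // m; apply: (@le_trans _ _ (\sum_(k < m + K) moment N.*2 (e k))).
    rewrite [leRHS]big_split_ord /=.
    under eq_bigr do rewrite -moment_double.
    by rewrite lerDl sumr_ge0// => i _; exact: moment_ge0.
  rewrite addnC.
  have := tail (K + m)%N (leq_addr _ _); rewrite !big_split_ord /= => tl.
  rewrite lerD2l; apply: le_trans (_ : \sum_(i < m) x (K + i)%N <= _); last lra.
  apply: ler_sum => i _; apply: moment_nincr.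
  by rewrite -addnn (leq_trans N0)// leq_addr.
have m01 : moment 0 f - moment 1 f <= d by lra.
have m1 : moment 1 f <= moment 0 f by exact: moment_leS.
rewrite -moment_double => up.
have up2 : (N.*2)%:R * (moment 0 f - moment 1 f) <= (N.*2)%:R * d.
  by rewrite ler_wpM2l.
lra.
Qed.
End contraction.

Section decomposition.
Variable e : nat -> V.
Hypothesis eON : forall i j, ip (e i) (e j) = (i == j)%:R.
Hypothesis ecomplete : forall f, (forall k, ip f (e k) = 0) -> Q f = 0.

(** The properties that deflation preserves. *)
Definition trace_op (T : V -> V) : Prop :=
  [/\ symmetric T, positive T,
      exists M : R, forall f, Re (ip (T f) f) <= M * Q f &
      exists t : R, forall m, \sum_(k < m) Re (ip (T (e k)) (e k)) <= t].

Definition top_eigen (T : V -> V) (p : R * V) : Prop :=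
  [/\ 0 <= p.1, forall f, Re (ip (T f) f) <= p.1 * Q f,
      forall h, ip (T p.2) h = p.1%:C * ip p.2 h &
      (p.1 = 0 /\ p.2 = 0) \/ (0 < p.1 /\ Q p.2 = 1)].

(** With [l] the supremum of the form on the unit ball, a fixed vector of
    [T / l] is an eigenvector for [l]. *)
Lemma top_eigen_exists T : trace_op T -> exists p, top_eigen T p.
Proof.
move=> [sT pT [M TM] [t Tt]].
pose A := [set Re (ip (T f) f) | f in [set f | Q f <= 1]].
have A0 : A 0 by exists 0; rewrite /= ?(qf0 H) ?ler01// (ip0r H).
have ubA : has_ubound A.
  exists (Num.max M 0) => _ [f /= f1 <-]; apply: le_trans (TM f) _.
  have := qf_ge0 H f; rewrite le_max; have [M0|M0] := leP 0 M => Qf.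
    by rewrite -[X in _ <= X]mulr1 ler_wpM2l.
  by apply/orP; right; rewrite mulr_le0_ge0// ltW.
have supA : has_sup A by split=> //; exists 0.
pose l := sup A.
have l0 : 0 <= l by exact: ub_le_sup.
have Tl f : Re (ip (T f) f) <= l * Q f.
  have := qf_ge0 H f; rewrite le_eqVlt => /predU1P[Q0|Q0].
    by rewrite -Q0 mulr0 sT ip_eq0.
  have : A (Re (ip (T f) f) / Q f).
    exists ((Num.sqrt (Q f))^-1%:C *: f) => /=.
      by rewrite (qfZ H) sqm_real exprVn sqr_sqrtr ?qf_ge0// mulVf// gt_eqF.
    rewrite sT !(ipZl H) -sT (ipZr H) conjc_real mulrA -rmorphM -expr2 exprVn.
    by rewrite sqr_sqrtr ?ltW//= !ReIm /= mul0r subr0 mulrC.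
  by move=> /(ub_le_sup ubA); rewrite ler_pdivrMr.
have [l00|lN0] := eqVneq l 0.
  by exists (0, 0); split => //= [f|h|]; rewrite -?l00 ?Tl ?sT ?ip0l ?mulr0//; left.
have lp : 0 < l by rewrite lt_neqAle eq_sym lN0.
pose T' f := l^-1%:C *: T f.
have T'E f g : ip (T' f) g = l^-1%:C * ip (T f) g by rewrite ipZl.
have ReT' f g : Re (ip (T' f) g) = l^-1 * Re (ip (T f) g).
  by rewrite T'E !ReIm /= mul0r subr0.
have [|||||g g1 T'g] := @fixed_vector T' _ _ _ e eON ecomplete (l^-1 * t).
- by move=> f g; rewrite T'E ipZr// conjc_real sT.
- by move=> f; rewrite ReT' mulr_ge0// invr_ge0.
- by move=> f; rewrite ReT' ler_pdivrMl.
- by move=> m; under eq_bigr do rewrite ReT'; rewrite -mulr_sumr ler_wpM2l// invr_ge0.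
- move=> d d0; have ld : 0 < l * d by rewrite mulr_gt0.
  have [_ [f /= f1 <-] lf] := sup_adherent ld supA.
  exists f => //; rewrite ReT' -(ltr_pM2l lp) mulrA divff// mul1r.
  by rewrite mulrBr mulr1.
exists (l, g); split => //=; last by right.
by move=> h; rewrite -T'g T'E mulrA -rmorphM divff// mul1r.
Qed.

Definition eigen (T : V -> V) : R * V := xget (0, 0) [set p | top_eigen T p].

Lemma eigenP T : trace_op T -> top_eigen T (eigen T).
Proof. by move=> /top_eigen_exists[p Tp]; exact: (xgetPex _ (ex_intro _ p Tp)). Qed.

Definition deflate (p : R * V) (T : V -> V) f :=
  T f - (p.1%:C * ip f p.2) *: p.2.

Lemma ip_deflate p T f g :
  ip (deflate p T f) g = ip (T f) g - p.1%:C * (ip f p.2 * ip p.2 g).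
Proof. by rewrite ipBl// ipZl// mulrA. Qed.

Lemma Re_deflate p T f :
  Re (ip (deflate p T f) f) = Re (ip (T f) f) - p.1 * sqm (ip f p.2).
Proof.
rewrite ip_deflate (herm_conj H f p.2) mulcJ cReD cReN; congr (_ - _).
by rewrite -rmorphM.
Qed.

Lemma deflate_trace_op T p : trace_op T -> top_eigen T p ->
  trace_op (deflate p T).
Proof.
move=> [sT pT [M TM] [t Tt]] [p0 Tp pE pN].
have le1 f : Re (ip (deflate p T f) f) <= Re (ip (T f) f).
  by rewrite Re_deflate gerBl mulr_ge0// sqm_ge0.
split.
- move=> f g; rewrite (herm_conj H _ f) !ip_deflate sT conjcB !conjcM conjc_real.
  by rewrite -!(herm_conj H) (mulrC (ip p.2 g)).
- move=> f; have [[p10 _]|[_ p1]] := pN.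
    by rewrite Re_deflate p10 mul0r subr0 pT.
  have := pT (f - ip f p.2 *: p.2).
  rewrite (symmetricB _ _ _ sT) (symmetricZ _ _ _ sT) !(ipBr H) !(ipZr H).
  have -> : ip (T f) p.2 = conjc (ip (T p.2) f) by rewrite -(herm_conj H) sT.
  rewrite !pE (qfE H) p1 conjcM conjc_real -(herm_conj H) Re_deflate.
  rewrite (herm_conj H f p.2) !ReIm /= /sqm; lra.
- by exists M => f; exact: le_trans (le1 _) (TM _).
- by exists t => m; apply: le_trans (Tt m); apply: ler_sum.
Qed.

(** The remainders T - sum_(i < n) s_i <., u_i> u_i. *)
Fixpoint remainder (T : V -> V) n : V -> V :=
  if n is m.+1 then deflate (eigen (remainder T m)) (remainder T m) else T.

Definition ev T n := (eigen (remainder T n)).1.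
Definition ef T n := (eigen (remainder T n)).2.

Variable T : V -> V.
Hypothesis tT : trace_op T.
Local Notation s := (ev T).
Local Notation u := (ef T).

Lemma remainder_trace_op n : trace_op (remainder T n).
Proof. by elim: n => //= n IH; apply: deflate_trace_op => //; exact: eigenP. Qed.

Lemma remainder_top n : top_eigen (remainder T n) (s n, u n).
Proof.
by have := eigenP (remainder_trace_op n); rewrite /ev /ef; case: eigen.
Qed.

Lemma remainder_eigen n h : ip (remainder T n (u n)) h = (s n)%:C * ip (u n) h.
Proof. by have [] := remainder_top n. Qed.

Lemma ev_ge0 n : 0 <= s n. Proof. by have [] := remainder_top n. Qed.

Lemma ef_normal n : Q (u n) = 1 \/ (s n = 0 /\ u n = 0).
Proof. by have [_ _ _ /= [?|[_ ?]]] := remainder_top n; tauto. Qed.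

Lemma ev_qf n : s n * Q (u n) = s n.
Proof. by have [->|[-> _]] := ef_normal n; rewrite ?mulr1// mul0r. Qed.

Lemma ip_remainder n f g : ip (remainder T n f) g =
  ip (T f) g - \sum_(i < n) (s i)%:C * (ip f (u i) * ip (u i) g).
Proof.
elim: n => [|n IH]; first by rewrite big_ord0 subr0.
by rewrite [LHS]ip_deflate IH big_ord_recr /= opprD addrA.
Qed.

Lemma remainder_qf n f : Re (ip (T f) f) =
  \sum_(i < n) s i * sqm (ip f (u i)) + Re (ip (remainder T n f) f).
Proof.
elim: n => [|n IH]; first by rewrite big_ord0 add0r.
by rewrite IH Re_deflate big_ord_recr /= -!addrA; congr (_ + _); rewrite addrC subrK.
Qed.

(** Each remainder annihilates the eigenvectors split off before it, and its own
    eigenvectors for non-zero values are orthogonal to its kernel. *)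
Lemma ef_orthogonal_lt i n : (i < n)%N ->
  (forall h, ip (remainder T n (u i)) h = 0) /\ ip (u i) (u n) = 0.
Proof.
elim: n => // n IH; rewrite ltnS leq_eqVlt => /predU1P lt_in.
have E h : ip (remainder T n.+1 (u i)) h = 0.
  rewrite [LHS]ip_deflate -/(s n) -/(u n).
  case: lt_in => [->|/IH[Ei ui]]; last by rewrite Ei ui mul0r mulr0 subr0.
  rewrite remainder_eigen; have [un|[-> _]] := ef_normal n.
    by rewrite (qfE H) un mul1r subrr.
  by rewrite !mul0r subr0.
split=> //; have [_ _ _ /= [[_ ->]|[sn _]]] := remainder_top n.+1; first exact: ip0r.
have [sR _ _ _] := remainder_trace_op n.+1.
have := E (u n.+1); rewrite sR (herm_conj H) remainder_eigen conjcM conjc_real.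
rewrite -(herm_conj H) => /eqP; rewrite mulf_eq0 => /orP[|/eqP//].
by rewrite eq_complex /= eqxx andbT gt_eqF.
Qed.

Lemma ef_orthogonal i j : i != j -> ip (u i) (u j) = 0.
Proof.
rewrite neq_ltn => /orP[|] /ef_orthogonal_lt[] // _.
by rewrite (herm_conj H) => /(congr1 conjc); rewrite conjcK conjc0.
Qed.

Lemma ef_eigen i h : ip (T (u i)) h = (s i)%:C * ip (u i) h.
Proof.
rewrite -remainder_eigen ip_remainder big1 ?subr0// => j _.
by rewrite ef_orthogonal ?mul0r ?mulr0// neq_ltn ltn_ord orbT.
Qed.

Lemma trace_part_le (t : R) n :
  (forall m, \sum_(k < m) Re (ip (T (e k)) (e k)) <= t) -> \sum_(i < n) s i <= t.
Proof.
move=> Tt; under eq_bigr do rewrite -ev_qf.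
have : \sum_(i < n) s i * (\sum_(k < m) sqm (ip (u i) (e k))) @[m --> \oo] -->
    \sum_(i < n) s i * Q (u i).
  apply: cvg_big => [|i _]; first exact: add_continuous.
  apply: cvgMl_tmp; apply: (iffRL (@nnseries_cvgP _ (fun k => sqm (ip (u i) (e k))) _ _)).
    by move=> k; exact: sqm_ge0.
  exact: parseval.
move=> c; rewrite -(cvg_lim _ c)//; apply: limr_le; first by apply/cvg_ex; eexists; exact: c.
apply: nearW => m; apply: le_trans (Tt m).
under eq_bigr do rewrite mulr_sumr.
rewrite exchange_big /=; apply: ler_sum => k _.
under eq_bigr do rewrite (sqm_ipC H).
rewrite (remainder_qf n) lerDl.
by have [_ pR _ _] := remainder_trace_op n.
Qed.

End decomposition.

(** Eigenvalues [s] and eigenvectors [u], the latter orthonormal up to the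
    convention that [u i = 0] when there is no further eigenvector; [t] is the
    trace. *)
Record eigen_system (T : V -> V) (s : nat -> R) (u : nat -> V) (t : R) : Prop :=
  EigenSystem {
  es_ge0 : forall i, 0 <= s i;
  es_orth : forall i j, i != j -> ip (u i) (u j) = 0;
  es_normal : forall i, Q (u i) = 1 \/ (s i = 0 /\ u i = 0);
  es_eigen : forall i h, ip (T (u i)) h = (s i)%:C * ip (u i) h;
  es_rem : forall n f,
    0 <= Re (ip (T f) f) - \sum_(i < n) s i * sqm (ip f (u i)) <= s n * Q f;
  es_diag : forall f,
    (\sum_(0 <= i <oo) (s i * sqm (ip f (u i)))%:E = (Re (ip (T f) f))%:E)%E;
  es_sum : (\sum_(0 <= i <oo) (s i)%:E = t%:E)%E }.

(** Deflation: the largest eigenvalue [s n] of the [n]-th remainder bounds its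
    form, and tends to 0 because the trace bounds the sum of the [s i]. *)
Theorem spectral_decomposition (e : nat -> V) (T : V -> V) (t M : R) :
  (forall i j, ip (e i) (e j) = (i == j)%:R) ->
  (forall f, (forall k, ip f (e k) = 0) -> Q f = 0) ->
  symmetric T -> positive T -> (forall f, Re (ip (T f) f) <= M * Q f) ->
  (\sum_(0 <= k <oo) (Re (ip (T (e k)) (e k)))%:E = t%:E)%E ->
  exists s u, eigen_system T s u t.
Proof.
move=> eON ec sT pT TM Tt.
have Tm m : \sum_(k < m) Re (ip (T (e k)) (e k)) <= t.
  by rewrite -lee_fin -Tt; apply: le_nneseries => k; exact: pT.
have tT : trace_op e T by split=> //; [exists M|exists t].
pose s := ev T; pose u := ef T.
have s0 i : 0 <= s i by exact: (ev_ge0 eON ec tT).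
have rem n f : 0 <= Re (ip (T f) f) - \sum_(i < n) s i * sqm (ip f (u i)) <= s n * Q f.
  rewrite (remainder_qf T n f) addrC addKr.
  have [_ -> _ _] := remainder_trace_op eON ec tT n.
  by have [_ /(_ f)] := remainder_top eON ec tT n.
have sumle n : \sum_(i < n) s i <= t by exact: (trace_part_le eON ec tT).
have s_cvg0 : s n @[n --> \oo] --> 0.
  have cs : cvgn (series s).
    apply: nondecreasing_is_cvgn.
      by apply/nondecreasing_seqP => n; rewrite seriesSr lerDl.
    by exists t => _ [n _ <-]; rewrite /series /= big_mkord.
  exact: cvg_series_cvg_0.
have diag f : (\sum_(0 <= i <oo) (s i * sqm (ip f (u i)))%:E =
    (Re (ip (T f) f))%:E)%E.
  apply: (iffLR (@nnseries_cvgP _ (fun i => s i * sqm (ip f (u i))) _ _)).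
    by move=> i; rewrite mulr_ge0// sqm_ge0.
  apply/cvgrPdist_le => d d0.
  have : s n * Q f @[n --> \oo] --> 0.
    by rewrite -(mul0r (Q f)); apply: cvgMr_tmp.
  move/cvgr0Pnorm_le => /(_ _ d0); apply: filterS => n.
  have /andP[r0 rn] := rem n f; rewrite (ger0_norm r0); apply: le_trans.
  exact: le_trans rn (ler_norm _).
exists s, u; split => //.
- by move=> i j; exact: (ef_orthogonal eON ec tT).
- by move=> i; exact: (ef_normal eON ec tT).
- by move=> i h; exact: (ef_eigen eON ec tT).
rewrite -Tt; under [RHS]eq_eseriesr do rewrite -diag.
rewrite nneseries_interchange; last by move=> *; rewrite lee_fin mulr_ge0// sqm_ge0.
apply: eq_eseriesr => i _.
under eq_eseriesr do rewrite EFinM (sqm_ipC H).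
rewrite nneseriesZl; last by move=> k _; rewrite lee_fin sqm_ge0.
by rewrite (parseval H eON cV ec) -EFinM (ev_qf eON ec tT).
Qed.

End spectral.

(** * Concavity of -x log x *)

Section real_inequalities.
Context {R : realType}.

Lemma sqr_sum_le n (x a b : nat -> R) : (forall k, 0 <= a k) ->
  (forall k, 0 <= b k) -> (forall k, x k ^+ 2 <= a k * b k) ->
  (\sum_(k < n) x k) ^+ 2 <= (\sum_(k < n) a k) * (\sum_(k < n) b k).
Proof.
move=> a0 b0 xab; elim: n => [|n IH]; first by rewrite !big_ord0 expr0n mul0r.
rewrite !big_ord_recr /=.
have A0 : 0 <= \sum_(k < n) a k by exact: sumr_ge0.
have B0 : 0 <= \sum_(k < n) b k by exact: sumr_ge0.
move: IH A0 B0 (a0 n) (b0 n) (xab n).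
move: (\sum_(_ < n) x _) (\sum_(_ < n) a _) (\sum_(_ < n) b _).
move: (x n) (a n) (b n) => y p q X A B XAB A0 B0 p0 q0 ypq.
suff : 2 * (X * y) <= A * q + p * B by rewrite sqrrD mulrDl !mulrDr -mulr_natl; lra.
have Aq : 0 <= A * q by rewrite mulr_ge0.
have pB : 0 <= p * B by rewrite mulr_ge0.
have le2 : (X * y) ^+ 2 <= (A * q) * (p * B).
  rewrite exprMn; have -> : A * q * (p * B) = (A * B) * (p * q) by ring.
  by rewrite ler_pM ?sqr_ge0.
move: (X * y) (A * q) (p * B) Aq pB le2 => z r t r0 t0 le2.
rewrite leNgt; apply/negP => lt; have := sqr_ge0 (r - t).
have : 0 <= r + t by rewrite addr_ge0.
nra.
Qed.

Definition ent (x : R) := - (x * ln x).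

Lemma ent_ge0 x : x <= 1 -> 0 <= ent x.
Proof.
move=> x1; rewrite /ent oppr_ge0; have [x0|x0] := leP x 0.
  by rewrite (ln0 x0) mulr0.
by rewrite mulr_ge0_le0 ?(ltW x0)// ln_le0.
Qed.

Lemma ln_le_subr1 (x : R) : 0 < x -> ln x <= x - 1.
Proof.
move=> x0; have := @le_ln1Dx R (x - 1).
by rewrite (_ : 1 + (x - 1) = x); [apply; lra|ring].
Qed.

(** Concavity: the tangent at [x] lies above the graph. *)
Lemma ent_tangent x m : 0 < x -> 0 <= m -> ent m <= x - m - m * ln x.
Proof.
move=> x0; rewrite le_eqVlt => /predU1P[<-|m0].
  by rewrite /ent !mul0r oppr0; lra.
have le1 : ln x - ln m <= x / m - 1.
  by rewrite -ln_div ?posrE// ln_le_subr1// divr_gt0.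
rewrite /ent; have : m * (ln x - ln m) <= m * (x / m - 1) by rewrite ler_pM2l.
by rewrite mulrBr mulrBr mulr1 mulrCA divff ?gt_eqF// mulr1; lra.
Qed.

(** Jensen with weights of total mass less than 1: the missing mass
    [1 - sum w] is imagined at points of [0, 1], where the function is
    non-negative, and these account for the missing mean [x - sum w m]. *)
Lemma ent_jensen (I : finType) (w m : I -> R) (x : R) :
  (forall i, 0 <= w i) -> (forall i, 0 <= m i) -> 0 <= x <= 1 ->
  0 <= x - \sum_i w i * m i <= 1 - \sum_i w i ->
  \sum_i w i * ent (m i) <= ent x.
Proof.
move=> w0 m0 /andP[]; rewrite le_eqVlt => /predU1P[<-{x} _|x0 x1] /andP[le1 le2].
  rewrite {2}/ent mul0r oppr0.
  have /eqP : \sum_i w i * m i = 0.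
    by apply/eqP; rewrite eq_le sumr_ge0 ?andbT// => [|i _]; [lra|exact: mulr_ge0].
  rewrite psumr_eq0 => [|i _]; last exact: mulr_ge0.
  move=> /allP z; rewrite big1// => i _.
  have /eqP := z i (mem_index_enum i); rewrite /ent mulrN mulrA => ->.
  by rewrite mul0r oppr0.
have lnx : ln x <= 0 by exact: ln_le0.
apply: (@le_trans _ _ (\sum_i w i * (x - m i - m i * ln x))).
  by apply: ler_sum => i _; rewrite ler_wpM2l// ent_tangent.
have -> : \sum_i w i * (x - m i - m i * ln x) =
    x * (\sum_i w i) - (1 + ln x) * \sum_i w i * m i.
  rewrite !mulr_sumr -sumrB; apply: eq_bigr => i _; ring.
rewrite /ent; set W := \sum_i w i in le2 *; set Y := \sum_i w i * m i in le1 le2 *.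
have lnx1 : ln x <= x - 1 by exact: ln_le_subr1.
(* the two defects between the averaged tangents and ent x *)
have d0 : 0 <= (x - Y) * (x - 1 - ln x) by apply: mulr_ge0 => //; lra.
have w1 : 0 <= x * (1 - W - (x - Y)) by apply: mulr_ge0; lra.
lra.
Qed.
End real_inequalities.

(** * Eigen-systems and traces of products *)

Section hilbert.
Context {R : realType} {V : lmodType R[i]}.
Local Notation C := R[i].
Variable ip : V -> V -> C.
Hypothesis H : hermitian ip.
Hypothesis cV : complete_form ip.
Local Notation Q := (qf ip).
Local Notation symmetric := (symmetric ip).
Local Notation positive := (positive ip).
Implicit Types f g h : V.

(** The orthogonal projection splits the form of [A], and its part on the
    complement is the value at [g - proj g], to which 0 <= A <= 1 applies. *)
Lemma finite_eigen_gap (I : finType) (v : I -> V) (m : I -> R) (A : V -> V) g :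
  (forall i j, ip (v i) (v j) = (i == j)%:R) ->
  (forall i h, ip (A (v i)) h = (m i)%:C * ip (v i) h) ->
  symmetric A -> positive A -> (forall f, Re (ip (A f) f) <= Q f) ->
  0 <= Re (ip (A g) g) - \sum_i sqm (ip g (v i)) * m i
    <= Q g - \sum_i sqm (ip g (v i)).
Proof.
move=> vON vE sA pA A1; rewrite -(qf_subproj H vON).
suff <- : Re (ip (A (g - proj ip v g)) (g - proj ip v g)) =
  Re (ip (A g) g) - \sum_i sqm (ip g (v i)) * m i by rewrite pA A1.
have E f : ip (A (proj ip v g)) f = \sum_i ip g (v i) * ((m i)%:C * ip (v i) f).
  rewrite sA (ip_projl H); apply: eq_bigr => i _.
  by rewrite -sA vE.
have Ef (f : V) : (forall i, ip (v i) f = conjc (ip g (v i))) ->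
    Re (ip (A (proj ip v g)) f) = \sum_i sqm (ip g (v i)) * m i.
  move=> fE; rewrite E Re_sum; apply: eq_bigr => i _.
  by rewrite fE mulrCA mulcJ -rmorphM /= mulrC.
have Eg : Re (ip (A (proj ip v g)) g) = \sum_i sqm (ip g (v i)) * m i.
  by apply: Ef => i; rewrite (herm_conj H).
have Ep : Re (ip (A (proj ip v g)) (proj ip v g)) = \sum_i sqm (ip g (v i)) * m i.
  by apply: Ef => i; rewrite (herm_conj H) (ip_proj H vON).
have Egp : Re (ip (A g) (proj ip v g)) = \sum_i sqm (ip g (v i)) * m i.
  by rewrite sA (herm_conj H) cReJ.
by rewrite (symmetricB H _ _ _ sA) !(ipBr H) !ReIm Eg Ep Egp; lra.
Qed.

Section eigen_system.
Variables (S : V -> V) (s : nat -> R) (u : nat -> V) (t : R).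
Hypotheses (sS : symmetric S) (pS : positive S).
Hypothesis Su : eigen_system ip S s u t.

Lemma es_partial_le n : \sum_(i < n) s i <= t.
Proof. by rewrite -lee_fin -(es_sum Su); apply: le_nneseries => i; exact: (es_ge0 Su). Qed.

Lemma es_le f : Re (ip (S f) f) <= t * Q f.
Proof.
have /andP[_] := es_rem Su 0 f; rewrite big_ord0 subr0 => /le_trans; apply.
rewrite ler_wpM2r ?qf_ge0//.
by have := es_partial_le 1; rewrite big_ord1.
Qed.

Definition finite_part n f := \sum_(i < n) (s i)%:C *: (ip f (u i) *: u i).
Definition rest n f := S f - finite_part n f.

Lemma ip_finite_part n f g :
  ip (finite_part n f) g = \sum_(i < n) (s i)%:C * (ip f (u i) * ip (u i) g).
Proof.
by rewrite (ip_suml H); apply: eq_bigr => i _; rewrite !(ipZl H).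
Qed.

Lemma rest_symmetric n : symmetric (rest n).
Proof.
move=> f g; rewrite (ipBl H) (ipBr H) sS; congr (_ - _).
rewrite (herm_conj H _ f) !ip_finite_part; apply: eq_ReIm.
  rewrite cReJ !Re_sum; apply: eq_bigr => i _.
  by rewrite (herm_conj H f) (herm_conj H _ g) !ReIm /=; ring.
rewrite cImJ !Im_sum -sumrN; apply: eq_bigr => i _.
by rewrite (herm_conj H f) (herm_conj H _ g) !ReIm /=; ring.
Qed.

Lemma Re_rest n f :
  Re (ip (rest n f) f) = Re (ip (S f) f) - \sum_(i < n) s i * sqm (ip f (u i)).
Proof.
rewrite (ipBl H) cReD cReN ip_finite_part Re_sum; congr (_ - _).
apply: eq_bigr => i _; rewrite (herm_conj H f) mulcJ.
by rewrite -rmorphM.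
Qed.

Lemma rest_positive n : positive (rest n).
Proof. by move=> f; rewrite Re_rest; have /andP[] := es_rem Su n f. Qed.

Lemma rest_le n f : Re (ip (rest n f) f) <= s n * Q f.
Proof. by rewrite Re_rest; have /andP[] := es_rem Su n f. Qed.

Lemma rest_cs n f g :
  sqm (ip (rest n f) g) <= Re (ip (rest n f) f) * Re (ip (rest n g) g).
Proof.
exact: (cauchy_schwarz (positive_hermitian H (@rest_symmetric n) (@rest_positive n))).
Qed.

Lemma es_cvg0 : s n @[n --> \oo] --> 0.
Proof.
have cs : cvgn (series s).
  apply: nondecreasing_is_cvgn.
    by apply/nondecreasing_seqP => n; rewrite seriesSr lerDl (es_ge0 Su).
  by exists t => _ [n _ <-]; rewrite /series /= big_mkord es_partial_le.
exact: cvg_series_cvg_0.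
Qed.

(** Off the diagonal, by Cauchy--Schwarz for the form of the rest. *)
Lemma finite_part_cvg f g :
  sqm (ip (finite_part n f) g - ip (S f) g) @[n --> \oo] --> 0.
Proof.
have : s n ^+ 2 * (Q f * Q g) @[n --> \oo] --> 0 ^+ 2 * (Q f * Q g).
  by apply: cvgMr_tmp; rewrite expr2; apply: cvgM; exact: es_cvg0.
rewrite expr0n mul0r; apply: squeeze_cvgr; last exact: cvg_cst.
apply: nearW => n; rewrite sqm_ge0 -sqmN opprB -(ipBl H) -/(rest n f).
rewrite (le_trans (rest_cs _ _ _))//.
have -> : s n ^+ 2 * (Q f * Q g) = (s n * Q f) * (s n * Q g) by ring.
by apply: ler_pM; rewrite ?rest_le ?rest_positive.
Qed.

Section trace_of_product.
Variable e : nat -> V.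
Hypothesis eON : forall i j, ip (e i) (e j) = (i == j)%:R.
Hypothesis ecomplete : forall f, (forall k, ip f (e k) = 0) -> Q f = 0.
Hypothesis et : (\sum_(0 <= k <oo) (Re (ip (S (e k)) (e k)))%:E = t%:E)%E.

Variables (T : V -> V) (M t' : R).
Hypotheses (sT : symmetric T) (pT : positive T).
Hypothesis M0 : 0 <= M.
Hypothesis TM : forall f, Re (ip (T f) f) <= M * Q f.
Hypothesis Tt : forall n, \sum_(k < n) Re (ip (T (e k)) (e k)) <= t'.

Lemma trace_finite_part n m :
  \sum_(k < n) ip (finite_part m (T (e k))) (e k) =
  \sum_(i < m) (s i)%:C * ip (projn ip e n (u i)) (T (u i)).
Proof.
under eq_bigr do rewrite ip_finite_part.
rewrite exchange_big /=; apply: eq_bigr => i _; rewrite -mulr_sumr.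
congr (_ * _); rewrite (ip_projl H); apply: eq_bigr => k _.
by rewrite mulrC sT.
Qed.

(* [phi] stands for the real and the imaginary part. *)
Variable phi : R[i] -> R.
Hypothesis phiD : {morph phi : x y / x + y}.
Hypothesis phi_sqr : forall c, phi c ^+ 2 <= sqm c.
Hypothesis phiR : forall (x : R) c, phi (x%:C * c) = x * phi c.

Lemma phi_sum n (F : nat -> R[i]) : phi (\sum_(k < n) F k) = \sum_(k < n) phi (F k).
Proof.
elim: n => [|n IH]; last by rewrite !big_ord_recr phiD IH.
by rewrite !big_ord0 -(mul0r 0) phiR mul0r.
Qed.

Lemma phiN c : phi (- c) = - phi c.
Proof. by rewrite -mulN1r -[- phi c]mulN1r -phiR rmorphN1. Qed.

(** Cauchy--Schwarz for the form of the rest, then for the sum over [k]; the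
    eigenvalue [s m] makes the bound uniform in [n]. *)
Lemma trace_rest_le n m :
  phi (\sum_(k < n) ip (rest m (T (e k))) (e k)) ^+ 2 <= s m * (M * t' * t).
Proof.
rewrite [leRHS]mulrA.
pose a k := Re (ip (rest m (T (e k))) (T (e k))).
pose b k := Re (ip (rest m (e k)) (e k)).
rewrite (phi_sum n (fun k => ip (rest m (T (e k))) (e k))).
have le1 : (\sum_(k < n) phi (ip (rest m (T (e k))) (e k))) ^+ 2 <=
    (\sum_(k < n) a k) * (\sum_(k < n) b k).
  apply: (@sqr_sum_le _ n (fun k => phi (ip (rest m (T (e k))) (e k)))) => k.
  - exact: rest_positive.
  - exact: rest_positive.
  - exact: le_trans (phi_sqr _) (rest_cs _ _ _).
apply: (le_trans le1); apply: ler_pM.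
- by rewrite sumr_ge0// => k _; exact: rest_positive.
- by rewrite sumr_ge0// => k _; exact: rest_positive.
- apply: (@le_trans _ _ (\sum_(k < n) s m * (M * Re (ip (T (e k)) (e k))))).
    apply: ler_sum => k _; apply: le_trans (rest_le _ _) _.
    by rewrite ler_wpM2l ?(es_ge0 Su)// (qf_op_le H _ sT pT TM).
  rewrite -!mulr_sumr ler_wpM2l ?(es_ge0 Su)//.
  by rewrite ler_wpM2l.
apply: (@le_trans _ _ (\sum_(k < n) Re (ip (S (e k)) (e k)))).
  apply: ler_sum => k _; rewrite /b Re_rest gerBl.
  by rewrite sumr_ge0// => i _; rewrite mulr_ge0 ?sqm_ge0 ?(es_ge0 Su).
by rewrite -lee_fin -et; apply: le_nneseries => k; exact: pS.
Qed.

Lemma trace_product_phi (L : R) :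
  \sum_(i < m) s i * phi (ip (u i) (T (u i))) @[m --> \oo] --> L ->
  phi (\sum_(k < n) ip (S (T (e k))) (e k)) @[n --> \oo] --> L.
Proof.
move=> uL; apply/cvgrPdist_le => d d0.
have d3 : 0 < d / 3 by lra.
have d9 : 0 < (d / 3) ^+ 2 by rewrite exprn_gt0.
have small : s m * (M * t' * t) @[m --> \oo] --> 0.
  by rewrite -(mul0r (M * t' * t)); apply: cvgMr_tmp; exact: es_cvg0.
move/cvgrPdist_le : uL => /(_ _ d3)[m1 _ P1].
move/cvgr0Pnorm_le : small => /(_ _ d9)[m2 _ P2].
pose m := maxn m1 m2.
have {P1} := P1 m (leq_maxl _ _); have {P2} := P2 m (leq_maxr _ _).
rewrite /= => P2 P1.
have : \sum_(i < m) s i * phi (ip (projn ip e n (u i)) (T (u i))) @[n --> \oo] -->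
    \sum_(i < m) s i * phi (ip (u i) (T (u i))).
  apply: cvg_big => [|i _]; first exact: add_continuous.
  apply: cvgMl_tmp; apply/subr_cvg0.
  apply: (@cvg_sqr_le0 _ _ (fun n => Q (projn ip e n (u i) - u i) * Q (T (u i)))).
    move=> n; apply: le_trans (cauchy_schwarz H _ _); rewrite (ipBl H).
    by apply: le_trans (phi_sqr _); rewrite phiD phiN.
  rewrite -(mul0r (Q (T (u i)))); apply: cvgMr_tmp.
  exact: projn_cvg.
move/cvgrPdist_le => /(_ _ d3); apply: filterS => n P3.
have E : phi (\sum_(k < n) ip (S (T (e k))) (e k)) =
    \sum_(i < m) s i * phi (ip (projn ip e n (u i)) (T (u i))) +
    phi (\sum_(k < n) ip (rest m (T (e k))) (e k)).
  have -> : \sum_(i < m) s i * phi (ip (projn ip e n (u i)) (T (u i))) =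
      phi (\sum_(k < n) ip (finite_part m (T (e k))) (e k)).
    rewrite trace_finite_part.
    rewrite (phi_sum m (fun i => (s i)%:C * ip (projn ip e n (u i)) (T (u i)))).
    by apply: eq_bigr => i _; rewrite phiR.
  rewrite -phiD -big_split; congr phi; apply: eq_bigr => k _ /=.
  by rewrite -(ipDl H) /rest addrC subrK.
have P4 : `|phi (\sum_(k < n) ip (rest m (T (e k))) (e k))| <= d / 3.
  rewrite -(@ler_pXn2r _ 2%N)// ?nnegrE// ?(ltW d3)// real_normK ?num_real//.
  rewrite (le_trans (trace_rest_le n m))// (le_trans (ler_norm _))//.
rewrite E; move: P1 P3 P4; rewrite !ler_norml => /andP[? ?] /andP[? ?] /andP[? ?].
by apply/andP; split; lra.
Qed.

End trace_of_product.

(** Parseval gives the contribution of the finite part of [S], and the rest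
    contributes little, uniformly in the number of terms. The right-hand side
    does not involve the basis [e]. *)
Theorem trace_product (e : nat -> V) (T : V -> V) (M t' l : R) :
  (forall i j, ip (e i) (e j) = (i == j)%:R) ->
  (forall f, (forall k, ip f (e k) = 0) -> Q f = 0) ->
  (\sum_(0 <= k <oo) (Re (ip (S (e k)) (e k)))%:E = t%:E)%E ->
  symmetric T -> positive T -> 0 <= M ->
  (forall f, Re (ip (T f) f) <= M * Q f) ->
  (forall n, \sum_(k < n) Re (ip (T (e k)) (e k)) <= t') ->
  (\sum_(0 <= i <oo) (s i * Re (ip (T (u i)) (u i)))%:E = l%:E)%E ->
  csum (fun k => ip (S (T (e k))) (e k)) l%:C.
Proof.
move=> eON ec et sT pT M0 TM Tt sl.
have E (phi : R[i] -> R) n : series (fun k => phi (ip (S (T (e k))) (e k))) n =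
  \sum_(k < n) phi (ip (S (T (e k))) (e k)) by rewrite /series /= big_mkord.
split; rewrite (eq_cvg _ _ (E _)).
  under eq_fun do rewrite -Re_sum.
  apply: (trace_product_phi eON ec et sT pT M0 TM Tt (@cReD R)).
  - exact: Re_sqr_le.
  - by move=> x c; rewrite cReM /= mul0r subr0.
  rewrite (_ : (fun m => _) = (fun m => \sum_(i < m) s i * Re (ip (T (u i)) (u i)))).
    apply: (iffRL (@nnseries_cvgP _ (fun i => s i * Re (ip (T (u i)) (u i))) _ _)) => //.
    by move=> i; rewrite mulr_ge0 ?(es_ge0 Su).
  by apply/funext => m; apply: eq_bigr => i _; rewrite sT.
under eq_fun do rewrite -Im_sum.
apply: (trace_product_phi eON ec et sT pT M0 TM Tt (@cImD R)).
- exact: Im_sqr_le.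
- by move=> x c; rewrite cImM /= mul0r addr0.
rewrite (_ : (fun m => _) = fun=> 0); first exact: cvg_cst.
apply/funext => m; rewrite big1// => i _.
by have := qfE (positive_hermitian H sT pT) (u i); rewrite sT => ->; rewrite mulr0.
Qed.
End eigen_system.

Section riesz.
Variable e : nat -> V.
Hypothesis eON : forall i j, ip (e i) (e j) = (i == j)%:R.
Hypothesis ecomplete : forall f, (forall k, ip f (e k) = 0) -> Q f = 0.

(** The vector is sum_k F(e_k) e_k; testing [F] on the partial sums bounds their
    norms. *)
Lemma riesz (F : V -> C) (M : R) : 0 <= M ->
  (forall a f g, F (a *: f + g) = conjc a * F f + F g) ->
  (forall f, sqm (F f) <= M * Q f) ->
  exists a, forall h, F h = ip a h.
Proof.
move=> M0 Flin FM.
have F0 : F 0 = 0.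
  by apply: sqm_eq0; apply/eqP; rewrite eq_le sqm_ge0 andbT (le_trans (FM 0))// (qf0 H) mulr0.
have FD f g : F (f + g) = F f + F g by rewrite -[f]scale1r Flin conjc1 mul1r scale1r.
have FZ a f : F (a *: f) = conjc a * F f by rewrite -[a *: f]addr0 Flin F0 addr0.
have FN f : F (- f) = - F f by rewrite -scaleN1r FZ conjcN conjc1 mulN1r.
have Fsum n (G : nat -> V) : F (\sum_(k < n) G k) = \sum_(k < n) F (G k).
  by elim: n => [|n IH]; rewrite ?big_ord0// !big_ord_recr /= FD IH.
pose w n := \sum_(k < n) F (e k) *: e k.
pose x k := sqm (F (e k)).
have x0 k : 0 <= x k by exact: sqm_ge0.
have we n k : ip (w n) (e k) = if (k < n)%N then F (e k) else 0.
  rewrite (ip_suml H); under eq_bigr do rewrite (ipZl H) eON.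
  case: ltnP => kn.
    rewrite (bigD1 (Ordinal kn))//= eqxx mulr1 big1 ?addr0// => i /negbTE.
    by rewrite -val_eqE /= => ->; rewrite mulr0.
  rewrite big1// => i _; rewrite ltn_eqF ?mulr0//.
  exact: leq_trans (ltn_ord i) kn.
have wQ n m : (n <= m)%N -> Re (ip (w m) (w n)) = \sum_(k < n) x k.
  move=> nm; rewrite {2}/w (ip_sumr H) Re_sum; apply: eq_bigr => k _.
  by rewrite (ipZr H) we (leq_trans (ltn_ord k) nm) mulrC mulcJ.
have Fw n : F (w n) = (\sum_(k < n) x k)%:C.
  rewrite /w (Fsum n (fun k => F (e k) *: e k)) rmorph_sum /=; apply: eq_bigr => k _.
  by rewrite FZ mulrC mulcJ.
have bx n : \sum_(k < n) x k <= M.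
  have := FM (w n); rewrite Fw sqm_real /qf wQ//.
  have : 0 <= \sum_(k < n) x k by exact: sumr_ge0.
  rewrite le_eqVlt => /predU1P[<-//|X0].
  by rewrite expr2 ler_pM2r.
have ndx : nondecreasing_seq (fun n => \sum_(k < n) x k).
  by apply/nondecreasing_seqP => n; rewrite big_ord_recr lerDl.
have cx : cvgn (fun n => \sum_(k < n) x k).
  by apply: nondecreasing_is_cvgn => //; exists M => _ [n _ <-].
have [|a wa] := cV (u := w).
  move=> eps eps0; have /cvgrPdist_le /(_ eps eps0)[N _ xN] := cx.
  exists N.
  have key m n : (N <= n)%N -> (n <= m)%N -> Q (w m - w n) <= eps.
    move=> Nn nm; rewrite (qfB H) {1 2}/qf !wQ//.
    have := xN _ Nn; have := nondecreasing_cvgn_le ndx cx m.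
    rewrite /= ler_norml => ? /andP[? ?]; lra.
  move=> m n Nm Nn; have [nm|mn] := leqP n m; first exact: key.
  by rewrite (qfBC H); apply: key => //; exact: ltnW.
exists a => h.
have ae k : ip a (e k) = F (e k).
  apply: eq_ReIm.
    apply: (cvg_unique _ (cvg_Re_ip H (h := e k) wa)) => //.
    by apply: cvg_near_cst; exists k.+1 => // n /= kn; rewrite we kn.
  apply: (cvg_unique _ (cvg_Im_ip H (h := e k) wa)) => //.
  by apply: cvg_near_cst; exists k.+1 => // n /= kn; rewrite we kn.
have FP n : F (projn ip e n h) = ip a (projn ip e n h).
  rewrite /projn /proj (Fsum n (fun k => ip h (e k) *: e k)) (ip_sumr H).
  by apply: eq_bigr => k _; rewrite FZ (ipZr H) ae.
have bnd n : sqm (F h - ip a h) <= 2 * (M + Q a) * Q (projn ip e n h - h).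
  set p := projn ip e n h; have Fp : F p = ip a p by exact: FP.
  have -> : F h - ip a h = F (h - p) - ip a (h - p).
    by rewrite FD FN (ipBr H) Fp opprB addrA subrK.
  have := FM (h - p); have := cauchy_schwarz H a (h - p).
  rewrite (qfBC H p h); set c := F _; set c' := ip _ _.
  have : sqm (c - c') <= 2 * sqm c + 2 * sqm c'.
    rewrite /sqm !ReIm; have := sqr_ge0 (Re c + Re c').
    by have := sqr_ge0 (Im c + Im c'); lra.
  lra.
apply/eqP; rewrite -subr_eq0; apply/eqP/sqm_eq0/eqP.
rewrite eq_le sqm_ge0 andbT.
have c0 : 2 * (M + Q a) * Q (projn ip e n h - h) @[n --> \oo] --> 0.
  rewrite -(mulr0 (2 * (M + Q a))); apply: cvgMl_tmp; exact: projn_cvg.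
rewrite -(cvg_lim _ c0)//; apply: limr_ge; first by apply/cvg_ex; eexists; exact: c0.
exact: nearW.
Qed.
End riesz.
End hilbert.

(** * Complex integrals and the space of square-integrable functions *)

Section complex_integral.
Context {R : realType} d' (T : measurableType d').
Local Notation C := R[i].
Implicit Types f g : T -> C.

Definition cmeasurable f :=
  measurable_fun setT (fun x => Re (f x)) /\ measurable_fun setT (fun x => Im (f x)).

Lemma cmeasurable_cst c : cmeasurable (fun=> c).
Proof. by split; exact: measurable_cst. Qed.

Lemma cmeasurableD f g : cmeasurable f -> cmeasurable g ->
  cmeasurable (fun x => f x + g x).
Proof.
move=> [fR fI] [gR gI]; split.
- by under eq_fun do rewrite cReD; exact: measurable_funD.
- by under eq_fun do rewrite cImD; exact: measurable_funD.
Qed.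

Lemma cmeasurableM f g : cmeasurable f -> cmeasurable g ->
  cmeasurable (fun x => f x * g x).
Proof.
move=> [fR fI] [gR gI]; split.
- by under eq_fun do rewrite cReM; apply: measurable_funB; exact: measurable_funM.
- by under eq_fun do rewrite cImM; apply: measurable_funD; exact: measurable_funM.
Qed.

Lemma cmeasurableJ f : cmeasurable f -> cmeasurable (fun x => conjc (f x)).
Proof.
move=> [fR fI]; split.
- by under eq_fun do rewrite cReJ.
- by under eq_fun do rewrite cImJ; exact: measurable_funN.
Qed.

Lemma cmeasurableN f : cmeasurable f -> cmeasurable (fun x => - f x).
Proof.
move=> [fR fI]; split.
- by under eq_fun do rewrite cReN; exact: measurable_funN.
- by under eq_fun do rewrite cImN; exact: measurable_funN.
Qed.

Lemma cmeasurableB f g : cmeasurable f -> cmeasurable g ->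
  cmeasurable (fun x => f x - g x).
Proof. by move=> mf mg; apply: cmeasurableD => //; exact: cmeasurableN. Qed.

Lemma cmeasurable_real (f : T -> R) : measurable_fun setT f ->
  cmeasurable (fun x => (f x)%:C).
Proof. by move=> mf; split => //; exact: measurable_cst. Qed.

Lemma measurable_sqm f : cmeasurable f -> measurable_fun setT (fun x => sqm (f x)).
Proof. by move=> [mR mI]; apply: measurable_funD; exact: measurable_funX. Qed.

Lemma cmeasurable_sum I (r : seq I) (F : I -> T -> C) :
  (forall i, cmeasurable (F i)) -> cmeasurable (fun x => \sum_(i <- r) F i x).
Proof.
move=> mF; elim: r => [|i r IH].
  by under eq_fun do rewrite big_nil; exact: cmeasurable_cst.
by under eq_fun do rewrite big_cons; exact: cmeasurableD.
Qed.

Lemma cmeasurable_comp d2 (T2 : measurableType d2) (h : T2 -> T) f :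
  measurable_fun setT h -> cmeasurable f ->
  measurable_fun setT (fun x => Re (f (h x))) /\ measurable_fun setT (fun x => Im (f (h x))).
Proof.
move=> mh [fR fI]; split.
- exact: (measurableT_comp fR mh).
- exact: (measurableT_comp fI mh).
Qed.

Variable nu : {measure set T -> \bar R}.

Definition cintegrable f :=
  nu.-integrable setT (fun x => (Re (f x))%:E) /\
  nu.-integrable setT (fun x => (Im (f x))%:E).

Lemma cintegrable_dominated f (g : T -> R) : cmeasurable f ->
  (forall x, 0 <= g x) -> (forall x, sqm (f x) <= g x ^+ 2) ->
  nu.-integrable setT (fun x => (g x)%:E) -> cintegrable f.
Proof.
move=> [fR fI] g0 fg ig.
have key (h : T -> R) : measurable_fun setT h -> (forall x, h x ^+ 2 <= sqm (f x)) ->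
    nu.-integrable setT (fun x => (h x)%:E).
  move=> mh hf; apply: le_integrable ig => //; first exact/measurable_EFinP.
  move=> x _ /=; rewrite lee_fin (ger0_norm (g0 x)).
  rewrite -(@ler_pXn2r _ 2%N)// ?nnegrE// real_normK ?num_real//.
  exact: le_trans (hf x) (fg x).
by split; apply: key => // x; rewrite ?Re_sqr_le ?Im_sqr_le.
Qed.

Lemma eq_cintegral f g : f =1 g -> cintegral nu f = cintegral nu g.
Proof. by move=> fg; congr (cintegral nu _); exact: funext. Qed.

Lemma cintegrableZ a f : cintegrable f -> cintegrable (fun x => a * f x).
Proof.
move=> [fR fI]; split.
- under eq_fun do rewrite cReM EFinB !EFinM.
  by apply: integrableB => //; exact: integrableZl.
- under eq_fun do rewrite cImM EFinD !EFinM.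
  by apply: integrableD => //; exact: integrableZl.
Qed.

Lemma cintegralD f g : cintegrable f -> cintegrable g ->
  cintegral nu (fun x => f x + g x) = cintegral nu f + cintegral nu g.
Proof.
move=> [fR fI] [gR gI]; apply: eq_ReIm; rewrite ?cReD ?cImD /=.
- by under eq_Rintegral do rewrite cReD; rewrite RintegralD.
- by under eq_Rintegral do rewrite cImD; rewrite RintegralD.
Qed.

Lemma cintegralZ a f : cintegrable f ->
  cintegral nu (fun x => a * f x) = a * cintegral nu f.
Proof.
move=> [fR fI]; have iZ (r : R) (h : T -> R) : nu.-integrable setT (EFin \o h) ->
    nu.-integrable setT (EFin \o (fun x => r * h x)).
  move=> ih; rewrite (_ : _ \o _ = fun x => (r%:E * (h x)%:E)%E) //.
  exact: integrableZl.
apply: eq_ReIm; rewrite ?cReM ?cImM /=.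
- under eq_Rintegral do rewrite cReM.
  by rewrite RintegralB ?RintegralZl//; exact: iZ.
- under eq_Rintegral do rewrite cImM.
  by rewrite RintegralD ?RintegralZl//; exact: iZ.
Qed.

Lemma cintegralJ f : cintegrable f ->
  cintegral nu (fun x => conjc (f x)) = conjc (cintegral nu f).
Proof.
move=> [fR fI]; apply: eq_ReIm; rewrite ?cReJ ?cImJ /=.
- by under eq_Rintegral do rewrite cReJ.
- under eq_Rintegral do rewrite cImJ -mulN1r.
  by rewrite RintegralZl// mulN1r.
Qed.

(** Multiplying [f] by the conjugate of its integral rotates the latter onto the
    real axis, where real parts can be compared. *)
Lemma sqm_cintegral_le f (g : T -> R) : cintegrable f ->
  (forall x, 0 <= g x) -> (forall x, sqm (f x) <= g x ^+ 2) ->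
  nu.-integrable setT (fun x => (g x)%:E) ->
  sqm (cintegral nu f) <= (\int[nu]_x g x) ^+ 2.
Proof.
move=> fi g0 fg gi; set c := cintegral nu f; set J := \int[nu]_x g x.
have J0 : 0 <= J by apply: Rintegral_ge0.
have := sqm_ge0 c; rewrite le_eqVlt => /predU1P[<-|c0]; first exact: sqr_ge0.
pose r := Num.sqrt (sqm c).
have r2 : r ^+ 2 = sqm c by rewrite sqr_sqrtr ?sqm_ge0.
have r0 : 0 < r by rewrite sqrtr_gt0.
have : sqm c <= r * J.
  have -> : sqm c = Re (cintegral nu (fun x => conjc c * f x)).
    by rewrite cintegralZ// mulrC mulcJ.
  rewrite -RintegralZl//; have [cfR _] := cintegrableZ (conjc c) fi.
  apply: le_Rintegral => //.
    rewrite (_ : _ \o _ = fun x => (r%:E * (g x)%:E)%E) //.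
    exact: integrableZl.
  move=> x _; apply: le_trans (ler_norm _) _.
  rewrite -(@ler_pXn2r _ 2%N)// ?nnegrE ?mulr_ge0 ?(ltW r0)// real_normK ?num_real//.
  apply: le_trans (Re_sqr_le _) _; rewrite sqmM sqmJ exprMn r2.
  by rewrite ler_wpM2l ?sqm_ge0.
rewrite -r2 expr2 ler_pM2l// => rJ; rewrite -expr2.
by rewrite ler_pXn2r// nnegrE ltW.
Qed.

End complex_integral.

Section L2_space.
Context {R : realType} {d : nat}.
Local Notation E := 'rV[R]_d.
Local Notation C := R[i].
Local Notation mu := (@lebesgue_rV R d).
Implicit Types f g h : E -> C.

Lemma L2_cmeasurable f : L2 f -> cmeasurable f.
Proof. by case. Qed.

Lemma L2_integrable f : L2 f -> mu.-integrable setT (fun x => (sqm (f x))%:E).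
Proof.
move=> fL; have mf := L2_cmeasurable fL; have [_ _ fi] := fL; apply/integrableP; split.
  by apply/measurable_EFinP; exact: measurable_sqm.
by under eq_integral do rewrite gee0_abs ?lee_fin ?sqm_ge0//.
Qed.

Lemma cmeasurable_L2 f : cmeasurable f -> (\int[mu]_x (sqm (f x))%:E < +oo)%E -> L2 f.
Proof. by move=> [mR mI] fi; split. Qed.

Lemma L2_lin a f g : L2 f -> L2 g -> L2 (fun x => a * f x + g x).
Proof.
move=> fL gL; have mf := L2_cmeasurable fL; have mg := L2_cmeasurable gL.
apply: cmeasurable_L2.
  by apply: cmeasurableD => //; apply: cmeasurableM => //; exact: cmeasurable_cst.
have iF := L2_integrable fL; have iG := L2_integrable gL.
have : mu.-integrable setT (fun x => (2 * sqm a)%:E * (sqm (f x))%:E + 2%:E * (sqm (g x))%:E)%E.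
  by apply: integrableD => //; exact: integrableZl.
move/integrableP => [mh]; apply: le_lt_trans; apply: ge0_le_integral => //.
- by move=> x _; rewrite lee_fin sqm_ge0.
- apply/measurable_EFinP; apply: measurable_sqm.
  by apply: cmeasurableD => //; apply: cmeasurableM => //; exact: cmeasurable_cst.
- exact: measurableT_comp mh.
move=> x _; apply: le_trans (lee_abs _); rewrite -!EFinM -EFinD lee_fin -mulrA -sqmM.
rewrite /sqm !ReIm; set p := _ - _; set q := _ + Im a * _.
have := sqr_ge0 (p - Re (g x)); have := sqr_ge0 (q - Im (g x)); lra.
Qed.

Lemma L2_0 : L2 (fun _ : E => 0 : C).
Proof.
split; [exact: measurable_cst|exact: measurable_cst|].
by rewrite /= expr0n addr0 integral0 ltry.
Qed.

Lemma L2_cintegrable f g : L2 f -> L2 g ->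
  cintegrable mu (fun x => f x * conjc (g x)).
Proof.
move=> fL gL; apply: (@cintegrable_dominated _ _ _ _ _ (fun x => sqm (f x) + sqm (g x))).
- apply: cmeasurableM; first exact: L2_cmeasurable.
  by apply: cmeasurableJ; exact: L2_cmeasurable.
- by move=> x; rewrite addr_ge0// sqm_ge0.
- move=> x; rewrite sqmM sqmJ sqrrD; have := sqm_ge0 (f x); have := sqm_ge0 (g x).
  by nra.
- by under eq_fun do rewrite EFinD; apply: integrableD => //; exact: L2_integrable.
Qed.

Lemma inner_lin a f g h : L2 f -> L2 g -> L2 h ->
  inner (fun x => a * f x + g x) h = a * inner f h + inner g h.
Proof.
move=> fL gL hL; rewrite /inner -cintegralZ; last exact: L2_cintegrable.
rewrite -cintegralD; last 2 first.
- by apply: cintegrableZ; exact: L2_cintegrable.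
- exact: L2_cintegrable.
by apply: eq_cintegral => x; rewrite mulrDl mulrA.
Qed.

Lemma inner_conj f g : L2 f -> L2 g -> inner g f = conjc (inner f g).
Proof.
move=> fL gL; rewrite /inner -cintegralJ; last exact: L2_cintegrable.
by apply: eq_cintegral => x; rewrite conjcM conjcK mulrC.
Qed.

Lemma Re_innerE f : Re (inner f f) = \int[mu]_x sqm (f x).
Proof. by apply: eq_Rintegral => x _; rewrite mulcJ. Qed.

Lemma EFin_inner f : L2 f -> ((Re (inner f f))%:E = \int[mu]_x (sqm (f x))%:E)%E.
Proof.
by move=> /L2_integrable fi; rewrite Re_innerE fineK//; exact: integrable_fin_num.
Qed.

Lemma inner_ge0 f : 0 <= Re (inner f f).
Proof. by rewrite Re_innerE; apply: Rintegral_ge0 => x _; exact: sqm_ge0. Qed.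

Definition L2_pred : {pred E -> C} := fun f => `[< L2 f >].

Lemma L2_submod_closed : submod_closed L2_pred.
Proof.
split; first by apply/asboolP; exact: L2_0.
by move=> a f g /asboolP fL /asboolP gL; apply/asboolP; exact: L2_lin.
Qed.

HB.instance Definition _ := GRing.isSubmodClosed.Build C (E -> C) L2_pred
  L2_submod_closed.

(** Representatives are not identified up to equality almost everywhere:
    [ipL] is then only semi-definite, and operators on functions act on this
    type directly. *)
Record L2fun := MkL2fun { L2val :> E -> C ; L2valP : L2val \in L2_pred }.
HB.instance Definition _ := [isSub for L2val].
HB.instance Definition _ := [Choice of L2fun by <:].
HB.instance Definition _ := [SubChoice_isSubLmodule of L2fun by <:].

Lemma L2funP (f : L2fun) : L2 f. Proof. by apply/asboolP; exact: L2valP. Qed.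

Lemma L2_asbool f : L2 f -> f \in L2_pred. Proof. by move/asboolP. Qed.

Definition mkL2 f (fL : L2 f) : L2fun := MkL2fun (L2_asbool fL).

Definition ipL (f g : L2fun) : C := inner f g.

Lemma ipL_hermitian : hermitian ipL.
Proof.
split => [a f g h|f g|f].
- by apply: inner_lin; exact: L2funP.
- by apply: inner_conj; exact: L2funP.
- exact: inner_ge0.
Qed.

End L2_space.

(** * Completeness of L^2 *)

Section riesz_fischer.
Context {R : realType} {d : nat}.
Local Notation E := 'rV[R]_d.
Local Notation C := R[i].
Local Notation mu := (@lebesgue_rV R d).

Lemma limn_einf_le (u : nat -> \bar R) c K :
  (forall k, (K <= k)%N -> (u k <= c)%E) -> (limn_einf u <= c)%E.
Proof.
move=> uc; rewrite limn_einf_lim; apply: lime_le; first exact: is_cvg_einfs.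
apply: nearW => n; apply: (@le_trans _ _ (u (maxn n K))); last by apply: uc; exact: leq_maxr.
by apply: ereal_inf_lbound; exists (maxn n K) => //=; exact: leq_maxl.
Qed.

Lemma cvg_of_summable_steps (y a : nat -> R) :
  (forall j, `|y j.+1 - y j| <= a j) -> cvgn (series a) -> cvgn y.
Proof.
move=> ya ca.
have : cvgn (series (telescope y)).
  apply: normed_cvg; apply: (series_le_cvg _ _ _ ca) => n //=.
    exact: le_trans (ya n).
  exact: ya.
move=> c; have -> : y = (fun n => y 0%N + series (telescope y) n).
  by apply/funext => n; exact: eq_sum_telescope.
by apply: is_cvgD => //; exact: is_cvg_cst.
Qed.

Lemma measurable_cvgn d' (T : measurableType d') (h : nat -> T -> R) :
  (forall m, measurable_fun setT (h m)) -> (forall x, cvgn (h ^~ x)) ->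
  measurable_fun setT (fun x => limn (h ^~ x)).
Proof. by move=> mh ch; apply: measurable_fun_cvg mh _ => x _; exact: ch. Qed.

Variable u : nat -> @L2fun R d.
Hypothesis cauchy_u : forall e : R, 0 < e -> exists N, forall m n,
  (N <= m)%N -> (N <= n)%N -> qf ipL (u m - u n) <= e.

(** A subsequence whose steps [w j] have squared norm at most 4^-j. *)
Let rate_ex j : exists N, forall m n,
  (N <= m)%N -> (N <= n)%N -> qf ipL (u m - u n) <= 4^-1 ^+ j :> R.
Proof. by apply: cauchy_u; rewrite exprn_gt0// invr_gt0. Qed.

Let rate j := projT1 (cid (rate_ex j)).
Let sub j := (\sum_(i < j.+1) rate i)%N.

Let rate_sub i j : (i <= j)%N -> (rate i <= sub j)%N.
Proof.
move=> ij; rewrite /sub (bigD1 (Ordinal (ij : (i < j.+1)%N)))//=.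
exact: leq_addr.
Qed.

Let uP j m n : (rate j <= m)%N -> (rate j <= n)%N ->
  qf ipL (u m - u n) <= 4^-1 ^+ j.
Proof. by rewrite /rate; case: cid => N /= NP; exact: NP. Qed.

Let v j : @L2fun R d := u (sub j).
Let w j := v j.+1 - v j.

Let w_small j : qf ipL (w j) <= 4^-1 ^+ j.
Proof. by apply: uP; apply: rate_sub; rewrite ?leqW. Qed.

(** This sum has a finite integral, hence is finite almost everywhere; there the
    steps are summable, as a <= 2^-j + 2^j a^2. *)
Let D x := (\sum_(0 <= j <oo) (2 ^+ j * sqm (w j x))%:E)%E.

Let mL (f : @L2fun R d) : cmeasurable f. Proof. exact: L2_cmeasurable (L2funP f). Qed.

Let mw j : measurable_fun setT (fun x => (2 ^+ j * sqm (w j x))%:E).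
Proof.
by apply/measurable_EFinP; apply: measurable_funM => //; exact: measurable_sqm.
Qed.

Let w0 j x : (0 <= (2 ^+ j * sqm (w j x))%:E)%E.
Proof. by rewrite lee_fin mulr_ge0 ?sqm_ge0// exprn_ge0. Qed.

Let mD : measurable_fun setT D.
Proof.
apply: (@ge0_emeasurable_sum _ _ _ setT (fun j x => (2 ^+ j * sqm (w j x))%:E) xpredT).
  by move=> k x _ _; exact: w0.
by move=> k _; exact: mw.
Qed.

Let intD : (\int[mu]_x D x < +oo)%E.
Proof.
rewrite integral_nneseries//.
apply: (@le_lt_trans _ _ (2%:E)); last exact: ltry.
have -> : (\sum_(0 <= j <oo) \int[mu]_x (2 ^+ j * sqm (w j x))%:E =
    \sum_(0 <= j <oo) (2 ^+ j * qf ipL (w j))%:E)%E.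
  apply: eq_eseriesr => j _; under eq_integral do rewrite EFinM.
  rewrite ge0_integralZl//.
  - by rewrite EFinM (EFin_inner (L2funP _)).
  - by apply/measurable_EFinP; exact: measurable_sqm.
  - by move=> x _; rewrite lee_fin sqm_ge0.
apply: nneseries_le => [j|n].
  by rewrite mulr_ge0 ?exprn_ge0// qf_ge0//; exact: ipL_hermitian.
rewrite lee_fin; apply: (@le_trans _ _ (\sum_(k < n) 2^-1 ^+ k)).
  apply: ler_sum => k _; apply: (@le_trans _ _ (2 ^+ k * 4^-1 ^+ k)).
    by rewrite ler_wpM2l ?exprn_ge0.
  by rewrite -exprMn (_ : 2 * 4^-1 = 2^-1)//; lra.
suff : \sum_(k < n) 2^-1 ^+ k <= 2 - 2 * 2^-1 ^+ n :> R.
  by move=> /le_trans; apply; rewrite gerBl mulr_ge0// exprn_ge0.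
elim: n => [|n IH]; first by rewrite big_ord0 expr0; lra.
by rewrite big_ord_recr /= exprS; lra.
Qed.

Let G := [set x | (D x < +oo)%E].

Let mG : measurable G.
Proof.
rewrite [X in measurable X](_ : G = setT `&` [set x | D x < +oo]%E); last by rewrite setTI.
exact: emeasurable_fun_infty_o.
Qed.

Let aeG : {ae mu, forall x, G x}.
Proof.
have iD : mu.-integrable setT D.
  apply/integrableP; split=> //; under eq_integral do rewrite gee0_abs ?nneseries_ge0//.
  exact: intD.
have := integrable_ae measurableT iD; apply: filterS => x /(_ I).
by rewrite /G /= fin_numE ltey => /andP[].
Qed.

Let G_cvg x (phi : C -> R) : (forall c, phi c ^+ 2 <= sqm c) ->
  (forall c c', phi (c - c') = phi c - phi c') -> G x -> cvgn (fun j => phi (v j x)).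
Proof.
move=> phi2 phiB Gx.
apply: (@cvg_of_summable_steps _ (fun j => 2^-1 ^+ j + 2 ^+ j * sqm (w j x))).
  move=> j; rewrite -phiB -/(w j x).
  have := phi2 (w j x); set p := phi _; set q := sqm _ => pq.
  set a := 2^-1 ^+ j; set b := 2 ^+ j.
  have ab : a * b = 1 by rewrite -exprMn mulVf ?expr1n// pnatr_eq0.
  have a0 : 0 < a by rewrite exprn_gt0// invr_gt0.
  have b0 : 0 < b by rewrite exprn_gt0.
  have q2 : b * `|p| ^+ 2 <= b * q by rewrite ler_wpM2l ?(ltW b0)// real_normK ?num_real.
  have := mulr_ge0 (ltW a0) (sqr_ge0 (1 - b * `|p|)).
  have -> : a * (1 - b * `|p|) ^+ 2 = a - 2 * (a * b) * `|p| + (a * b) * (b * `|p| ^+ 2) by ring.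
  by rewrite ab; have := normr_ge0 p; lra.
have cA : cvgn (series (fun j => 2^-1 ^+ j : R)).
  rewrite exprn_geometric; apply: is_cvg_geometric_series.
  by rewrite ger0_norm; lra.
have cB : cvgn (series (fun j => 2 ^+ j * sqm (w j x))).
  have D0 : (0 <= D x)%E by apply: nneseries_ge0 => j _ _; exact: w0.
  have ge0 j : 0 <= 2 ^+ j * sqm (w j x) by rewrite mulr_ge0 ?sqm_ge0// exprn_ge0.
  apply/cvg_ex; exists (fine (D x)).
  rewrite (_ : series _ = fun n => \sum_(k < n) 2 ^+ k * sqm (w k x)); last first.
    by apply/funext => n; rewrite /series /= big_mkord.
  apply: (iffRL (@nnseries_cvgP _ (fun j => 2 ^+ j * sqm (w j x)) (fine (D x)) ge0)).
  by rewrite fineK// ge0_fin_numE.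
rewrite (_ : series _ = (series (fun j => 2^-1 ^+ j) \+ series (fun j => 2 ^+ j * sqm (w j x)))%R).
  exact: is_cvgD.
by apply/funext => n; rewrite /series /= big_split.
Qed.

(** The subsequence, cut off where it may diverge. *)
Let gv j x : C := (\1_G x)%:C * v j x.

Let lre x := limn (fun j => Re (gv j x)).
Let lim_ x := limn (fun j => Im (gv j x)).

Let gv_cvg x (phi : C -> R) : (forall c, phi c ^+ 2 <= sqm c) ->
  (forall c c', phi (c - c') = phi c - phi c') -> cvgn (fun j => phi (gv j x)).
Proof.
move=> phi2 phiB; have [Gx|Gx] := pselect (G x).
  rewrite /gv indicE mem_set//; under eq_fun do rewrite mul1r.
  exact: G_cvg.
rewrite /gv indicE memNset//; under eq_fun do rewrite mul0r.
exact: is_cvg_cst.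
Qed.

Let cRe x : cvgn (fun j => Re (gv j x)).
Proof. by apply: gv_cvg => [c|c c']; [exact: Re_sqr_le|rewrite cReD cReN]. Qed.

Let cIm x : cvgn (fun j => Im (gv j x)).
Proof. by apply: gv_cvg => [c|c c']; [exact: Im_sqr_le|rewrite cImD cImN]. Qed.

Let l x : C := lre x +i* lim_ x.

Let mgv j : cmeasurable (gv j).
Proof.
apply: cmeasurableM => //; apply: cmeasurable_real.
exact: measurable_indic.
Qed.

Let ml : cmeasurable l.
Proof.
split; apply: measurable_cvgn => //.
- by move=> j; have [] := mgv j.
- by move=> j; have [] := mgv j.
Qed.

(** Fatou along the subsequence. *)
Let dist n j : (rate j <= n)%N ->
  (\int[mu]_x (sqm (u n x - l x))%:E <= (4^-1 ^+ j)%:E)%E.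
Proof.
move=> jn; have mun k : measurable_fun setT (fun x => (sqm (u n x - gv k x))%:E).
  by apply/measurable_EFinP; apply: measurable_sqm; exact: cmeasurableB.
have F := @fatou _ _ _ mu _ measurableT (fun k x => (sqm (u n x - gv k x))%:E) mun.
apply: (@le_trans _ _ (\int[mu]_x limn_einf (fun k => (sqm (u n x - gv k x))%:E))%E).
  rewrite le_eqVlt; apply/orP; left; apply/eqP; apply: eq_integral => x _.
  have c : (sqm (u n x - gv k x))%:E @[k --> \oo] --> (sqm (u n x - l x))%:E.
    apply: cvg_EFin; first exact: nearW.
    rewrite /sqm /comp /=; apply: cvgD; rewrite !expr2.
      by apply: cvgM; rewrite !cReD !cReN; under eq_fun do rewrite cReD cReN;
        apply: cvgB => //; exact: cvg_cst.
    by apply: cvgM; rewrite !cImD !cImN; under eq_fun do rewrite cImD cImN;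
        apply: cvgB => //; exact: cvg_cst.
  rewrite is_cvg_limn_einfE; first by rewrite (cvg_lim _ c).
  by apply/cvg_ex; eexists; exact: c.
apply: le_trans (F _) _; first by move=> k x _; rewrite lee_fin sqm_ge0.
apply: (@limn_einf_le _ _ j) => k jk.
rewrite [X in (X <= _)%E](_ : _ = \int[mu]_x (sqm (u n x - v k x))%:E)%E; last first.
  apply: ge0_ae_eq_integral => //.
  - by apply/measurable_EFinP; apply: measurable_sqm; exact: cmeasurableB.
  - by move=> x _; rewrite lee_fin sqm_ge0.
  - by move=> x _; rewrite lee_fin sqm_ge0.
  - apply: filterS aeG => x Gx _; rewrite /gv indicE mem_set// mul1r//.
have := EFin_inner (L2funP (u n - v k)) => /= <-.
by rewrite lee_fin; apply: uP => //; exact: rate_sub.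
Qed.

Lemma L2_cauchy_lim : exists l : @L2fun R d, qf ipL (u n - l) @[n --> \oo] --> 0.
Proof.
have Ll : L2 (fun x => u (rate 0) x - l x).
  apply: cmeasurable_L2; first exact: cmeasurableB.
  by apply: le_lt_trans (dist (leqnn _)) _; exact: ltry.
have lL : L2 l.
  have := L2_lin (-1) Ll (L2funP (u (rate 0))).
  by congr L2; apply/funext => x; rewrite mulN1r opprB subrK.
exists (mkL2 lL); apply/cvgr0Pnorm_le => e e0.
have : 4^-1 ^+ j @[j --> \oo] --> (0 : R).
  by apply: cvg_expr; rewrite ger0_norm; lra.
move=> /cvgr0Pnorm_le /(_ _ e0)[j _ /(_ j (leqnn j))] /= je.
exists (rate j) => // n /= jn.
rewrite ger0_norm; last by apply: qf_ge0; exact: ipL_hermitian.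
apply: le_trans (le_trans (ler_norm _) je).
rewrite -lee_fin (EFin_inner (L2funP (u n - mkL2 lL))).
exact: dist.
Qed.

End riesz_fischer.

Theorem L2_complete {R : realType} {d : nat} : complete_form (@ipL R d).
Proof. by move=> u /L2_cauchy_lim. Qed.

(** * Translation invariance of Lebesgue measure *)

Section translation.
Context {R : realType}.
Local Notation leb := (@lebesgue_measure R).

Lemma measurable_addr_cst (a : R) :
  measurable_fun setT (fun x : measurableTypeR R => (x + a : measurableTypeR R)).
Proof. by apply: measurable_funD => //; exact: measurable_cst. Qed.

Lemma lebesgue_measure_shift (a : R) A : measurable A ->
  pushforward leb (fun x : measurableTypeR R => (x + a : measurableTypeR R)) A = leb A.
Proof.
move=> mA; apply/esym.
pose m := measure_function_pushforward__canonical__measure_function_Measure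
  leb (measurable_addr_cst a).
apply: (@lebesgue_measure_unique _ m) => //= _ [[b c]] _ <-.
rewrite /m /= /pushforward.
have -> : (fun x => x + a) @^-1` [set` `]b, c]] = [set` `](b - a), (c - a)]].
  by apply/seteqP; split => x /=; rewrite !in_itv /= ltrBlDr lerBrDr.
rewrite !lebesgue_measure_itv /= !lte_fin ltrD2r; case: ifP => // _.
by congr (_%:E); ring.
Qed.

Lemma ge0_integral_shiftR (a : R) (f : R -> \bar R) :
  measurable_fun setT f -> (forall x, 0 <= f x)%E ->
  (\int[leb]_x f (x + a)%R = \int[leb]_x f x)%E.
Proof.
move=> mf f0.
transitivity (\int[pushforward leb (fun x : measurableTypeR R => (x + a)%R : measurableTypeR R)]_x f x)%E.
  by rewrite ge0_integral_pushforward//; exact: measurable_addr_cst.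
apply: eq_measure_integral; first exact: measurable_addr_cst.
by move=> mphi A mA _; exact: lebesgue_measure_shift.
Qed.

Section finite_dimension.
Variable n : nat.
Local Notation E := 'rV[R]_n.

Lemma measurable_rV_add d' (T : measurableType d') (f g : T -> E) :
  measurable_fun setT f -> measurable_fun setT g ->
  measurable_fun setT (fun x => f x + g x : E).
Proof.
move=> mf mg; apply: measurable_fun_coordP => i.
under eq_fun do rewrite mxE; apply: measurable_funD.
- exact: (measurableT_comp (measurable_coord i) mf).
- exact: (measurableT_comp (measurable_coord i) mg).
Qed.

Lemma measurable_rV_opp d' (T : measurableType d') (f : T -> E) :
  measurable_fun setT f -> measurable_fun setT (fun x => - f x : E).
Proof.
move=> mf; apply: measurable_fun_coordP => i.
under eq_fun do rewrite mxE; apply: measurable_funN.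
exact: (measurableT_comp (measurable_coord i) mf).
Qed.

Lemma measurable_dot d' (T : measurableType d') (f g : T -> E) :
  measurable_fun setT f -> measurable_fun setT g ->
  measurable_fun setT (fun x => dot (f x) (g x)).
Proof.
move=> mf mg; apply: measurable_sum => i; apply: measurable_funM.
- exact: (measurableT_comp (measurable_coord i) mf).
- exact: (measurableT_comp (measurable_coord i) mg).
Qed.
End finite_dimension.

Lemma ge0_integral_rV_cons n (f : 'rV[R]_n.+1 -> \bar R) :
  measurable_fun setT f -> (forall x, 0 <= f x)%E ->
  (\int[lebesgue_rV n.+1]_x f x =
   \int[leb]_t \int[lebesgue_rV n]_y f (rV_cons (t, y)))%E.
Proof.
move=> mf f0.
rewrite [LHS](@ge0_integral_pushforward _ _ _ _ _ (@rV_cons R n)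
  (@measurable_rV_cons R n) (leb \x lebesgue_rV n)%E)//.
rewrite preimage_setT fubini_tonelli1//; last by move=> x; exact: f0.
exact: measurableT_comp (@measurable_rV_cons R n).
Qed.

Lemma rV_consD n (t a : R) (y b : 'rV[R]_n) :
  rV_cons (t + a, y + b) = rV_cons (t, y) + rV_cons (a, b).
Proof.
by apply/rowP => i; rewrite !mxE; case: unliftP => [j|] _ /=; rewrite ?mxE.
Qed.

Lemma rV_cons_surj n (x : 'rV[R]_n.+1) :
  exists (t : R) (y : 'rV[R]_n), x = rV_cons (t, y).
Proof.
exists (x ord0 ord0), (\row_i x ord0 (lift ord0 i)); apply/rowP => i.
by rewrite mxE; case: unliftP => [j|] -> /=; rewrite ?mxE.
Qed.

Lemma ge0_integral_shift n (a : 'rV[R]_n) (f : 'rV[R]_n -> \bar R) :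
  measurable_fun setT f -> (forall x, 0 <= f x)%E ->
  (\int[lebesgue_rV n]_x f (x + a)%R = \int[lebesgue_rV n]_x f x)%E.
Proof.
elim: n a f => [|n IH] a f mf f0.
  by apply: eq_integral => x _; congr f; apply/rowP => -[].
have mfa : measurable_fun setT (fun x : 'rV[R]_n.+1 => f (x + a)).
  apply: measurableT_comp mf _; apply: measurable_rV_add => //; exact: measurable_cst.
apply: etrans (ge0_integral_rV_cons mfa (fun x => f0 _)) _.
apply: etrans _ (esym (ge0_integral_rV_cons mf f0)).
have [a0 [a' ->]] := rV_cons_surj a.
under eq_integral do under eq_integral do rewrite -rV_consD.
have mfc : measurable_fun setT (fun p : measurableTypeR R * 'rV[R]_n => f (rV_cons p)).
  exact: measurableT_comp (@measurable_rV_cons R n).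
have E1 (t : R) : (\int[lebesgue_rV n]_y f (rV_cons (t + a0, y + a')%R) =
    \int[lebesgue_rV n]_y f (rV_cons ((t + a0)%R, y)))%E.
  apply: (IH a' (fun y => f (rV_cons (t + a0, y)))) => //.
  exact: (measurableT_comp mfc (measurable_pair1 _)).
under eq_integral do rewrite E1.
apply: (ge0_integral_shiftR a0 (f := fun t => (\int[lebesgue_rV n]_y f (rV_cons (t, y)))%E)).
- exact: (@measurable_fun_fubini_tonelli_F _ _ _ _ _ (lebesgue_rV n) _ mfc).
- by move=> t; apply: integral_ge0.
Qed.

Lemma integral_shift n (a : 'rV[R]_n) (f : 'rV[R]_n -> \bar R) :
  measurable_fun setT f ->
  (\int[lebesgue_rV n]_x f (x + a)%R = \int[lebesgue_rV n]_x f x)%E.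
Proof.
move=> mf; rewrite integralE [RHS]integralE; congr (_ - _)%E.
- have mfp : measurable_fun setT (f^\+)%E by exact: measurable_funepos.
  by rewrite -(@ge0_integral_shift _ a _ mfp); [apply: eq_integral => x _; rewrite !funeposE|exact: funepos_ge0].
- have mfn : measurable_fun setT (f^\-)%E by exact: measurable_funeneg.
  by rewrite -(@ge0_integral_shift _ a _ mfn); [apply: eq_integral => x _; rewrite !funenegE|exact: funeneg_ge0].
Qed.

Lemma measurable_phase_add d (a : phase_space R d) :
  measurable_fun setT (fun z : phase_space R d => z + a : phase_space R d).
Proof.
apply: measurable_fun_pair; apply: measurable_rV_add => //; exact: measurable_cst.
Qed.

Lemma ge0_integral_phase d (f : phase_space R d -> \bar R) :
  measurable_fun setT f -> (forall x, 0 <= f x)%E ->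
  (\int[lebesgue_phase]_z f z =
   \int[lebesgue_rV d]_x \int[lebesgue_rV d]_w f (x, w))%E.
Proof. by move=> mf f0; exact: fubini_tonelli1. Qed.

Lemma ge0_integral_phase_shift d (a : phase_space R d) (f : phase_space R d -> \bar R) :
  measurable_fun setT f -> (forall x, 0 <= f x)%E ->
  (\int[lebesgue_phase]_z f (z + a)%R = \int[lebesgue_phase]_z f z)%E.
Proof.
move=> mf f0.
have mfa : measurable_fun setT (fun z : phase_space R d => f (z + a)).
  exact: measurableT_comp mf (measurable_phase_add a).
apply: etrans (ge0_integral_phase mfa (fun x => f0 _)) _.
apply: etrans _ (esym (ge0_integral_phase mf f0)).
have E1 (x : 'rV[R]_d) : (\int[lebesgue_rV d]_w f ((x, w) + a)%R =
    \int[lebesgue_rV d]_w f (x + a.1, w)%R)%E.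
  apply: (@ge0_integral_shift _ a.2 (fun w => f (x + a.1, w))) => //.
  exact: (measurableT_comp mf (measurable_pair1 _)).
under eq_integral do rewrite E1.
apply: (@ge0_integral_shift _ a.1 (fun x => \int[lebesgue_rV d]_w f (x, w))%E).
- exact: (@measurable_fun_fubini_tonelli_F _ _ _ _ _ (lebesgue_rV d) _ mf).
- by move=> t; apply: integral_ge0.
Qed.

End translation.

(** * The Poisson kernel on the line *)

Section kernel_1D.
Context {R : realType}.
Local Notation leb := (@lebesgue_measure R).

Lemma is_derive_comp_lin (f : R -> R) (c df : R) (x : R) :
  is_derive (c * x) 1 f df -> is_derive x 1 (fun w : R => f (c * w)) (c * df).
Proof.
move=> fd.
have d1 : is_derive x 1 (fun w : R => c * w) c.
  by apply: is_derive_eq; rewrite /= ?scaler0 ?addr0 /GRing.scale /= ?mulr1.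
have := @is_derive1_comp R f (fun w : R => c * w) x _ _ fd d1.
by rewrite mulrC.
Qed.

Variables (e : R) (e0 : 0 < e).

(** The cosine transform of exp(-e |w|) with 1 added to the cosine: the
    integrand becomes non-negative and even, and is integrated over the
    half-line from its primitive. *)
Definition osc (a w : R) : R := expR (- (e * `|w|)) * (1 + cos (a * w)).

(** A primitive on the positive half-line. *)
Let F (a w : R) : R := expR (- e * w) *
  (- e^-1 + (a * sin (a * w) - e * cos (a * w)) / (e ^+ 2 + a ^+ 2)).

Let den (a : R) : 0 < e ^+ 2 + a ^+ 2.
Proof. by rewrite ltr_wpDr ?sqr_ge0// exprn_gt0. Qed.

Lemma is_derive_osc (a w : R) :
  is_derive w 1 (F a) (expR (- e * w) * (1 + cos (a * w))).
Proof.
have dE : is_derive w 1 (fun w : R => expR (- e * w)) (- e * expR (- e * w)).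
  exact: is_derive_comp_lin.
have dS : is_derive w 1 (fun w : R => sin (a * w)) (a * cos (a * w)).
  exact: is_derive_comp_lin.
have dC : is_derive w 1 (fun w : R => cos (a * w)) (a * - sin (a * w)).
  exact: is_derive_comp_lin.
apply: is_derive_eq.
rewrite /GRing.scale /=.
have := den a; have := e0.
set E := expR _; set s := sin _; set c := cos _ => ep dp.
field.
by rewrite gt_eqF// gt_eqF.
Qed.

Lemma continuous_osc (a : R) : continuous (osc a).
Proof.
move=> w; apply: cvgM.
  apply: (@continuous_comp _ _ _ (fun w : R => - (e * `|w|)) expR); last exact: continuous_expR.
  apply: cvgN; apply: cvgMl_tmp; exact: (@norm_continuous _ R^o).
apply: cvgD; first exact: cvg_cst.
apply: (@continuous_comp _ _ _ (fun w : R => a * w) cos); last exact: continuous_cos.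
by apply: cvgMl_tmp; exact: cvg_id.
Qed.

Lemma osc_ge0 (a w : R) : 0 <= osc a w.
Proof.
by rewrite mulr_ge0 ?expR_ge0//; have := cos_geN1 (a * w); lra.
Qed.

Lemma sin_bound (x : R) : -1 <= sin x <= 1.
Proof. by rewrite sin_geN1 sin_le1. Qed.

Lemma cvg_expR_mulNy : expR (- e * w) @[w --> +oo] --> (0 : R).
Proof.
rewrite (_ : (fun w => expR (- e * w)) = (fun z => expR (- z)) \o (fun z => e * z)); last first.
  by apply/funext => x /=; rewrite mulNr.
apply: (@cvg_comp _ _ _ _ _ _ (pinfty_nbhs R)); last exact: cvgr_expR.
exact: gt0_cvgMry.
Qed.

Lemma integral_osc (a : R) : (\int[leb]_w (osc a w)%:E =
  (2 / e + 2 * e / (e ^+ 2 + a ^+ 2))%:E)%E.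
Proof.
rewrite ge0_symfun_integralT; first last.
- by move=> w; rewrite /osc /= normrN mulrN cosN.
- exact: continuous_osc.
- exact: osc_ge0.
have -> : (\int[leb]_(x in [set x : R | (0 <= x)%R]) (osc a x)%:E =
    \int[leb]_(x in `[0%R, +oo[) (expR (- e * x) * (1 + cos (a * x)))%:E)%E.
  rewrite -set_itvcy; apply: eq_integral => x.
  by rewrite inE /= in_itv /= andbT => x0; rewrite /osc ger0_norm// mulNr.
rewrite (@ge0_continuous_FTC2y _ _ (F a) _ 0).
- rewrite -EFinB -EFinM; congr (_%:E).
  rewrite /F !mulr0 expR0 sin0 cos0; have := den a => dp; field.
  by rewrite !gt_eqF.
- move=> x _; rewrite mulr_ge0 ?expR_ge0//; have := cos_geN1 (a * x); lra.
- apply: continuous_subspaceT => w; apply: cvgM.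
    apply: (@continuous_comp _ _ _ (fun w : R => - e * w) expR); last exact: continuous_expR.
    by apply: cvgMl_tmp; exact: cvg_id.
  apply: cvgD; first exact: cvg_cst.
  apply: (@continuous_comp _ _ _ (fun w : R => a * w) cos); last exact: continuous_cos.
  by apply: cvgMl_tmp; exact: cvg_id.
- pose B := e^-1 + (`|a| + e) / (e ^+ 2 + a ^+ 2).
  have FB (w : R) : `|F a w| <= expR (- e * w) * B.
    rewrite /F normrM (ger0_norm (expR_ge0 _)) ler_wpM2l ?expR_ge0//.
    rewrite (le_trans (ler_normD _ _))// normrN ger0_norm ?invr_ge0 ?(ltW e0)//.
    rewrite lerD2l normrM (ger0_norm (_ : 0 <= _^-1)) ?invr_ge0 ?(ltW (den a))//.
    rewrite ler_wpM2r ?invr_ge0 ?(ltW (den a))// (le_trans (ler_normB _ _))//.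
    rewrite !normrM (ger0_norm (ltW e0)) lerD//.
      by rewrite ler_piMr// ler_norml sin_bound.
    by rewrite ler_piMr ?(ltW e0)// ler_norml cos_geN1 cos_le1.
  apply/cvgr0Pnorm_le => eps eps0.
  have : expR (- e * w) * B @[w --> +oo] --> (0 * B : R).
    by apply: cvgMr_tmp; exact: cvg_expR_mulNy.
  rewrite mul0r => /cvgr0Pnorm_le /(_ _ eps0); apply: filterS => w.
  by apply: le_trans; apply: le_trans (FB w) (ler_norm _).
- by move=> w _; have := is_derive_osc a w => /@ex_derive.
- apply: cvg_at_right_filter; apply: differentiable_continuous.
  by apply/derivable1_diffP; have := is_derive_osc a 0 => /@ex_derive.
- by move=> w _; rewrite derive1E; have := is_derive_osc a w => /@derive_val.
Qed.

Definition pexp (w : R) : R := expR (- (e * `|w|)).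

Lemma pexp_ge0 w : 0 <= pexp w. Proof. exact: expR_ge0. Qed.

Lemma pexp_le1 w : pexp w <= 1.
Proof. by rewrite -expR0 ler_expR oppr_le0 mulr_ge0// ltW. Qed.

Lemma osc0E w : osc 0 w = 2 * pexp w.
Proof. by rewrite /osc mul0r cos0 mulrC. Qed.

Lemma measurable_pexp : measurable_fun setT pexp.
Proof.
apply: continuous_measurable_fun => w.
apply: (@continuous_comp _ _ _ (fun w : R => - (e * `|w|)) expR); last exact: continuous_expR.
by apply: cvgN; apply: cvgMl_tmp; exact: (@norm_continuous _ R^o).
Qed.

Lemma integral_pexp : (\int[leb]_w (pexp w)%:E = (2 / e)%:E)%E.
Proof.
have := integral_osc 0; under eq_integral do rewrite osc0E EFinM.
rewrite ge0_integralZl//; last 2 first.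
- by apply/measurable_EFinP; exact: measurable_pexp.
- by move=> w _; rewrite lee_fin pexp_ge0.
have : (0 <= \int[leb]_w (pexp w)%:E)%E.
  by apply: integral_ge0 => w _; rewrite lee_fin pexp_ge0.
case: (\int[leb]_w (pexp w)%:E)%E => [r| |]//; last first.
  by rewrite mulry gtr0_sg ?mul1e.
rewrite -EFinM lee_fin => _ [] E; congr (_%:E).
have -> : r = (2 * r) / 2 by field.
by rewrite E expr0n /= addr0; field; rewrite gt_eqF.
Qed.

Lemma integrable_pexp : leb.-integrable setT (fun w => (pexp w)%:E).
Proof.
apply/integrableP; split; first by apply/measurable_EFinP; exact: measurable_pexp.
under eq_integral do rewrite gee0_abs ?lee_fin ?pexp_ge0//.
by rewrite integral_pexp ltry.
Qed.

Lemma integrable_osc a : leb.-integrable setT (fun w => (osc a w)%:E).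
Proof.
apply/integrableP; split.
  by apply/measurable_EFinP; apply: continuous_measurable_fun; exact: continuous_osc.
under eq_integral do rewrite gee0_abs ?lee_fin ?osc_ge0//.
by rewrite integral_osc ltry.
Qed.

Lemma Rintegral_pexp_cos (a : R) :
  \int[leb]_w (pexp w * cos (a * w)) = 2 * e / (e ^+ 2 + a ^+ 2).
Proof.
have -> : \int[leb]_w (pexp w * cos (a * w)) = \int[leb]_w (osc a w - pexp w).
  by apply: eq_Rintegral => w _; rewrite /osc -/(pexp w); ring.
rewrite RintegralB//; [|exact: integrable_osc|exact: integrable_pexp].
by rewrite /Rintegral integral_osc integral_pexp /= addrAC subrr add0r.
Qed.

Lemma integral_oppR (f : R -> \bar R) : measurable_fun setT f ->
  (\int[leb]_x f (- x)%R = \int[leb]_x f x)%E.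
Proof.
have key (g : R -> \bar R) : measurable_fun setT g -> (forall x, 0 <= g x)%E ->
    (\int[leb]_x g (- x)%R = \int[leb]_x g x)%E.
  move=> mg g0.
  transitivity (\int[pushforward leb (-%R : R -> measurableTypeR R)]_x g x)%E.
    by rewrite ge0_integral_pushforward//; exact: oppr_measurable.
  by apply: eq_measure_integral => A mA _; exact: lebesgue_measureN.
move=> mf; rewrite integralE [RHS]integralE; congr (_ - _)%E.
- have mfp : measurable_fun setT (f^\+)%E by exact: measurable_funepos.
  by rewrite -(key _ mfp); [apply: eq_integral => x _; rewrite !funeposE|exact: funepos_ge0].
- have mfn : measurable_fun setT (f^\-)%E by exact: measurable_funeneg.
  by rewrite -(key _ mfn); [apply: eq_integral => x _; rewrite !funenegE|exact: funeneg_ge0].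
Qed.

Lemma Rintegral_pexp_sin (a : R) : \int[leb]_w (pexp w * sin (a * w)) = 0.
Proof.
have mf : measurable_fun setT (fun w => (pexp w * sin (a * w))%:E).
  apply/measurable_EFinP; apply: measurable_funM; first exact: measurable_pexp.
  apply: continuous_measurable_fun => w.
  apply: (@continuous_comp _ _ _ (fun w : R => a * w) sin); last exact: continuous_sin.
  by apply: cvgMl_tmp; exact: cvg_id.
have fi : leb.-integrable setT (fun w => (pexp w * sin (a * w))%:E).
  apply: le_integrable integrable_pexp => //= w _.
  rewrite lee_fin (ger0_norm (pexp_ge0 w)) normrM (ger0_norm (pexp_ge0 w)).
  by rewrite ler_piMr ?pexp_ge0// ler_norml sin_bound.
have := integral_oppR mf.
have -> : (\int[leb]_x (pexp (- x) * sin (a * - x))%:E =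
    \int[leb]_x (- (pexp x * sin (a * x)%R)%:E))%E.
  by apply: eq_integral => w _; rewrite /pexp normrN mulrN sinN mulrN.
rewrite integralN; last exact: integrable_add_def.
rewrite /Rintegral; have := integrable_fin_num measurableT fi.
by move=> /fineK <-; rewrite -EFinN => -[]; lra.
Qed.

(** The Fourier transform of [pexp], with the normalization of the frequency
    that [tf_shift] uses. *)
Definition pker (x : R) : R := 2 * e / (e ^+ 2 + (2 * pi * x) ^+ 2).

Lemma pker_ge0 x : 0 <= pker x.
Proof. by rewrite divr_ge0// ?(ltW (den _))// mulr_ge0// ltW. Qed.

Lemma continuous_pker : continuous pker.
Proof.
move=> x; apply: cvgM; first exact: cvg_cst.
apply: cvgV; first by rewrite gt_eqF.
apply: cvgD; first exact: cvg_cst.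
apply: (@continuous_comp _ _ _ (fun x : R => 2 * pi * x) (fun y : R => y ^+ 2)).
  by apply: cvgMl_tmp; exact: cvg_id.
exact: exprn_continuous.
Qed.

Lemma measurable_pker : measurable_fun setT pker.
Proof. exact: continuous_measurable_fun continuous_pker. Qed.

Lemma is_derive_pker (x : R) : is_derive x 1 (fun x : R => pi^-1 * atan (2 * pi / e * x)) (pker x).
Proof.
have dA : is_derive x 1 (fun x : R => atan (2 * pi / e * x))
    (2 * pi / e * (1 + (2 * pi / e * x) ^+ 2)^-1).
  by apply: is_derive_comp_lin; exact: is_derive1_atan.
apply: is_derive_eq; rewrite /GRing.scale /= ?mulr0 ?addr0 ?scaler0.
have pi0 := pi_gt0 R; have := den (2 * pi * x); rewrite /pker.
move: pi0; move: (pi : R) => p pi0 dp.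
have -> : 1 + (2 * p / e * x) ^+ 2 = (e ^+ 2 + (2 * p * x) ^+ 2) / e ^+ 2.
  by field; rewrite gt_eqF.
by field; rewrite !gt_eqF.
Qed.

Lemma integral_pker_itv (t : R) : 0 < t ->
  (\int[leb]_(x in `[(- t)%R, t]) (pker x)%:E = (2 / pi * atan (2 * pi / e * t))%:E)%E.
Proof.
move=> t0; rewrite (@continuous_FTC2 _ _ (fun x : R => pi^-1 * atan (2 * pi / e * x))).
- rewrite -EFinB mulrN atanN mulrN opprK; congr (_%:E); ring.
- by rewrite gtrN.
- by apply: continuous_subspaceT; exact: continuous_pker.
- have c : continuous (fun x : R => pi^-1 * atan (2 * pi / e * x)).
    move=> x; apply: differentiable_continuous; apply/derivable1_diffP.
    by have := is_derive_pker x => /@ex_derive.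
  split; first by move=> x _; have := is_derive_pker x => /@ex_derive.
  + by apply: cvg_at_right_filter; exact: c.
  + by apply: cvg_at_left_filter; exact: c.
- by move=> x _; rewrite derive1E; have := is_derive_pker x => /@derive_val.
Qed.

Lemma integral_pker_le1 : (\int[leb]_x (pker x)%:E <= 1)%E.
Proof.
pose K n : set (measurableTypeR R) := [set` `[- (n.+1%:R) : R, n.+1%:R : R]].
have KT : \bigcup_n K n = setT.
  apply/seteqP; split => // x _; exists (Num.bound `|x|) => //.
  rewrite /K /= in_itv /= -ler_norml.
  by rewrite (le_trans (ltW (archi_boundP (normr_ge0 x))))// ler_nat.
have ndK : nondecreasing_seq K.
  move=> m n mn; apply/subsetPset => x; rewrite /K /= !in_itv /= => /andP[a b].
  have le : m.+1%:R <= n.+1%:R :> R by rewrite ler_nat ltnS.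
  by apply/andP; split; lra.
have := @ge0_nondecreasing_set_cvg_integral _ _ _ K (fun x : measurableTypeR R => (pker x)%:E) leb ndK.
rewrite KT => /(_ _ _ _)/cvg_lim <-//; last 3 first.
- by move=> i; exact: measurable_itv.
- by move=> i; apply: measurable_funTS; apply/measurable_EFinP; exact: measurable_pker.
- by move=> i x _; rewrite lee_fin pker_ge0.
apply: lime_le.
  apply: ereal_nondecreasing_is_cvgn; apply: ge0_nondecreasing_set_nondecreasing_integral => //.
  - by move=> i; exact: measurable_itv.
  - by move=> i; apply: measurable_funTS; apply/measurable_EFinP; exact: measurable_pker.
  - by move=> i x _; rewrite lee_fin pker_ge0.
apply: nearW => n; rewrite integral_pker_itv// lee_fin.
have pi0 := pi_gt0 R; have := atan_ltpi2 (2 * pi / e * n.+1%:R).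
rewrite -(@ltr_pM2l _ (2 / pi)) ?divr_gt0//.
suff -> : 2 / pi * (pi / 2) = 1 :> R by exact: ltW.
by move: pi0; move: (pi : R) => p pi0; field; rewrite gt_eqF.
Qed.

End kernel_1D.

(** * The Poisson kernel in several dimensions *)

Section kernel_nD.
Context {R : realType}.
Local Notation leb := (@lebesgue_measure R).

Lemma prod_rV_cons n (q : R -> R) (t : R) (y : 'rV[R]_n) :
  \prod_(i < n.+1) q (rV_cons (t, y) ord0 i) = q t * \prod_(i < n) q (y ord0 i).
Proof.
rewrite big_ord_recl mxE unlift_none /=; congr (_ * _).
by apply: eq_bigr => i _; rewrite mxE liftK.
Qed.

Lemma dot_rV_cons n (t s : R) (y z : 'rV[R]_n) :
  dot (rV_cons (t, y)) (rV_cons (s, z)) = t * s + dot y z.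
Proof.
rewrite /dot big_ord_recl !mxE unlift_none /=; congr (_ + _).
by apply: eq_bigr => i _; rewrite !mxE liftK.
Qed.

Lemma measurable_prod_coord n (q : R -> R) : measurable_fun setT q ->
  measurable_fun setT (fun x : 'rV[R]_n => \prod_(i < n) q (x ord0 i)).
Proof.
move=> mq; apply: measurable_prod => i _.
by apply: (measurableT_comp mq); exact: measurable_coord.
Qed.

Lemma ge0_integral_prod_coord n (q : R -> R) (c : R) : measurable_fun setT q ->
  (forall x, 0 <= q x) -> (\int[leb]_x (q x)%:E = c%:E)%E ->
  (\int[lebesgue_rV n]_x (\prod_(i < n) q (x ord0 i))%:E = (c ^+ n)%:E)%E.
Proof.
move=> mq q0 qc.
have c0 : 0 <= c.
  by rewrite -lee_fin -qc; apply: integral_ge0 => x _; rewrite lee_fin.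
elim: n => [|n IH].
  under eq_integral do rewrite big_ord0.
  by rewrite integral_cst//= diracE mem_set// mule1.
have p0 m (x : 'rV[R]_m) : 0 <= \prod_(i < m) q (x ord0 i) by exact: prodr_ge0.
rewrite ge0_integral_rV_cons; last 2 first.
- by apply/measurable_EFinP; exact: measurable_prod_coord.
- by move=> x; rewrite lee_fin.
under eq_integral do under eq_integral do rewrite prod_rV_cons EFinM.
have E t : (\int[lebesgue_rV n]_y ((q t)%:E * (\prod_(i < n) q (y ord0 i))%:E) =
    (q t)%:E * (c ^+ n)%:E)%E.
  rewrite -IH ge0_integralZl// ?lee_fin//.
    by apply/measurable_EFinP; exact: measurable_prod_coord.
  by move=> y _; rewrite lee_fin.
under eq_integral do rewrite E muleC.
rewrite ge0_integralZl ?lee_fin ?exprn_ge0//.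
- by rewrite qc -EFinM exprSr.
- exact/measurable_EFinP.
- by move=> x _; rewrite lee_fin.
Qed.

Lemma integral_rV_cons_mul n (a : R -> R) (b : 'rV[R]_n -> R)
    (F : 'rV[R]_n.+1 -> R) :
  leb.-integrable setT (fun t => (a t)%:E) ->
  (lebesgue_rV n).-integrable setT (fun y => (b y)%:E) ->
  measurable_fun setT F -> (forall t y, F (rV_cons (t, y)) = a t * b y) ->
  (lebesgue_rV n.+1).-integrable setT (fun x => (F x)%:E) /\
  \int[lebesgue_rV n.+1]_x F x = \int[leb]_t a t * \int[lebesgue_rV n]_y b y.
Proof.
move=> ia ib mF FE.
have mEF : measurable_fun setT (fun x => (F x)%:E) by exact/measurable_EFinP.
have mFc : measurable_fun setT
    (fun p : measurableTypeR R * 'rV[R]_n => (F (rV_cons p))%:E).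
  exact: measurableT_comp mEF (@measurable_rV_cons R n).
have fin : (\int[leb]_t \int[lebesgue_rV n]_y `|(F (rV_cons (t, y)))%:E| < +oo)%E.
  have E t : (\int[lebesgue_rV n]_y `|(F (rV_cons (t, y)))%:E| =
      `|(a t)%:E| * \int[lebesgue_rV n]_y `|(b y)%:E|)%E.
    under eq_integral do rewrite FE EFinM abseM.
    rewrite ge0_integralZl//.
    by apply: measurableT_comp => //; exact: measurable_int ib.
  under eq_integral do rewrite E muleC.
  have /integrableP[mb bfin] := ib; have /integrableP[ma afin] := ia.
  rewrite ge0_integralZl//; last 2 first.
  - exact: measurableT_comp.
  - exact: integral_ge0.
  by apply: lte_mul_pinfty => //; rewrite ?integral_ge0// ge0_fin_numE// integral_ge0.
have iFc : (leb \x lebesgue_rV n)%E.-integrable setT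
    (fun p : measurableTypeR R * 'rV[R]_n => (F (rV_cons p))%:E).
  by apply: (iffRL (@integrable12ltyP _ _ _ _ _ leb (lebesgue_rV n) _ mFc)); exact: fin.
have iF : (lebesgue_rV n.+1).-integrable setT (fun x => (F x)%:E).
  apply/integrableP; split=> //.
  by rewrite (ge0_integral_rV_cons (f := fun x => `|(F x)%:E|%E))//; exact: measurableT_comp.
split=> //.
have E1 : (\int[lebesgue_rV n.+1]_x (F x)%:E =
    \int[leb]_t \int[lebesgue_rV n]_y (F (rV_cons (t, y)))%:E)%E.
  apply: etrans (esym (integral12_prod_meas1 iFc)).
  exact: (@integral_pushforward _ _ _ _ _ _ (@measurable_rV_cons R n)
    (leb \x lebesgue_rV n)%E setT (fun x => (F x)%:E) mEF iFc).
rewrite {1}/Rintegral E1.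
have E2 t : (\int[lebesgue_rV n]_y (F (rV_cons (t, y)))%:E =
    (a t)%:E * (\int[lebesgue_rV n]_y b y)%:E)%E.
  under eq_integral do rewrite FE EFinM.
  by rewrite integralZl// fineK//; exact: integrable_fin_num ib.
under eq_integral do rewrite E2.
rewrite integralZr// fineM//; exact: integrable_fin_num ia.
Qed.

Variables (e : R) (e0 : 0 < e).

Definition damp n (w : 'rV[R]_n) : R := \prod_(i < n) pexp e (w ord0 i).
Definition poisson n (u : 'rV[R]_n) : R := \prod_(i < n) pker e (u ord0 i).

Lemma damp_ge0 n (w : 'rV[R]_n) : 0 <= damp w.
Proof. by apply: prodr_ge0 => i _; exact: pexp_ge0. Qed.

Lemma damp_le1 n (w : 'rV[R]_n) : damp w <= 1.
Proof. by apply: prodr_ile1 => i _; rewrite pexp_ge0 pexp_le1. Qed.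

Lemma poisson_ge0 n (w : 'rV[R]_n) : 0 <= poisson w.
Proof. by apply: prodr_ge0 => i _; exact: pker_ge0. Qed.

Lemma measurable_damp n : measurable_fun setT (@damp n).
Proof. by apply: measurable_prod_coord; exact: measurable_pexp. Qed.

Lemma measurable_poisson n : measurable_fun setT (@poisson n).
Proof. by apply: measurable_prod_coord; exact: measurable_pker. Qed.

Lemma integrable_damp n : (lebesgue_rV n).-integrable setT (fun w => (damp w)%:E).
Proof.
apply/integrableP; split; first by apply/measurable_EFinP; exact: measurable_damp.
under eq_integral do rewrite gee0_abs ?lee_fin ?damp_ge0//.
rewrite (ge0_integral_prod_coord n (measurable_pexp _) (pexp_ge0 _) (integral_pexp e0)).
exact: ltry.
Qed.

Lemma integral_poisson_le1 n : (\int[lebesgue_rV n]_u (poisson u)%:E <= 1)%E.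
Proof.
pose c := fine (\int[leb]_x (pker e x)%:E)%E.
have c0 : (0 <= \int[leb]_x (pker e x)%:E)%E.
  by apply: integral_ge0 => x _; rewrite lee_fin pker_ge0.
have cE : (\int[leb]_x (pker e x)%:E = c%:E)%E.
  by rewrite fineK// ge0_fin_numE// (le_lt_trans (integral_pker_le1 e0)) ?ltry.
rewrite (ge0_integral_prod_coord n (measurable_pker e0) (pker_ge0 e0) cE) lee_fin.
by rewrite exprn_ile1// -lee_fin -cE// integral_pker_le1.
Qed.

Lemma integrable_poisson n : (lebesgue_rV n).-integrable setT (fun w => (poisson w)%:E).
Proof.
apply/integrableP; split; first by apply/measurable_EFinP; exact: measurable_poisson.
under eq_integral do rewrite gee0_abs ?lee_fin ?poisson_ge0//.
by apply: le_lt_trans (integral_poisson_le1 n) _; rewrite ltry.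
Qed.

Lemma measurable_cos_comp d' (T : measurableType d') (f : T -> R) :
  measurable_fun setT f -> measurable_fun setT (fun x => cos (f x)).
Proof.
by move=> mf; apply: measurableT_comp mf; apply: continuous_measurable_fun; exact: continuous_cos.
Qed.

Lemma measurable_sin_comp d' (T : measurableType d') (f : T -> R) :
  measurable_fun setT f -> measurable_fun setT (fun x => sin (f x)).
Proof.
by move=> mf; apply: measurableT_comp mf; apply: continuous_measurable_fun; exact: continuous_sin.
Qed.

Lemma integrable_pexp_mul (g : R -> R) : measurable_fun setT g ->
  (forall x, `|g x| <= 1) -> leb.-integrable setT (fun t => (pexp e t * g t)%:E).
Proof.
move=> mg g1; apply: le_integrable (integrable_pexp e0) => //=.
  by apply/measurable_EFinP; apply: measurable_funM => //; exact: measurable_pexp.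
move=> x _; rewrite lee_fin normrM (ger0_norm (pexp_ge0 e x)).
by rewrite ler_piMr ?pexp_ge0.
Qed.

Lemma norm_cos_le1 (x : R) : `|cos x| <= 1.
Proof. by rewrite ler_norml cos_geN1 cos_le1. Qed.

Lemma norm_sin_le1 (x : R) : `|sin x| <= 1.
Proof. by rewrite ler_norml sin_geN1 sin_le1. Qed.

Lemma integrable_damp_mul n (g : 'rV[R]_n -> R) : measurable_fun setT g ->
  (forall x, `|g x| <= 1) ->
  (lebesgue_rV n).-integrable setT (fun t => (damp t * g t)%:E).
Proof.
move=> mg g1; apply: le_integrable (integrable_damp n) => //=.
  by apply/measurable_EFinP; apply: measurable_funM => //; exact: measurable_damp.
move=> x _; rewrite lee_fin normrM (ger0_norm (damp_ge0 x)).
by rewrite ler_piMr ?damp_ge0.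
Qed.

Lemma measurable_dot_cst n (u : 'rV[R]_n) :
  measurable_fun setT (fun w : 'rV[R]_n => 2 * pi * dot u w).
Proof.
apply: measurable_funM; first exact: measurable_cst.
by apply: measurable_dot => //; exact: measurable_cst.
Qed.

(** By induction on the dimension: the addition formulas split the integrand
    into products of a function of the first coordinate and one of the others,
    and the sine integral vanishes in each dimension. *)
Lemma fourier_damp n (u : 'rV[R]_n) :
  \int[lebesgue_rV n]_w (damp w * cos (2 * pi * dot u w)) = poisson u /\
  \int[lebesgue_rV n]_w (damp w * sin (2 * pi * dot u w)) = 0.
Proof.
elim: n u => [|n IH] u.
  have E (w : 'rV[R]_0) : damp w = 1 by rewrite /damp big_ord0.
  have D (w : 'rV[R]_0) : dot u w = 0 by rewrite /dot big_ord0.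
  rewrite /poisson big_ord0; split.
    under eq_Rintegral do rewrite E D mulr0 cos0 mulr1.
    rewrite Rintegral_cst// mul1r.
    by rewrite [X in fine X](_ : _ = 1%E)//= diracE mem_set.
  under eq_Rintegral do rewrite E D mulr0 sin0 mulr0.
  by rewrite Rintegral_cst// mul0r.
have [s [y ->]] := rV_cons_surj u; have [IHc IHs] := IH y.
have lin_m : measurable_fun setT (fun t : R => 2 * pi * s * t).
  by apply: measurable_funM => //; exact: measurable_cst.
have ic1 := integrable_pexp_mul (measurable_cos_comp lin_m) (fun t => norm_cos_le1 _).
have is1 := integrable_pexp_mul (measurable_sin_comp lin_m) (fun t => norm_sin_le1 _).
have icn := integrable_damp_mul (measurable_cos_comp (measurable_dot_cst y)) (fun t => norm_cos_le1 _).
have isn := integrable_damp_mul (measurable_sin_comp (measurable_dot_cst y)) (fun t => norm_sin_le1 _).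
pose tl (x : 'rV[R]_n.+1) : 'rV[R]_n := \row_i x ord0 (lift ord0 i).
have tlE t z : tl (rV_cons (t, z)) = z.
  by apply/rowP => i; rewrite !mxE liftK.
have hdE t (z : 'rV[R]_n) : rV_cons (t, z) ord0 ord0 = t by rewrite mxE unlift_none.
have mtl : measurable_fun setT tl.
  by apply: measurable_fun_coordP => i; under eq_fun do rewrite mxE; exact: measurable_coord.
have mhd : measurable_fun setT (fun x : 'rV[R]_n.+1 => x ord0 ord0) by exact: measurable_coord.
have step (f : R -> R) (g : 'rV[R]_n -> R) :
    measurable_fun setT f -> measurable_fun setT g ->
    leb.-integrable setT (fun t => (f t)%:E) ->
    (lebesgue_rV n).-integrable setT (fun z => (g z)%:E) ->
    (lebesgue_rV n.+1).-integrable setT (fun x => (f (x ord0 ord0) * g (tl x))%:E) /\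
    \int[lebesgue_rV n.+1]_x (f (x ord0 ord0) * g (tl x)) =
      \int[leb]_t f t * \int[lebesgue_rV n]_z g z.
  move=> mf mg fi gi; apply: integral_rV_cons_mul => //.
    by apply: measurable_funM; [exact: measurableT_comp mf mhd|exact: measurableT_comp mg mtl].
  by move=> t z; rewrite hdE tlE.
have mC := measurable_funM (measurable_pexp e) (measurable_cos_comp lin_m).
have mS := measurable_funM (measurable_pexp e) (measurable_sin_comp lin_m).
have mCn := measurable_funM (@measurable_damp n) (measurable_cos_comp (measurable_dot_cst y)).
have mSn := measurable_funM (@measurable_damp n) (measurable_sin_comp (measurable_dot_cst y)).
have [CCi CC] := step _ _ mC mCn ic1 icn.
have [SSi SS] := step _ _ mS mSn is1 isn.
have [CSi CS] := step _ _ mC mSn ic1 isn.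
have [SCi SC] := step _ _ mS mCn is1 icn.
have key (w : 'rV[R]_n.+1) : exists t z, [/\ w = rV_cons (t, z),
    damp w = pexp e t * damp z &
    2 * pi * dot (rV_cons (s, y)) w = 2 * pi * s * t + 2 * pi * dot y z].
  have [t [z ->]] := rV_cons_surj w; exists t, z; split=> //.
    by rewrite /damp prod_rV_cons.
  by rewrite dot_rV_cons; ring.
split.
  transitivity (\int[lebesgue_rV n.+1]_w (
      pexp e (w ord0 ord0) * cos (2 * pi * s * w ord0 ord0) *
        (damp (tl w) * cos (2 * pi * dot y (tl w))) -
      pexp e (w ord0 ord0) * sin (2 * pi * s * w ord0 ord0) *
        (damp (tl w) * sin (2 * pi * dot y (tl w))))).
    apply: eq_Rintegral => w _; have [t [z [-> -> ->]]] := key w.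
    by rewrite hdE tlE cosD; ring.
  rewrite RintegralB// CC SS IHs mulr0 subr0 IHc Rintegral_pexp_cos//.
  by rewrite /poisson prod_rV_cons /pker.
transitivity (\int[lebesgue_rV n.+1]_w (
    pexp e (w ord0 ord0) * sin (2 * pi * s * w ord0 ord0) *
      (damp (tl w) * cos (2 * pi * dot y (tl w))) +
    pexp e (w ord0 ord0) * cos (2 * pi * s * w ord0 ord0) *
      (damp (tl w) * sin (2 * pi * dot y (tl w))))).
  apply: eq_Rintegral => w _; have [t [z [-> -> ->]]] := key w.
  by rewrite hdE tlE sinD; ring.
by rewrite RintegralD// SC CS IHs mulr0 addr0 Rintegral_pexp_sin// mul0r.
Qed.

End kernel_nD.

(** * Continuity of translations in L^2 *)

Section translation_continuity.
Context {R : realType} {d : nat}.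
Local Notation E := 'rV[R]_d.
Local Notation C := R[i].
Local Notation mu := (@lebesgue_rV R d).
Implicit Types f g : E -> C.

Definition energy f : \bar R := (\int[mu]_x (sqm (f x))%:E)%E.

Lemma energy_ge0 f : (0 <= energy f)%E.
Proof. by apply: integral_ge0 => x _; rewrite lee_fin sqm_ge0. Qed.

Lemma measurable_esqm f : cmeasurable f -> measurable_fun setT (fun x => (sqm (f x))%:E).
Proof. by move=> mf; apply/measurable_EFinP; exact: measurable_sqm. Qed.

Lemma energyD_le f g : cmeasurable f -> cmeasurable g ->
  (energy (fun x => f x + g x)%R <= 2%:E * energy f + 2%:E * energy g)%E.
Proof.
move=> mf mg; rewrite -!ge0_integralZl//; last 4 first.
- exact: measurable_esqm.
- by move=> x _; rewrite lee_fin sqm_ge0.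
- exact: measurable_esqm.
- by move=> x _; rewrite lee_fin sqm_ge0.
rewrite -ge0_integralD//; last 4 first.
- by move=> x _; rewrite -EFinM lee_fin mulr_ge0 ?sqm_ge0.
- by apply: measurable_funeM; exact: measurable_esqm.
- by move=> x _; rewrite -EFinM lee_fin mulr_ge0 ?sqm_ge0.
- by apply: measurable_funeM; exact: measurable_esqm.
apply: ge0_le_integral => //.
- by move=> x _; rewrite lee_fin sqm_ge0.
- by apply: measurable_esqm; exact: cmeasurableD.
- by apply: emeasurable_funD; apply: measurable_funeM; exact: measurable_esqm.
move=> x _; rewrite -!EFinM -EFinD lee_fin /sqm !ReIm.
have := sqr_ge0 (Re (f x) - Re (g x)); have := sqr_ge0 (Im (f x) - Im (g x)); lra.
Qed.

Lemma energyZ c f : cmeasurable f ->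
  energy (fun x => c * f x) = ((sqm c)%:E * energy f)%E.
Proof.
move=> mf; rewrite -ge0_integralZl//; last 3 first.
- exact: measurable_esqm.
- by move=> x _; rewrite lee_fin sqm_ge0.
- by rewrite lee_fin sqm_ge0.
by apply: eq_integral => x _; rewrite sqmM.
Qed.

Lemma cmeasurable_shift f (u : E) : cmeasurable f -> cmeasurable (fun x : E => f (x + u)).
Proof.
move=> mf; have mu_ : measurable_fun setT (fun x : E => x + u : E).
  by apply: measurable_rV_add => //; exact: measurable_cst.
exact: (cmeasurable_comp mu_ mf).
Qed.

Lemma energy_shift f (u : E) : cmeasurable f -> energy (fun x => f (x + u)) = energy f.
Proof.
move=> mf; apply: (ge0_integral_shift u (f := fun x => (sqm (f x))%:E)).
- exact: measurable_esqm.
- by move=> x; rewrite lee_fin sqm_ge0.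
Qed.

(** Continuity at 0, in the squared L^2 distance, of the translates of [f]. *)
Definition tcont f := forall eta : R, 0 < eta -> exists2 del : R, 0 < del &
  forall u : E, (forall i, `|u ord0 i| <= del) ->
    (energy (fun x => f (x + u) - f x)%R <= eta%:E)%E.

Lemma tcontD f g : cmeasurable f -> cmeasurable g -> tcont f -> tcont g ->
  tcont (fun x => f x + g x).
Proof.
move=> mf mg cf cg eta eta0; have e4 : 0 < eta / 4 by rewrite divr_gt0.
have [df df0 fP] := cf _ e4; have [dg dg0 gP] := cg _ e4.
exists (Num.min df dg); first by rewrite lt_min df0.
move=> u ul.
have uf i : `|u ord0 i| <= df by have := ul i; rewrite le_min => /andP[].
have ug i : `|u ord0 i| <= dg by have := ul i; rewrite le_min => /andP[].
have -> : (fun x => f (x + u) + g (x + u) - (f x + g x)) =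
    (fun x => (f (x + u) - f x) + (g (x + u) - g x)).
  by apply/funext => x; rewrite opprD addrACA.
have := energyD_le (cmeasurableB (cmeasurable_shift u mf) mf)
  (cmeasurableB (cmeasurable_shift u mg) mg).
move=> /le_trans; apply.
apply: (@le_trans _ _ (2%:E * (eta / 4)%:E + 2%:E * (eta / 4)%:E)%E).
  by apply: leeD; apply: lee_wpmul2l; rewrite ?lee_fin//; [exact: fP|exact: gP].
by rewrite -!EFinM -EFinD lee_fin; lra.
Qed.

Lemma tcontZ c f : cmeasurable f -> tcont f -> tcont (fun x => c * f x).
Proof.
move=> mf cf eta eta0.
have c1 : 0 < sqm c + 1 by rewrite ltr_wpDl ?sqm_ge0.
have [del del0 fP] := cf _ (divr_gt0 eta0 c1); exists del => // u /fP le1.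
have -> : (fun x => c * f (x + u) - c * f x) = (fun x => c * (f (x + u) - f x)).
  by apply/funext => x; rewrite mulrBr.
rewrite energyZ; last by apply: cmeasurableB => //; exact: cmeasurable_shift.
apply: (@le_trans _ _ ((sqm c)%:E * (eta / (sqm c + 1))%:E)%E).
  by apply: lee_wpmul2l => //; rewrite lee_fin sqm_ge0.
rewrite -EFinM lee_fin mulrA ler_pdivrMr// mulrC ler_wpM2l ?(ltW eta0)//.
by rewrite lerDl.
Qed.

Lemma tcont0 : tcont (fun=> 0).
Proof.
move=> eta eta0; exists 1 => // u _; rewrite /energy.
by under eq_integral do rewrite subrr sqm0; rewrite integral0 lee_fin ltW.
Qed.

Lemma tcont_sum I (r : seq I) (F : I -> E -> C) :
  (forall i, cmeasurable (F i)) -> (forall i, tcont (F i)) ->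
  tcont (fun x => \sum_(i <- r) F i x).
Proof.
move=> mF cF; elim: r => [|i r IH].
  by under eq_fun do rewrite big_nil; exact: tcont0.
under eq_fun do rewrite big_cons.
by apply: tcontD => //; exact: cmeasurable_sum.
Qed.

(** Translations are isometries, so approximable functions inherit the property. *)
Lemma tcont_lim f : cmeasurable f -> (forall eta : R, 0 < eta -> exists g,
  [/\ cmeasurable g, tcont g & (energy (fun x => f x - g x)%R <= eta%:E)%E]) ->
  tcont f.
Proof.
move=> mf fg eta eta0; have e16 : 0 < eta / 16 by rewrite divr_gt0.
have [g [mg cg gP]] := fg _ e16; have [del del0 dP] := cg _ e16.
exists del => // u /dP le1.
have mfg := cmeasurableB mf mg.
have -> : (fun x => f (x + u) - f x) =
    (fun x => ((f (x + u) - g (x + u)) + (-1) * (f x - g x)) + (g (x + u) - g x)).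
  by apply/funext => x; rewrite mulN1r; ring.
have mfgu : cmeasurable (fun x : E => f (x + u) - g (x + u)).
  exact: (cmeasurable_shift u mfg).
have mfgN : cmeasurable (fun x => (-1) * (f x - g x)).
  by apply: cmeasurableM => //; exact: cmeasurable_cst.
have := energyD_le (cmeasurableD mfgu mfgN) (cmeasurableB (cmeasurable_shift u mg) mg).
move=> /le_trans; apply.
have := energyD_le mfgu mfgN; rewrite energyZ// (energy_shift u mfg).
have -> : sqm (-1 : C) = 1 by rewrite sqmN sqm_real expr1n.
rewrite mul1e => le2.
apply: (@le_trans _ _ (2%:E * (2%:E * (eta / 16)%:E + 2%:E * (eta / 16)%:E) + 2%:E * (eta / 16)%:E)%E).
  apply: leeD; apply: lee_wpmul2l; rewrite ?lee_fin//.
  apply: le_trans le2 _.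
  by apply: leeD; apply: lee_wpmul2l; rewrite ?lee_fin.
by rewrite -!EFinM -!EFinD lee_fin; lra.
Qed.

Definition cindic (A : set E) : E -> C := fun x => (\1_A x)%:C.

Lemma cmeasurable_cindic A : measurable A -> cmeasurable (cindic A).
Proof. by move=> mA; apply: cmeasurable_real; exact: measurable_indic. Qed.

Lemma sqm_cindic A x : sqm (cindic A x) = \1_A x.
Proof. by rewrite sqm_real indicE; case: (x \in A); rewrite ?expr1n ?expr0n. Qed.

Lemma energy_cindic A : measurable A -> energy (cindic A) = mu A.
Proof.
move=> mA; rewrite /energy; under eq_integral do rewrite sqm_cindic.
by rewrite integral_indic// setIT.
Qed.

Definition box (a b : 'I_d -> R) : set E :=
  [set x | forall i, x ord0 i \in `]a i, b i[].

Lemma measurable_box a b : measurable (box a b).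
Proof.
rewrite [X in measurable X](_ : _ = \bigcap_(i in [set: 'I_d])
    ((fun x : E => x ord0 i) @^-1` [set` `]a i, b i[])).
  apply: (@fin_bigcap_measurable _ 'rV[R]_d) => [|i _].
    exact: finite_finset.
  have := @measurable_coord _ R d i measurableT _ (measurable_itv `]a i, b i[).
  by rewrite setTI.
by apply/seteqP; split => x /= Ax i; [move=> _; exact: Ax|exact: Ax].
Qed.

Lemma box_lty a b : (mu (box a b) < +oo)%E.
Proof.
rewrite /box (lebesgue_rV_box (A := fun i => [set` `]a i, b i[])) => [|i]; last exact: measurable_itv.
rewrite -ge0_fin_numE; last by apply: prode_ge0 => i _.
apply: prode_fin_num => i _; rewrite lebesgue_measure_itv /=.
by case: ifP => // _; rewrite fin_numE.
Qed.

(** Shrink the box B to A, by more than the translation: then A lies in B and in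
    its translate, so that |1_B(x + u) - 1_B(x)|^2 + 2 1_A(x) is at most
    1_B(x + u) + 1_B(x), and the measure of A is close to that of B. *)
Lemma tcont_box a b : tcont (cindic (box a b)).
Proof.
move=> eta eta0; set B := box a b.
have mB := measurable_box a b; have fB := box_lty a b.
pose Bm m := box (fun i => a i + m.+1%:R^-1) (fun i => b i - m.+1%:R^-1).
have mBm m : measurable (Bm m) by exact: measurable_box.
have ndB : nondecreasing_seq Bm.
  move=> m n mn; apply/subsetPset => x Bx i; have := Bx i.
  rewrite !in_itv /= => /andP[h1 h2].
  have : n.+1%:R^-1 <= m.+1%:R^-1 :> R by rewrite lef_pV2 ?posrE// ler_nat ltnS.
  move: h1 h2; move: (m.+1%:R^-1) (n.+1%:R^-1) (x ord0 i) => p q y h1 h2 h3.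
  by apply/andP; split; lra.
have UB : \bigcup_m Bm m = B.
  apply/seteqP; split => [x [m _ Bx] i|x Bx].
    have := Bx i; rewrite !in_itv /= => /andP[h1 h2].
    have : 0 < m.+1%:R^-1 :> R by rewrite invr_gt0.
    move: h1 h2; move: (m.+1%:R^-1) (x ord0 i) => p y h1 h2 h3.
    by apply/andP; split; lra.
  pose gap := \big[Num.min/1]_(i < d) Num.min (x ord0 i - a i) (b i - x ord0 i).
  have gap0 : 0 < gap.
    rewrite /gap; elim/big_ind : _ => // [y z y0 z0|i _]; first by rewrite lt_min y0.
    by have := Bx i; rewrite in_itv /= => /andP[h1 h2]; rewrite lt_min !subr_gt0 h1.
  have gi i : gap <= Num.min (x ord0 i - a i) (b i - x ord0 i).
    by rewrite /gap; exact: bigmin_le_cond.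
  exists (Num.bound gap^-1) => // i; rewrite in_itv /=.
  have := gi i; rewrite le_min => /andP[g1 g2].
  have lt1 : (Num.bound gap^-1).+1%:R^-1 < gap.
    rewrite invf_plt ?posrE//; apply: lt_le_trans (archi_boundP _) _.
      by rewrite invr_ge0 ltW.
    by rewrite ler_nat.
  have {lt1 gi g1 g2}[g [p [[g1 g2 lt1] <-]]] : exists g p : R, [/\ g <= x ord0 i - a i,
      g <= b i - x ord0 i & p < g] /\ p = (Num.bound gap^-1).+1%:R^-1.
    by exists gap, (Num.bound gap^-1).+1%:R^-1.
  move: g1 g2 lt1; move: (x ord0 i) => y g1 g2 lt1.
  by apply/andP; split; lra.
have cB : mu (Bm m) @[m --> \oo] --> mu B.
  by rewrite -UB; apply: nondecreasing_cvg_mu => //; rewrite UB.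
have fB' : mu B \is a fin_num by rewrite ge0_fin_numE.
have [m mP] : exists m, (mu B - (eta / 2)%:E <= mu (Bm m))%E.
  apply: contrapT => noM.
  have : (limn (fun m => mu (Bm m)) <= mu B - (eta / 2)%:E)%E.
    apply: lime_le; first by apply/cvg_ex; eexists; exact: cB.
    apply: nearW => m; rewrite leNgt; apply/negP => lt1; apply: noM.
    by exists m; exact: ltW.
  rewrite (cvg_lim _ cB)// leeBrDr// -(fineK fB') -EFinD lee_fin.
  lra.
have fA : mu (Bm m) \is a fin_num.
  rewrite ge0_fin_numE//; apply: le_lt_trans fB; apply: le_measure; rewrite ?inE//.
  move=> x Bx; have : (\bigcup_k Bm k) x by exists m.
  by rewrite UB.
have m0 : 0 < m.+1%:R^-1 :> R by rewrite invr_gt0.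
exists (m.+1%:R^-1 / 2); first by rewrite divr_gt0.
move=> u ul; set A := Bm m; have mA : measurable A := mBm m.
have AB x : A x -> B x.
  move=> Ax; have : (\bigcup_k Bm k) x by exists m.
  by rewrite UB.
have ABu x : A x -> B (x + u).
  move=> Ax i; have := Ax i; have := ul i; rewrite !in_itv /= mxE ler_norml.
  move=> /andP[h1 h2] /andP[h3 h4]; move: m0 h1 h2 h3 h4.
  move: (m.+1%:R^-1) (x ord0 i) (u ord0 i) => p y v m0 h1 h2 h3 h4.
  by apply/andP; split; lra.
have mBu := cmeasurable_shift u (cmeasurable_cindic mB).
have le1 : (energy (fun x => cindic B (x + u) - cindic B x)%R + 2%:E * energy (cindic A) <=
    energy (fun x => cindic B (x + u)%R) + energy (cindic B))%E.
  rewrite -ge0_integralZl//; last 2 first.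
  - by apply: measurable_esqm; exact: cmeasurable_cindic.
  - by move=> x _; rewrite lee_fin sqm_ge0.
  have mAe : measurable_fun setT (fun x => 2%:E * (sqm (cindic A x))%:E)%E.
    by apply: measurable_funeM; apply: measurable_esqm; exact: cmeasurable_cindic.
  have mdiff : measurable_fun setT (fun x : E => (sqm (cindic B (x + u) - cindic B x))%:E).
    by apply: measurable_esqm; apply: cmeasurableB => //; exact: cmeasurable_cindic.
  rewrite -ge0_integralD//; last 2 first.
  - by move=> x _; rewrite lee_fin sqm_ge0.
  - by move=> x _; rewrite -EFinM lee_fin mulr_ge0 ?sqm_ge0.
  rewrite -ge0_integralD//; last 4 first.
  - by move=> x _; rewrite lee_fin sqm_ge0.
  - exact: measurable_esqm.
  - by move=> x _; rewrite lee_fin sqm_ge0.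
  - by apply: measurable_esqm; exact: cmeasurable_cindic.
  apply: ge0_le_integral => //.
  - by move=> x _; apply: adde_ge0; rewrite ?mule_ge0 ?lee_fin ?sqm_ge0.
  - exact: emeasurable_funD.
  - by apply: emeasurable_funD; apply: measurable_esqm => //; exact: cmeasurable_cindic.
  move=> x _; rewrite -EFinM -!EFinD lee_fin !sqm_cindic /cindic -rmorphB sqm_real.
  rewrite !indicE; have [Ax|Ax] := boolP (x \in A).
    have /AB Bx : A x by rewrite inE in Ax.
    have /ABu Bxu : A x by rewrite inE in Ax.
    by rewrite !mem_set//= subrr expr0n /=; lra.
  by case: (x + u \in B); case: (x \in B); rewrite /= ?subrr ?subr0 ?sub0r ?sqrrN ?expr0n ?expr1n /=; lra.
move: le1; rewrite (energy_shift u (cmeasurable_cindic mB)) !energy_cindic//.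
rewrite -/A; move: mP; rewrite -/A -(fineK fB') -(fineK fA).
rewrite -EFinB lee_fin -EFinM -EFinD => le2.
have := energy_ge0 (fun x => cindic B (x + u) - cindic B x).
case: (energy _) => [r| |]// _; rewrite -?EFinD ?lee_fin; lra.
Qed.

End translation_continuity.

Section translation_continuity_L2.
Context {R : realType} {d : nat}.
Local Notation E := 'rV[R]_d.
Local Notation C := R[i].
Local Notation mu := (@lebesgue_rV R d).

Definition cube k : set E := box (fun=> - k%:R) (fun=> k%:R).

Definition boxes : set (set E) := [set A | exists a b, A = box a b].

Lemma boxI (a b a' b' : 'I_d -> R) : box a b `&` box a' b' =
  box (fun i => Num.max (a i) (a' i)) (fun i => Num.min (b i) (b' i)).
Proof.
apply/seteqP; split => [x [xa xb] i|x xab].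
  have := xa i; have := xb i; rewrite !in_itv /= => /andP[h1 h2] /andP[h3 h4].
  by rewrite gt_max lt_min h1 h2 h3 h4.
by split => i; have := xab i; rewrite !in_itv /= gt_max lt_min => /andP[/andP[h1 h2] /andP[h3 h4]];
  apply/andP.
Qed.

Lemma mem_cube (x : E) : exists k, forall n, (k <= n)%N -> cube n x.
Proof.
pose m := \sum_(i < d) `|x ord0 i|.
have m0 : 0 <= m by exact: sumr_ge0.
exists (Num.bound m) => n mn i; rewrite in_itv /= -ltr_norml.
apply: (@le_lt_trans _ _ m).
  by rewrite /m (bigD1 i)//= lerDl sumr_ge0.
by rewrite (lt_le_trans (archi_boundP m0))// ler_nat.
Qed.

Lemma measurable_sub_boxes (A : set E) : measurable A -> <<s boxes >> A.
Proof.
move: A; apply: smallest_sub; first exact: smallest_sigma_algebra.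
rewrite -bigcup_seq/=; apply: bigcup_sub => i _ A [B mB <-] /=; rewrite setTI.
have [sig0 sigC sigU] := smallest_sigma_algebra setT boxes.
pose P := [set Y : set R | <<s boxes >> ((fun x : E => x ord0 i) @^-1` Y)].
suff : (@RGenInftyO.G R).-sigma.-measurable `<=` P.
  by apply; rewrite -RGenInftyO.measurableE.
apply: smallest_sub.
  split.
  - by rewrite /P /= preimage_set0; exact: sig0.
  - by move=> Y; rewrite /P /= => /sigC; rewrite !setTD preimage_setC.
  - by move=> F; rewrite /P /= => /sigU; rewrite preimage_bigcup.
move=> _ [c ->]; rewrite /P /=.
rewrite (_ : _ @^-1` _ = \bigcup_n (box (fun=> - n%:R) (fun j => if j == i then Num.min c n%:R else n%:R))).
  by apply: sigU => n; apply: sub_sigma_algebra; eexists; eexists.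
apply/seteqP; split => [x|x [n _ Bx]] /=.
  rewrite in_itv /= => xc; have [k kx] := mem_cube x; exists k => // j.
  have := kx k (leqnn k) j; rewrite !in_itv /= => /andP[-> h2] /=.
  by case: eqP => [->|//]; rewrite lt_min xc; have := kx k (leqnn k) i; rewrite in_itv /= => /andP[].
by have := Bx i; rewrite !in_itv /= eqxx lt_min => /andP[_ /andP[]].
Qed.

(** The pi-lambda theorem, from boxes to measurable sets; the intersection with a
    cube keeps all measures finite. *)
Lemma cindic_tcont (A : set E) k : measurable A -> tcont (cindic (A `&` cube k)).
Proof.
move=> mA.
pose H := [set A : set E | measurable A /\ forall k, tcont (cindic (A `&` cube k))].
suff : <<s boxes >> `<=` H by move=> /(_ A (measurable_sub_boxes mA))[_]; exact.
have mcube n : measurable (cube n) by exact: measurable_box.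
apply: lambda_system_subset => //.
- by move=> _ _ [a [b ->]] [a' [b' ->]]; rewrite boxI; eexists; eexists.
- split=> //.
  + by split=> // n; rewrite setTI; exact: tcont_box.
  + move=> X Y YX [mX cX] [mY cY]; split; first exact: measurableD.
    move=> n; rewrite (_ : cindic _ = fun x => cindic (X `&` cube n) x +
        (-1) * cindic (Y `&` cube n) x).
      apply: tcontD => //; try by apply: cmeasurable_cindic; exact: measurableI.
        by apply: cmeasurableM; [exact: cmeasurable_cst|apply: cmeasurable_cindic; exact: measurableI].
      by apply: tcontZ => //; apply: cmeasurable_cindic; exact: measurableI.
    apply/funext => x; rewrite /cindic !indicE classical_sets.in_setI classical_sets.in_setD !classical_sets.in_setI mulN1r -rmorphB.
    congr (_ %:C); have [xY|xY] := boolP (x \in Y).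
      have -> : x \in X by rewrite inE; apply: YX; rewrite inE in xY.
      by rewrite /= subrr.
    by rewrite /= subr0 andbT.
  + move=> F ndF HF; have mF n : measurable (F n) by have [] := HF n.
    have mUF : measurable (\bigcup_i F i) by exact: bigcup_measurable.
    split=> // n; set U := \bigcup_i F i.
    apply: tcont_lim; first by apply: cmeasurable_cindic; exact: measurableI.
    move=> eta eta0; pose FK i := F i `&` cube n.
    have mFK i : measurable (FK i) by exact: measurableI.
    have UE : \bigcup_i FK i = U `&` cube n by rewrite /FK -setI_bigcupl.
    have ndFK : nondecreasing_seq FK.
      by move=> i j ij; apply/subsetPset; apply: setSI; apply/subsetPset; exact: ndF.
    have cF : mu (FK i) @[i --> \oo] --> mu (U `&` cube n).
      by rewrite -UE; apply: nondecreasing_cvg_mu => //; rewrite UE; exact: measurableI.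
    have fK : mu (U `&` cube n) \is a fin_num.
      rewrite ge0_fin_numE//; apply: le_lt_trans (box_lty (fun=> - n%:R) (fun=> n%:R)).
      by apply: le_measure; rewrite ?inE//; [exact: measurableI|exact: measurable_box].
    have sub i : FK i `<=` U `&` cube n by move=> x Fx; rewrite -UE; exists i.
    have fKi i : mu (FK i) \is a fin_num.
      rewrite ge0_fin_numE//; apply: (@le_lt_trans _ _ (mu (U `&` cube n))).
        by apply: le_measure; rewrite ?inE//; exact: measurableI.
      by rewrite -ge0_fin_numE.
    have [m mP] : exists m, (mu (U `&` cube n) - eta%:E <= mu (FK m))%E.
      apply: contrapT => noM.
      have : (limn (fun m => mu (FK m)) <= mu (U `&` cube n) - eta%:E)%E.
        apply: lime_le; first by apply/cvg_ex; eexists; exact: cF.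
        apply: nearW => m; rewrite leNgt; apply/negP => lt1; apply: noM.
        by exists m; exact: ltW.
      rewrite (cvg_lim _ cF)// leeBrDr// -(fineK fK) -EFinD lee_fin; lra.
    exists (cindic (FK m)); split.
    * exact: cmeasurable_cindic.
    * by have [_] := HF m; exact.
    rewrite (_ : (fun x => _) = cindic ((U `&` cube n) `\` FK m)).
      rewrite energy_cindic; last by apply: measurableD => //; exact: measurableI.
      rewrite measureD//; [|exact: measurableI|by rewrite -ge0_fin_numE].
      have -> : U `&` cube n `&` FK m = FK m.
        by apply/seteqP; split => [x []//|x Fx]; split=> //; exact: (sub m).
      by rewrite leeBlDr ?fKi// addeC -leeBlDr.
    apply/funext => x; rewrite /cindic !indicE classical_sets.in_setD -rmorphB; congr (_ %:C).
    have [xF|xF] := boolP (x \in FK m); last by rewrite subr0 andbT.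
    have -> : x \in U `&` cube n by exact: mem_set (sub m x (set_mem xF)).
    by rewrite subrr.
- by move=> _ [a [b ->]]; split; [exact: measurable_box|move=> n; rewrite boxI; exact: tcont_box].
Qed.

Import HBNNSimple.

(** Non-negative functions in L^2 are limits of simple functions supported in
    cubes. *)
Lemma tcont_nonneg (phi : E -> R) : measurable_fun setT phi -> (forall x, 0 <= phi x) ->
  (\int[mu]_x (phi x ^+ 2)%:E < +oo)%E -> tcont (fun x => (phi x)%:C).
Proof.
move=> mphi phi0 phi2.
have mE : measurable_fun setT (EFin \o phi) by exact/measurable_EFinP.
pose s n := nnsfun_approx measurableT mE n.
have s_cvg x : s n x @[n --> \oo] --> phi x.
  have c : (EFin \o (s ^~ x)) n @[n --> \oo] --> (phi x)%:E.
    by apply: (cvg_nnsfun_approx measurableT mE) => // y _; rewrite lee_fin.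
  exact: (fine_cvg c).
have s_nd x : nondecreasing_seq (s ^~ x).
  move=> m n mn; have /lefP/(_ x) := nd_nnsfun_approx measurableT mE mn.
  exact.
have s_le n x : s n x <= phi x.
  have := nondecreasing_cvgn_le (s_nd x) (cvgP _ (s_cvg x)) n.
  by rewrite (cvg_lim _ (s_cvg x)).
have ms n : measurable_fun setT (s n) by exact: measurable_funP.
have s0 n x : 0 <= s n x by exact: fun_ge0.
pose g n x := s n x * \1_(cube n) x.
have mcube n : measurable (cube n) by exact: measurable_box.
have mg n : measurable_fun setT (g n).
  by apply: measurable_funM => //; exact: measurable_indic.
have g0 n x : 0 <= g n x by rewrite mulr_ge0// indicE.
have g_le n x : g n x <= phi x.
  rewrite /g indicE; case: (x \in _); rewrite ?mulr1 ?mulr0 ?phi0//; exact: s_le.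
have g_cvg x : g n x @[n --> \oo] --> phi x.
  have [k kx] := mem_cube x; apply: cvg_trans (s_cvg x).
  apply: near_eq_cvg; exists k => // n /= kn.
  by rewrite /g indicE mem_set ?mulr1//; exact: kx.
have mf2 : measurable_fun setT (fun x => (phi x ^+ 2)%:E).
  by apply/measurable_EFinP; exact: measurable_funX.
have iphi : mu.-integrable setT (fun x => (phi x ^+ 2)%:E).
  apply/integrableP; split=> //.
  by under eq_integral do rewrite gee0_abs ?lee_fin ?sqr_ge0//.
have mdiff n : measurable_fun setT (fun x => ((phi x - g n x) ^+ 2)%:E).
  by apply/measurable_EFinP; apply: measurable_funX; exact: measurable_funB.
have [||||] := @dominated_convergence _ _ _ mu setT measurableT
  (fun n x => ((phi x - g n x) ^+ 2)%:E) (fun=> 0%E) (fun x => (phi x ^+ 2)%:E) mdiff.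
- exact: measurable_cst.
- apply: nearW => x _; apply: cvg_EFin; first exact: nearW.
  rewrite /comp /=; have : phi x - g n x @[n --> \oo] --> 0.
    by rewrite -(subrr (phi x)); apply: cvgB => //; exact: cvg_cst.
  move=> c; rewrite -(mulr0 (0 : R)); under eq_fun do rewrite expr2.
  exact: cvgM.
- exact: iphi.
- apply: nearW => x n _; rewrite /= lee_fin ger0_norm ?sqr_ge0//.
  rewrite ler_pXn2r ?nnegrE// ?subr_ge0//; last by rewrite gerBl.
move=> _ _; rewrite integral0 => c0.
apply: tcont_lim; first exact: cmeasurable_real.
move=> eta eta0.
have [n nP] : exists n, (\int[mu]_x ((phi x - g n x) ^+ 2)%:E <= eta%:E)%E.
  apply: contrapT => noN.
  have : (eta%:E <= limn (fun n => \int[mu]_x ((phi x - g n x) ^+ 2)%:E))%E.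
    apply: lime_ge; first by apply/cvg_ex; eexists; exact: c0.
    apply: nearW => n; rewrite leNgt; apply/negP => lt1; apply: noN.
    by exists n; exact: ltW.
  by rewrite (cvg_lim _ c0)// lee_fin leNgt eta0.
exists (fun x => (g n x)%:C); split; first exact: cmeasurable_real.
  have ms1 (y : R) : measurable (s n @^-1` [set y]) by exact: measurable_sfunP.
  rewrite (_ : (fun x => _) = (fun x => \sum_(y <- fset_set (range (s n)))
      y%:C * cindic (s n @^-1` [set y] `&` cube n) x)).
    apply: tcont_sum => y.
      by apply: cmeasurableM; [exact: cmeasurable_cst|apply: cmeasurable_cindic; exact: measurableI].
    apply: tcontZ; first by apply: cmeasurable_cindic; exact: measurableI.
    exact: cindic_tcont.
  apply/funext => x; rewrite /g fimfunE fsbig_finite; last exact: fimfunP.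
  rewrite /= mulr_suml rmorph_sum /=.
  apply: eq_bigr => y _; rewrite /cindic -rmorphM /= -mulrA; congr (_ * _)%:C.
  by rewrite !indicE classical_sets.in_setI -mulnb natrM.
rewrite /energy; under eq_integral do rewrite -rmorphB sqm_real.
exact: nP.
Qed.

Lemma measurable_Rpos (phi : E -> R) : measurable_fun setT phi ->
  measurable_fun setT (fun x => Num.max (phi x) 0).
Proof. by move=> m; apply: measurable_maxr => //; exact: measurable_cst. Qed.

Lemma tcont_real (phi : E -> R) : measurable_fun setT phi ->
  (\int[mu]_x (phi x ^+ 2)%:E < +oo)%E -> tcont (fun x => (phi x)%:C).
Proof.
move=> mphi phi2.
have pos (p : E -> R) : measurable_fun setT p -> (\int[mu]_x (p x ^+ 2)%:E < +oo)%E ->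
    tcont (fun x => (Num.max (p x) 0)%:C).
  move=> mp p2; apply: tcont_nonneg; first exact: measurable_Rpos.
    by move=> x; rewrite le_max lexx orbT.
  apply: le_lt_trans p2; apply: ge0_le_integral => //.
  - by move=> x _; rewrite lee_fin sqr_ge0.
  - by apply/measurable_EFinP; apply: measurable_funX; exact: measurable_Rpos.
  - by apply/measurable_EFinP; exact: measurable_funX.
  - move=> x _; rewrite lee_fin; have [p0|p0] := leP (p x) 0; rewrite ?expr0n ?sqr_ge0//.
have mN : measurable_fun setT (fun x => - phi x) by exact: measurable_funN.
have -> : (fun x => (phi x)%:C) =
    (fun x => (Num.max (phi x) 0)%:C + (-1) * (Num.max (- phi x) 0)%:C).
  apply/funext => x; rewrite mulN1r -rmorphB; congr (_ %:C).
  by have [p0|p0] := leP (phi x) 0; have [q0|q0] := leP (- phi x) 0; lra.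
apply: tcontD.
- by apply: cmeasurable_real; exact: measurable_Rpos.
- by apply: cmeasurableM; [exact: cmeasurable_cst|apply: cmeasurable_real; exact: measurable_Rpos].
- exact: pos.
apply: tcontZ; first by apply: cmeasurable_real; exact: measurable_Rpos.
by apply: pos => //; under eq_integral do rewrite sqrrN.
Qed.

Theorem L2_translation_continuous (f : E -> C) : L2 f -> tcont f.
Proof.
move=> fL; have [mR mI f2] := fL.
have mf := L2_cmeasurable fL.
have bnd (p : E -> R) : measurable_fun setT p -> (forall x, p x ^+ 2 <= sqm (f x)) ->
    (\int[mu]_x (p x ^+ 2)%:E < +oo)%E.
  move=> mp pf; apply: le_lt_trans f2; apply: ge0_le_integral => //.
  - by move=> x _; rewrite lee_fin sqr_ge0.
  - by apply/measurable_EFinP; exact: measurable_funX.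
  - exact: measurable_esqm.
  - by move=> x _; rewrite lee_fin; exact: pf.
have -> : f = (fun x => (Re (f x))%:C + 'i%C * (Im (f x))%:C).
  by apply/funext => x; exact: complexE.
apply: tcontD.
- exact: cmeasurable_real.
- by apply: cmeasurableM; [exact: cmeasurable_cst|exact: cmeasurable_real].
- by apply: tcont_real => //; apply: bnd => // x; exact: Re_sqr_le.
apply: tcontZ; first exact: cmeasurable_real.
by apply: tcont_real => //; apply: bnd => // x; exact: Im_sqr_le.
Qed.

End translation_continuity_L2.

(** * Iterated complex integrals and characters *)

Section complex_fubini.
Context d1 d2 (T1 : measurableType d1) (T2 : measurableType d2) (R : realType).
Variable m1 : {sigma_finite_measure set T1 -> \bar R}.
Variable m2 : {sigma_finite_measure set T2 -> \bar R}.

Lemma Rfubini (f : T1 * T2 -> R) :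
  (m1 \x m2)%E.-integrable setT (fun p => (f p)%:E) ->
  (forall x, m2.-integrable setT (fun y => (f (x, y))%:E)) ->
  (forall y, m1.-integrable setT (fun x => (f (x, y))%:E)) ->
  \int[m1]_x (\int[m2]_y f (x, y)) = \int[m2]_y (\int[m1]_x f (x, y)).
Proof.
move=> fi f1 f2; rewrite {1 3}/Rintegral.
have -> : (\int[m1]_x (\int[m2]_y f (x, y))%:E = \int[m1]_x \int[m2]_y (f (x, y))%:E)%E.
  by apply: eq_integral => x _; rewrite fineK//; exact: integrable_fin_num (f1 x).
have -> : (\int[m2]_y (\int[m1]_x f (x, y))%:E = \int[m2]_y \int[m1]_x (f (x, y))%:E)%E.
  by apply: eq_integral => x _; rewrite fineK//; exact: integrable_fin_num (f2 x).
by rewrite (Fubini fi).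
Qed.

Lemma integrable_Rintegral_r (f : T1 * T2 -> R) :
  (m1 \x m2)%E.-integrable setT (fun p => (f p)%:E) ->
  (forall x, m2.-integrable setT (fun y => (f (x, y))%:E)) ->
  m1.-integrable setT (fun x => (\int[m2]_y f (x, y))%:E).
Proof.
move=> fi f2.
rewrite (_ : (fun x => _) = (fun x => \int[m2]_y (f (x, y))%:E)%E).
  exact: (integrable_fubini_F fi).
by apply/funext => x; rewrite fineK//; exact: integrable_fin_num (f2 x).
Qed.

(** Integrability of every section keeps exceptional null sets out of the
    iterated integrals. *)
Definition fubini_ok (F : T1 * T2 -> R[i]) : Prop :=
  [/\ cintegrable (m1 \x m2)%E F,
      forall x, cintegrable m2 (fun y => F (x, y)) &
      forall y, cintegrable m1 (fun x => F (x, y))].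

Lemma fubini_okP (F : T1 * T2 -> R[i]) (g : T1 * T2 -> R) : cmeasurable F ->
  measurable_fun setT g -> (forall p, 0 <= g p) -> (forall p, sqm (F p) <= g p ^+ 2) ->
  (\int[m1]_x \int[m2]_y (g (x, y))%:E < +oo)%E ->
  (forall x, cintegrable m2 (fun y => F (x, y))) ->
  (forall y, cintegrable m1 (fun x => F (x, y))) -> fubini_ok F.
Proof.
move=> mF mg g0 Fg gfin F1 F2; split => //.
apply: (cintegrable_dominated mF g0 Fg).
have mEg : measurable_fun setT (fun p => (g p)%:E) by exact/measurable_EFinP.
apply: (iffRL (@integrable12ltyP _ _ _ _ _ m1 m2 _ mEg)).
by under eq_integral do under eq_integral do rewrite gee0_abs ?lee_fin//.
Qed.

Lemma cfubini F : fubini_ok F ->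
  cintegral m1 (fun x => cintegral m2 (fun y => F (x, y))) =
  cintegral m2 (fun y => cintegral m1 (fun x => F (x, y))).
Proof.
move=> [[FR FI] F1 F2]; apply: eq_ReIm => /=.
- by apply: (Rfubini FR) => [x|y]; [have [] := F1 x|have [] := F2 y].
- by apply: (Rfubini FI) => [x|y]; [have [] := F1 x|have [] := F2 y].
Qed.

Lemma cintegrable_cintegral_r F : fubini_ok F ->
  cintegrable m1 (fun x => cintegral m2 (fun y => F (x, y))).
Proof.
move=> [[FR FI] F1 F2]; split => /=.
- by apply: (integrable_Rintegral_r FR) => x; have [] := F1 x.
- by apply: (integrable_Rintegral_r FI) => x; have [] := F1 x.
Qed.
End complex_fubini.

Section modulus_bound.
Context d' (T : measurableType d') (R : realType) (nu : {measure set T -> \bar R}).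

(** Equivalent to the modulus, and free of square roots. *)
Definition l1mod (f : T -> R[i]) x := `|Re (f x)| + `|Im (f x)|.

Lemma l1mod_ge0 f x : 0 <= l1mod f x. Proof. by rewrite addr_ge0. Qed.

Lemma sqm_le_l1mod f x : sqm (f x) <= l1mod f x ^+ 2.
Proof.
rewrite /sqm /l1mod sqrrD !real_normK ?num_real//.
have : 0 <= `|Re (f x)| * `|Im (f x)| by rewrite mulr_ge0.
by rewrite -mulr_natl; lra.
Qed.

Lemma measurable_l1mod f : cmeasurable f -> measurable_fun setT (l1mod f).
Proof.
by move=> [mR mI]; apply: measurable_funD; apply: measurableT_comp.
Qed.

Lemma integrable_l1mod f : cintegrable nu f -> nu.-integrable setT (fun x => (l1mod f x)%:E).
Proof.
move=> [fR fI]; rewrite (_ : (fun x => _) = (fun x => `|(Re (f x))%:E| + `|(Im (f x))%:E|)%E) //.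
by apply: integrableD => //; exact: integrable_abse.
Qed.

Lemma cintegrable_measurable f : cintegrable nu f -> cmeasurable f.
Proof.
by move=> [/integrableP[mR _] /integrableP[mI _]]; split; apply/measurable_EFinP.
Qed.

Lemma cintegrable_bounded_mul f (b : T -> R[i]) (M : R) : 0 <= M ->
  cintegrable nu f -> cmeasurable b -> (forall x, sqm (b x) <= M ^+ 2) ->
  cintegrable nu (fun x => f x * b x).
Proof.
move=> M0 fi mb bM; apply: (@cintegrable_dominated _ _ _ _ _ (fun x => M * l1mod f x)).
- by apply: cmeasurableM => //; exact: cintegrable_measurable fi.
- by move=> x; rewrite mulr_ge0// l1mod_ge0.
- move=> x; rewrite sqmM mulrC exprMn ler_pM ?sqm_ge0//; exact: sqm_le_l1mod.
- under eq_fun do rewrite EFinM; apply: integrableZl => //; exact: integrable_l1mod.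
Qed.
End modulus_bound.

Section characters.
Context {R : realType} {n : nat}.
Local Notation E := 'rV[R]_n.

Lemma sqm_cis (a : R) : sqm (cis a) = 1.
Proof. by rewrite /sqm /= cos2Dsin2. Qed.

Lemma cisD (a b : R) : cis (a + b) = cis a * cis b.
Proof. by apply: eq_ReIm; rewrite ?ReIm /= ?cosD ?sinD //; ring. Qed.

Lemma conj_cis (a : R) : conjc (cis a) = cis (- a).
Proof. by rewrite /cis /= cosN sinN. Qed.

Lemma dotDl (s t w : E) : dot (s + t) w = dot s w + dot t w.
Proof. by rewrite /dot -big_split; apply: eq_bigr => i _; rewrite mxE mulrDl. Qed.

Lemma cmeasurable_cis d' (T : measurableType d') (f : T -> R) :
  measurable_fun setT f -> cmeasurable (fun x => cis (f x)).
Proof. by move=> mf; split; [exact: measurable_cos_comp|exact: measurable_sin_comp]. Qed.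

(** The character t |-> exp (- 2 pi i t . w). *)
Definition chr (t w : E) : R[i] := conjc (cis (2 * pi * dot t w)).

Lemma chrD s t w : chr (s + t) w = chr s w * chr t w.
Proof. by rewrite /chr dotDl mulrDr cisD conjcM. Qed.

Lemma sqm_chr t w : sqm (chr t w) = 1. Proof. by rewrite sqmJ sqm_cis. Qed.

Lemma chr_conj t w : chr t w * conjc (chr t w) = 1.
Proof. by rewrite mulcJ sqm_chr. Qed.

Lemma cmeasurable_chr d' (T : measurableType d') (f g : T -> E) :
  measurable_fun setT f -> measurable_fun setT g ->
  cmeasurable (fun x => chr (f x) (g x)).
Proof.
move=> mf mg; apply: cmeasurableJ; apply: cmeasurable_cis.
by apply: measurable_funM; [exact: measurable_cst|exact: measurable_dot].
Qed.

Lemma cintegral_shift (a : E) (f : E -> R[i]) : cmeasurable f ->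
  cintegral (lebesgue_rV n) (fun x => f (x + a)) = cintegral (lebesgue_rV n) f.
Proof.
move=> [mR mI]; apply: eq_ReIm; rewrite /= /Rintegral; congr fine.
- by apply: (integral_shift a (f := fun x => (Re (f x))%:E)); exact/measurable_EFinP.
- by apply: (integral_shift a (f := fun x => (Im (f x))%:E)); exact/measurable_EFinP.
Qed.

Lemma cintegrable_shift (a : E) (f : E -> R[i]) : cintegrable (lebesgue_rV n) f ->
  cintegrable (lebesgue_rV n) (fun x => f (x + a)).
Proof.
have key (h : E -> R) : (lebesgue_rV n).-integrable setT (fun x => (h x)%:E) ->
    (lebesgue_rV n).-integrable setT (fun x => (h (x + a))%:E).
  move=> /integrableP[mh hfin]; apply/integrableP; split.
    apply: (measurableT_comp mh); apply: measurable_rV_add => //; exact: measurable_cst.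
  rewrite (ge0_integral_shift a (f := fun x => `|(h x)%:E|%E))//.
  exact: measurableT_comp.
by move=> [fR fI]; split; [exact: key (fun x => Re (f x)) fR|exact: key (fun x => Im (f x)) fI].
Qed.
End characters.

(** * Plancherel's inequality *)

Lemma cintegrableJ d' (T : measurableType d') (R : realType)
    (nu : {measure set T -> \bar R}) (f : T -> R[i]) :
  cintegrable nu f -> cintegrable nu (fun x => conjc (f x)).
Proof.
move=> [fR fI]; split; first by under eq_fun do rewrite cReJ.
by under eq_fun do rewrite cImJ EFinN; exact: integrableN.
Qed.

Section measurable_integral.
Context d1 d2 (T1 : measurableType d1) (T2 : measurableType d2) (R : realType).
Variable m2 : {sigma_finite_measure set T2 -> \bar R}.

Lemma measurable_Rintegral (f : T1 * T2 -> R) : measurable_fun setT f ->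
  measurable_fun setT (fun x => \int[m2]_y f (x, y)).
Proof.
move=> mf; have mE : measurable_fun setT (fun p => (f p)%:E) by exact/measurable_EFinP.
rewrite /Rintegral; apply: (measurableT_comp (f := @fine R)) => //.
under eq_fun do rewrite integralE.
apply: emeasurable_funB.
  have := (@measurable_fun_fubini_tonelli_F _ _ _ _ _ m2 _ (measurable_funepos mE) (funepos_ge0 _)).
  by congr (measurable_fun _ _); apply/funext => x; apply: eq_integral => y _; rewrite !funeposE.
have := (@measurable_fun_fubini_tonelli_F _ _ _ _ _ m2 _ (measurable_funeneg mE) (funeneg_ge0 _)).
by congr (measurable_fun _ _); apply/funext => x; apply: eq_integral => y _; rewrite !funenegE.
Qed.

Lemma cmeasurable_cintegral (F : T1 * T2 -> R[i]) : cmeasurable F ->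
  cmeasurable (fun x => cintegral m2 (fun y => F (x, y))).
Proof.
by move=> [mR mI]; split; [exact: (measurable_Rintegral mR)|exact: (measurable_Rintegral mI)].
Qed.
End measurable_integral.

Section plancherel.
Context {R : realType} {n : nat}.
Local Notation E := 'rV[R]_n.
Local Notation C := R[i].
Local Notation mu := (@lebesgue_rV R n).

Lemma L2_shift (h : E -> C) (u : E) : L2 h -> L2 (fun t => h (t + u)).
Proof.
move=> hL; have mh := L2_cmeasurable hL; apply: cmeasurable_L2.
  exact: cmeasurable_shift.
rewrite -/(energy (fun t => h (t + u))) energy_shift//.
by rewrite /energy -EFin_inner// ltry.
Qed.

Lemma measurable_add_pair : measurable_fun setT (fun p : E * E => p.2 + p.1 : E).
Proof. by apply: measurable_rV_add; [exact: measurable_snd|exact: measurable_fst]. Qed.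

Variables (h : E -> C).
Hypotheses (h1 : cintegrable mu h) (h2 : L2 h).

Definition fourier (w : E) : C := cintegral mu (fun t => h t * chr t w).
Definition autocorr (u : E) : C := cintegral mu (fun t => h (t + u) * conjc (h t)).

Let mh := L2_cmeasurable h2.

Let corr_kernel_ok (w : E) : fubini_ok mu mu
  (fun p : E * E => conjc (h p.2) * (h (p.2 + p.1) * chr p.1 w)).
Proof.
have mh2 : cmeasurable (fun p : E * E => h p.2).
  exact: (cmeasurable_comp measurable_snd mh).
have mha : cmeasurable (fun p : E * E => h (p.2 + p.1)).
  exact: (cmeasurable_comp measurable_add_pair mh).
have ml : measurable_fun setT (fun t => (l1mod h t)%:E).
  by apply/measurable_EFinP; exact: measurable_l1mod.
have l0 t : (0 <= (l1mod h t)%:E)%E by rewrite lee_fin l1mod_ge0.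
have fl : (\int[mu]_t (l1mod h t)%:E < +oo)%E.
  have /integrableP[_] := integrable_l1mod h1; congr (_ < _)%E.
  by apply: eq_integral => t _; rewrite gee0_abs.
apply: (@fubini_okP _ _ _ _ _ _ _ _ (fun p : E * E => l1mod h p.2 * l1mod h (p.2 + p.1))).
- apply: cmeasurableM; first exact: cmeasurableJ.
  apply: cmeasurableM => //; apply: cmeasurable_chr; first exact: measurable_fst.
  exact: measurable_cst.
- apply: measurable_funM.
    exact: (measurableT_comp (measurable_l1mod mh) measurable_snd).
  exact: (measurableT_comp (measurable_l1mod mh) measurable_add_pair).
- by move=> p; rewrite mulr_ge0// l1mod_ge0.
- move=> p; rewrite !sqmM sqmJ sqm_chr mulr1 exprMn.
  by apply: ler_pM; rewrite ?sqm_ge0 ?sqm_le_l1mod.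
- rewrite (@fubini_tonelli _ _ _ _ _ mu mu
    (fun p : E * E => (l1mod h p.2 * l1mod h (p.2 + p.1))%:E)); first last.
  + by move=> p; rewrite lee_fin mulr_ge0// l1mod_ge0.
  + apply/measurable_EFinP; apply: measurable_funM.
      exact: (measurableT_comp (measurable_l1mod mh) measurable_snd).
    exact: (measurableT_comp (measurable_l1mod mh) measurable_add_pair).
  have step t : (\int[mu]_u (l1mod h t * l1mod h (t + u))%:E =
      (l1mod h t)%:E * \int[mu]_u (l1mod h u)%:E)%E.
    rewrite -(ge0_integral_shift t ml l0).
    under eq_integral do rewrite EFinM.
    rewrite ge0_integralZl//; first by congr (_ * _)%E; apply: eq_integral => u _; rewrite addrC.
    apply/measurable_EFinP; apply: (measurableT_comp (measurable_l1mod mh)).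
    by apply: measurable_rV_add => //; exact: measurable_cst.
  under eq_integral do rewrite step.
  have fn : (\int[mu]_u (l1mod h u)%:E)%E \is a fin_num.
    by rewrite ge0_fin_numE//; apply: integral_ge0.
  rewrite ge0_integralZr//; last exact: integral_ge0.
  by rewrite -(fineK fn) -EFinM ltry.
- move=> u; have := cintegrableZ (chr u w) (L2_cintegrable (L2_shift u h2) h2).
  by congr cintegrable; apply/funext => t /=; ring.
- move=> t; have hs := cintegrable_shift t h1.
  have mc : cmeasurable (fun u : E => chr u w).
    by apply: cmeasurable_chr => //; exact: measurable_cst.
  have := cintegrable_bounded_mul (M := 1) ler01 (cintegrableZ (conjc (h t)) hs) mc.
  under eq_fun do rewrite addrC -mulrA.
  by apply=> x; rewrite sqm_chr expr1n.
Qed.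

Lemma cintegrable_autocorr : cintegrable mu autocorr.
Proof.
have := cintegrable_cintegral_r (corr_kernel_ok 0); congr cintegrable.
apply/funext => u; apply: eq_cintegral => t /=.
have -> : chr u 0 = 1.
  rewrite /chr /dot big1 ?mulr0; last by move=> i _; rewrite mxE mulr0.
  by rewrite /cis cos0 sin0; apply: eq_ReIm => //=; rewrite oppr0.
by rewrite mulr1 mulrC.
Qed.

(** Wiener--Khinchin: the power spectrum is the transform of the autocorrelation. *)
Lemma sqm_fourier (w : E) :
  (sqm (fourier w))%:C = cintegral mu (fun u => chr u w * autocorr u).
Proof.
have := cfubini (corr_kernel_ok w) => /=.
have -> : cintegral mu (fun u => cintegral mu (fun t =>
    conjc (h t) * (h (t + u) * chr u w))) = cintegral mu (fun u => chr u w * autocorr u).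
  apply: eq_cintegral => u.
  rewrite -cintegralZ; last exact: (L2_cintegrable (L2_shift u h2) h2).
  by apply: eq_cintegral => t; ring.
move=> ->.
have hc : cintegrable mu (fun t => h t * chr t w).
  apply: (cintegrable_bounded_mul ler01 h1).
    by apply: cmeasurable_chr => //; exact: measurable_cst.
  by move=> x; rewrite sqm_chr expr1n.
have inner_u t : cintegral mu (fun u => conjc (h t) * (h (t + u) * chr u w)) =
    fourier w * conjc (h t * chr t w).
  have hs := cintegrable_shift t hc.
  rewrite (_ : (fun u => _) = fun u => conjc (h t * chr t w) * (h (u + t) * chr (u + t) w)).
    rewrite cintegralZ// (cintegral_shift t (f := fun u => h u * chr u w)); last first.
      exact: cintegrable_measurable hc.
    by rewrite mulrC.
  apply/funext => u; rewrite (addrC u t) chrD conjcM.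
  transitivity (conjc (h t) * (h (t + u) * chr u w) * (chr t w * conjc (chr t w))).
    by rewrite chr_conj mulr1.
  ring.
rewrite (eq_cintegral _ inner_u) cintegralZ; last exact: cintegrableJ.
by rewrite cintegralJ// mulcJ.
Qed.
Lemma measurable_fourier : cmeasurable fourier.
Proof.
pose F := fun p : E * E => h p.2 * chr p.2 p.1.
have mF : cmeasurable F.
  apply: cmeasurableM; first exact: (cmeasurable_comp measurable_snd mh).
  by apply: cmeasurable_chr; [exact: measurable_snd|exact: measurable_fst].
exact: (cmeasurable_cintegral mu mF).
Qed.

Section damped.
Variables (e : R) (e0 : 0 < e).

Lemma cintegrable_damp : cintegrable mu (fun w : E => (damp e w)%:C).
Proof.
split => /=; first exact: integrable_damp.
rewrite (_ : (fun x => _) = cst 0%E)//; exact: integrable0.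
Qed.

Lemma cintegrable_damp_chr (u : E) : cintegrable mu (fun w => (damp e w)%:C * chr u w).
Proof.
apply: (cintegrable_bounded_mul ler01 cintegrable_damp).
  by apply: cmeasurable_chr => //; exact: measurable_cst.
by move=> x; rewrite sqm_chr expr1n.
Qed.

Let damped_kernel_ok : fubini_ok mu mu
  (fun p : E * E => (damp e p.1)%:C * (chr p.2 p.1 * autocorr p.2)).
Proof.
have iB := cintegrable_autocorr; have mB := cintegrable_measurable iB.
have mc : cmeasurable (fun p : E * E => chr p.2 p.1).
  by apply: cmeasurable_chr; [exact: measurable_snd|exact: measurable_fst].
have md : measurable_fun setT (@damp R e n) by exact: measurable_damp.
have id := integrable_damp e0 n.
have d0 (w : E) : 0 <= damp e w := damp_ge0 e w.
have mg : measurable_fun setT (fun p : E * E => damp e p.1 * l1mod autocorr p.2).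
  apply: measurable_funM; first exact: (measurableT_comp md measurable_fst).
  exact: (measurableT_comp (measurable_l1mod mB) measurable_snd).
apply: (@fubini_okP _ _ _ _ _ _ _ _ (fun p : E * E => damp e p.1 * l1mod autocorr p.2)) => //.
- apply: cmeasurableM.
    exact: cmeasurable_real (measurableT_comp md measurable_fst).
  by apply: cmeasurableM => //; exact: (cmeasurable_comp measurable_snd mB).
- by move=> p; rewrite mulr_ge0// l1mod_ge0.
- move=> p; rewrite !sqmM sqm_chr mul1r sqm_real exprMn.
  by apply: ler_pM; rewrite ?sqr_ge0 ?sqm_ge0 ?sqm_le_l1mod.
- have fl : (\int[mu]_u (l1mod autocorr u)%:E < +oo)%E.
    have /integrableP[_] := integrable_l1mod iB; congr (_ < _)%E.
    by apply: eq_integral => t _; rewrite gee0_abs// lee_fin l1mod_ge0.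
  have fd : (\int[mu]_u (damp e u)%:E < +oo)%E.
    have /integrableP[_] := id; congr (_ < _)%E.
    by apply: eq_integral => t _; rewrite gee0_abs// lee_fin.
  have l0 : (0 <= \int[mu]_u (l1mod autocorr u)%:E)%E.
    by apply: integral_ge0 => x _; rewrite lee_fin l1mod_ge0.
  have fn : (\int[mu]_u (l1mod autocorr u)%:E)%E \is a fin_num by rewrite ge0_fin_numE.
  have step (w : E) : (\int[mu]_u (damp e w * l1mod autocorr u)%:E =
      (damp e w)%:E * \int[mu]_u (l1mod autocorr u)%:E)%E.
    under eq_integral do rewrite EFinM.
    rewrite ge0_integralZl//; first by apply/measurable_EFinP; exact: measurable_l1mod.
      by move=> x _; rewrite lee_fin l1mod_ge0.
    by rewrite lee_fin; exact: d0.
  under eq_integral do rewrite step.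
  rewrite ge0_integralZr//; first last.
  + by move=> x _; rewrite lee_fin; exact: d0.
  + exact/measurable_EFinP.
  have fdn : (\int[mu]_u (damp e u)%:E)%E \is a fin_num.
    by rewrite ge0_fin_numE//; apply: integral_ge0 => x _; rewrite lee_fin.
  by rewrite -(fineK fn) -(fineK fdn) -EFinM ltry.
- move=> w; apply: (cintegrableZ (damp e w)%:C (f := fun u => chr u w * autocorr u)).
  under eq_fun do rewrite mulrC.
  apply: (cintegrable_bounded_mul ler01 iB).
    by apply: cmeasurable_chr => //; exact: measurable_cst.
  by move=> x; rewrite sqm_chr expr1n.
- move=> u /=; have := cintegrableZ (autocorr u) (cintegrable_damp_chr u).
  by congr cintegrable; apply/funext => w; ring.
Qed.

(** Fubini once more: integrating the characters against [damp] produces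
    [poisson]. Damping makes the integral over the frequencies converge before
    anything is known about the energy of the transform. *)
Lemma damped_spectrum :
  mu.-integrable setT (fun w => (damp e w * sqm (fourier w))%:E) /\
  \int[mu]_w (damp e w * sqm (fourier w)) = \int[mu]_u (Re (autocorr u) * poisson e u).
Proof.
have iB := cintegrable_autocorr; have mB := cintegrable_measurable iB.
have row w : cintegral mu (fun u => (damp e w)%:C * (chr u w * autocorr u)) =
    (damp e w * sqm (fourier w))%:C.
  rewrite cintegralZ; first by rewrite -sqm_fourier rmorphM.
  under eq_fun do rewrite mulrC; apply: (cintegrable_bounded_mul ler01 iB).
    by apply: cmeasurable_chr => //; exact: measurable_cst.
  by move=> x; rewrite sqm_chr expr1n.
have col u : cintegral mu (fun w => (damp e w)%:C * (chr u w * autocorr u)) =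
    (poisson e u)%:C * autocorr u.
  rewrite (_ : (fun w => _) = fun w => autocorr u * ((damp e w)%:C * chr u w)); last first.
    by apply/funext => w; ring.
  have [c s] := fourier_damp e0 u.
  rewrite cintegralZ; last exact: cintegrable_damp_chr.
  rewrite mulrC; congr (_ * _).
  rewrite (_ : (fun w => _) = fun w => conjc ((damp e w)%:C * cis (2 * pi * dot u w))).
    rewrite cintegralJ.
      apply: eq_ReIm => /=.
        by under eq_Rintegral do rewrite mul0r subr0.
      by under eq_Rintegral do rewrite mul0r addr0; rewrite s oppr0.
    apply: (cintegrable_bounded_mul ler01 cintegrable_damp).
    + by apply: cmeasurable_cis; exact: measurable_dot_cst.
    + by move=> x; rewrite sqm_cis expr1n.
  by apply/funext => w; rewrite conjcM /chr conjc_real.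
have [rI _] := cintegrable_cintegral_r damped_kernel_ok.
have := etrans (esym (eq_cintegral mu row)) (etrans (cfubini damped_kernel_ok) (eq_cintegral mu col)).
move=> /(congr1 (@complex.Re R)) /= fe.
split; first by move: rI; congr integrable; apply/funext => w; rewrite row.
rewrite fe; apply: eq_Rintegral => u _.
by rewrite mul0r subr0 mulrC.
Qed.
End damped.
End plancherel.

Section plancherel_inequality.
Context {R : realType} {n : nat}.
Local Notation E := 'rV[R]_n.
Local Notation C := R[i].
Local Notation mu := (@lebesgue_rV R n).
Local Notation leb := (@lebesgue_measure R).

(** The Poisson kernel cut to a cube has mass q^n for any q < 1 prescribed in
    advance, the width being tuned through the tangent. *)
Lemma poisson_concentrates (del q : R) : 0 < del -> 0 < q < 1 ->
  exists2 e : R, 0 < e & exists pb : E -> R,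
    [/\ measurable_fun setT pb, forall u, 0 <= pb u <= poisson e u,
        forall u : E, (forall i, `|u ord0 i| <= del) /\ pb u = poisson e u \/ pb u = 0 &
        (\int[mu]_u (pb u)%:E = (q ^+ n)%:E)%E].
Proof.
move=> del0 /andP[q0 q1].
have pi0 := pi_gt0 R.
set th := q * (pi / 2).
have th0 : 0 < th by rewrite mulr_gt0// divr_gt0.
have th1 : th < pi / 2 by rewrite gtr_pMl// divr_gt0.
have tan0 : 0 < tan th.
  by rewrite -tan0 ltr_tan// in_itv /= ?th0 ?th1 ?andbT; [rewrite oppr_lt0 divr_gt0 ?divr_gt0|lra].
exists (2 * pi * del / tan th); first by rewrite divr_gt0// !mulr_gt0.
set e := _ / _; have e0 : 0 < e by rewrite divr_gt0// !mulr_gt0.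
pose q1' (x : R) := pker e x * \1_(`[(- del)%R, del] : set R) x.
have mq : measurable_fun setT q1'.
  by apply: measurable_funM; [exact: measurable_pker|exact: measurable_indic].
have q1E x : q1' x = if `|x| <= del then pker e x else 0.
  rewrite /q1' indicE; case: ifPn => h.
    by rewrite mem_set ?mulr1// /= in_itv /= -ler_norml.
  by rewrite memNset ?mulr0// /= in_itv /= -ler_norml; exact/negP.
have q10 x : 0 <= q1' x by rewrite q1E; case: ifP => // _; exact: pker_ge0.
have q1le x : q1' x <= pker e x by rewrite q1E; case: ifP => // _; exact: pker_ge0.
exists (fun u => \prod_(i < n) q1' (u ord0 i)); split.
- exact: measurable_prod_coord.
- move=> u; rewrite prodr_ge0//= /poisson ler_prod// => i _.
  by rewrite q10 q1le.
- move=> u; have [h|h] := boolP [forall i, `|u ord0 i| <= del]; [left|right].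
    split; first exact/forallP.
    by apply: eq_bigr => i _; rewrite q1E (forallP h).
  by move: h; rewrite negb_forall => /existsP[i /negbTE h]; rewrite (bigD1 i)//= q1E h mul0r.
- apply: ge0_integral_prod_coord => //.
  have -> : (\int[leb]_x (q1' x)%:E = \int[leb]_(x in `[(- del)%R, del]) (pker e x)%:E)%E.
    rewrite [RHS]integral_mkcond; apply: eq_integral => x _.
    rewrite patchE /q1' indicE; case: ifPn => _ /=; first by rewrite mulr1.
    by rewrite mulr0.
  rewrite integral_pker_itv//; congr _%:E.
  have -> : 2 * pi / e * del = tan th.
    rewrite /e; move: (tan th) tan0 => T T0; move: (@pi R) pi0 => p p0.
    by field; rewrite !gt_eqF//.
  have cancel (p : R) : 0 < p -> 2 / p * (q * (p / 2)) = q.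
    by move=> p0; field; rewrite gt_eqF.
  rewrite tanK; first exact: cancel.
  rewrite in_itv /= -/th th1 andbT; lra.
Qed.

(** Plancherel, in the direction that follows from damping alone: the damped
    energy of the transform is an average of the autocorrelation around the
    origin, where it equals the energy of the function. *)
Theorem plancherel_ge (h : E -> C) : cintegrable mu h -> L2 h ->
  (energy h <= \int[mu]_w (sqm (fourier h w))%:E)%E.
Proof.
move=> h1 h2; have mh := L2_cmeasurable h2.
set P := (\int[mu]_w _)%E.
set Q := qf (@ipL R n) (mkL2 h2).
have QE : energy h = Q%:E by rewrite /energy -EFin_inner.
have Q0 : 0 <= Q by exact: (qf_ge0 (@ipL_hermitian R n)).
have autoE u : Re (autocorr h u) = Re (ipL (mkL2 (L2_shift u h2)) (mkL2 h2)) by [].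
have Qs u : qf (@ipL R n) (mkL2 (L2_shift u h2)) = Q.
  have := energy_shift u mh; rewrite QE /energy -(EFin_inner (L2_shift u h2)).
  by move=> -[].
have auto_ge u : - Q <= Re (autocorr h u).
  rewrite autoE; have := qf_ge0 (@ipL_hermitian R n) (mkL2 (L2_shift u h2) + mkL2 h2).
  by rewrite (qfD (@ipL_hermitian R n)) Qs -/Q; lra.
have auto_le u : Re (autocorr h u) <= Q.
  rewrite autoE; have := qf_ge0 (@ipL_hermitian R n) (mkL2 (L2_shift u h2) - mkL2 h2).
  by rewrite (qfB (@ipL_hermitian R n)) Qs -/Q; lra.
have auto_near u (eta : R) : (energy (fun x => h (x + u) - h x)%R <= eta%:E)%E ->
    Q - eta <= Re (autocorr h u).
  rewrite autoE => he.
  have := qf_ge0 (@ipL_hermitian R n) (mkL2 (L2_shift u h2) - mkL2 h2).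
  have : qf (@ipL R n) (mkL2 (L2_shift u h2) - mkL2 h2) <= eta.
    rewrite -lee_fin; apply: le_trans he.
    rewrite /energy -(EFin_inner (f := fun x => h (x + u) - h x))//.
    exact: (L2funP (mkL2 (L2_shift u h2) - mkL2 h2)).
  by rewrite (qfB (@ipL_hermitian R n)) Qs -/Q; lra.
have bound (eta del q : R) : 0 < eta -> 0 < del -> 0 < q < 1 ->
    (forall u : E, (forall i, `|u ord0 i| <= del) ->
    (energy (fun x => h (x + u) - h x)%R <= eta%:E)%E) ->
    (((2 * Q - eta) * q ^+ n - Q)%:E <= P)%E.
  move=> eta0 del0 q01 hdel.
  have [e e0 [pb [mpb pb0 pbox pbi]]] := poisson_concentrates del0 q01.
  have [dI dE] := damped_spectrum h1 h2 e0.
  have iB := cintegrable_autocorr h1 h2.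
  have dP : ((\int[mu]_w (damp e w * sqm (fourier h w)))%:E <= P)%E.
    rewrite /Rintegral fineK; last exact: integrable_fin_num dI.
    have ms : measurable_fun setT (fun w => (sqm (fourier h w))%:E).
      by apply/measurable_EFinP/measurable_sqm; exact: measurable_fourier.
    apply: ge0_le_integral => //.
    - by move=> w _; rewrite lee_fin mulr_ge0 ?damp_ge0 ?sqm_ge0.
    - by case/integrableP : dI.
    - by move=> w _; rewrite lee_fin ler_piMl ?sqm_ge0 ?damp_le1.
  apply: le_trans dP; rewrite dE lee_fin.
  have ipb : mu.-integrable setT (fun u => (pb u)%:E).
    apply/integrableP; split; first exact/measurable_EFinP.
    under eq_integral do rewrite gee0_abs ?lee_fin ?(andP (pb0 _)).1//.
    by rewrite pbi ltry.
  have ip := integrable_poisson e0 n.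
  have ilow : mu.-integrable setT (EFin \o (fun u => (2 * Q - eta) * pb u - Q * poisson e u)).
    rewrite (_ : _ \o _ = (fun u => (2 * Q - eta)%:E * (pb u)%:E - Q%:E * (poisson e u)%:E)%E)//.
    by apply: integrableB => //; exact: integrableZl.
  have iup : mu.-integrable setT (EFin \o (fun u => Re (autocorr h u) * poisson e u)).
    have mp := measurable_poisson e0 (n := n).
    have iQ : mu.-integrable setT (fun u => (Q * poisson e u)%:E).
      by rewrite (_ : (fun u => _) = (fun u => Q%:E * (poisson e u)%:E)%E)//; exact: integrableZl.
    apply: (le_integrable measurableT _ _ iQ).
      apply/measurable_EFinP; apply: measurable_funM => //.
      by case: (cintegrable_measurable iB).
    move=> u _; rewrite lee_fin normrM [leRHS]normrM !(ger0_norm (poisson_ge0 e0 u)).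
    rewrite ler_wpM2r ?poisson_ge0// (ger0_norm Q0) ler_norml.
    by rewrite auto_ge auto_le.
  have : (2 * Q - eta) * q ^+ n - Q <=
      \int[mu]_u ((2 * Q - eta) * pb u - Q * poisson e u).
    rewrite /Rintegral; under eq_integral do rewrite EFinB !EFinM.
    rewrite integralB//; [|exact: integrableZl|exact: integrableZl].
    rewrite integralZl// integralZl// pbi.
    have pf := integrable_fin_num measurableT ip.
    rewrite -(fineK pf) -!EFinM -EFinB /= lerB// ler_piMr//.
    by rewrite -lee_fin fineK// integral_poisson_le1.
  move=> /le_trans; apply; apply: (le_Rintegral measurableT ilow iup) => u _.
  have p0 := poisson_ge0 e0 u; have /andP[b0 bp] := pb0 u.
  case: (pbox u) => [[hu ->]|->]; last by rewrite mulr0 add0r -mulNr ler_wpM2r.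
  by rewrite -mulrBl ler_wpM2r//; have := auto_near _ _ (hdel _ hu); lra.
rewrite QE; have [->|Pfin] := eqVneq P +oo%E; first by rewrite leey.
have P0 : (0 <= P)%E by apply: integral_ge0 => w _; rewrite lee_fin sqm_ge0.
have {}Pfin : P \is a fin_num by rewrite ge0_fin_numE// ltey.
rewrite -(fineK Pfin) lee_fin; apply/ler_addgt0Pr => eta eta0.
have [del del0 hdel] := L2_translation_continuous h2 eta0.
pose q (m : nat) : R := 1 - m.+2%:R^-1.
have q01 m : 0 < q m < 1.
  rewrite /q; have : (m.+2%:R : R)^-1 < 1 by rewrite invf_lt1 ?ltr1n.
  have : 0 < (m.+2%:R : R)^-1 by rewrite invr_gt0.
  by move: (m.+2%:R^-1 : R) => r r0 r1; apply/andP; split; lra.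
have q1c : q m @[m --> \oo] --> (1 : R).
  have h0 : (m.+2%:R : R)^-1 @[m --> \oo] --> (0 : R).
    by have := cvg_harmonic (R := R); rewrite -cvg_shiftS.
  by rewrite -[X in _ --> X]subr0; apply: cvgB; [exact: cvg_cst|exact: h0].
have qc : ((2 * Q - eta) * q m ^+ n - Q @[m --> \oo] --> (2 * Q - eta) * 1 ^+ n - Q).
  apply: cvgB; last exact: cvg_cst.
  apply: cvgM; first exact: cvg_cst.
  exact: (cvg_comp q (fun x : R => x ^+ n) q1c (@exprn_continuous R n 1)).
have : (2 * Q - eta) * 1 ^+ n - Q <= fine P.
  rewrite -(cvg_lim _ qc)//; apply: limr_le; first by apply/cvg_ex; eexists; exact: qc.
  by near=> m; rewrite -lee_fin fineK//; apply: (bound eta del (q m)).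
by rewrite expr1n mulr1; lra.
Unshelve. all: by end_near.
Qed.
End plancherel_inequality.

(** * Moyal's inequality *)

Section moyal.
Context {R : realType} {d : nat}.
Local Notation E := 'rV[R]_d.
Local Notation C := R[i].
Local Notation mu := (@lebesgue_rV R d).
Local Notation P := (phase_space R d).

Lemma cmeasurable_tf_shift (g : E -> C) : cmeasurable g ->
  cmeasurable (fun p : P * E => tf_shift p.1 g p.2).
Proof.
move=> mg; have m11 : measurable_fun setT (fun p : P * E => p.1.1).
  exact: (measurableT_comp measurable_fst measurable_fst).
have m12 : measurable_fun setT (fun p : P * E => p.1.2).
  exact: (measurableT_comp measurable_snd measurable_fst).
rewrite /tf_shift; apply: cmeasurableM.
  apply: cmeasurable_cis; apply: measurable_funM; first exact: measurable_cst.
  by apply: measurable_dot => //; exact: measurable_snd.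
apply: (cmeasurable_comp _ mg); apply: measurable_rV_add; first exact: measurable_snd.
exact: measurable_rV_opp.
Qed.

Lemma cmeasurable_inner_tf (f g : E -> C) : cmeasurable f -> cmeasurable g ->
  cmeasurable (fun z : P => inner f (tf_shift z g)).
Proof.
move=> mf mg.
pose F := fun p : P * E => f p.2 * conjc (tf_shift p.1 g p.2).
have mF : cmeasurable F.
  apply: cmeasurableM; first exact: (cmeasurable_comp measurable_snd mf).
  by apply: cmeasurableJ; exact: cmeasurable_tf_shift.
exact: (cmeasurable_cintegral mu mF).
Qed.

(** One half of Moyal's identity: for a fixed translation the inner products
    with all the modulations are the Fourier transform of a product, to which
    Plancherel applies. *)
Theorem moyal_ge (f g : E -> C) : L2 f -> L2 g ->
  ((Re (inner f f) * Re (inner g g))%:E <=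
   \int[lebesgue_phase]_z (sqm (inner f (tf_shift z g)))%:E)%E.
Proof.
move=> fL gL; have mf := L2_cmeasurable fL; have mg := L2_cmeasurable gL.
have msf := measurable_sqm mf; have msg := measurable_sqm mg.
pose h (x t : E) : C := f t * conjc (g (t - x)).
have hi x : cintegrable mu (h x) by exact: (L2_cintegrable fL (L2_shift (- x) gL)).
have hE x w : inner f (tf_shift (x, w) g) = fourier (h x) w.
  apply: eq_cintegral => t; rewrite /h /tf_shift /chr conjcM /=.
  by rewrite (mulrC (conjc (cis _))) mulrA.
have mI : measurable_fun setT (fun z : P => (sqm (inner f (tf_shift z g)))%:E).
  by apply/measurable_EFinP/measurable_sqm; exact: cmeasurable_inner_tf.
have I0 z : (0 <= (sqm (inner f (tf_shift z g)))%:E)%E by rewrite lee_fin sqm_ge0.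
apply: le_trans; last first.
  by rewrite ge0_integral_phase//; exact: lexx.
pose K (p : E * E) : R := sqm (f (p.2 + p.1)) * sqm (g p.2).
have mK : measurable_fun setT (fun p => (K p)%:E).
  apply/measurable_EFinP; apply: measurable_funM.
    exact: (measurableT_comp msf measurable_add_pair).
  exact: (measurableT_comp msg measurable_snd).
have K0 p : (0 <= (K p)%:E)%E by rewrite lee_fin mulr_ge0 ?sqm_ge0.
have energyE x : energy (h x) = (\int[mu]_t (K (x, t))%:E)%E.
  pose k t := (sqm (f t) * sqm (g (t - x)))%:E.
  have mk : measurable_fun setT k.
    apply/measurable_EFinP; apply: measurable_funM => //.
    apply: (measurableT_comp msg); apply: measurable_rV_add => //; exact: measurable_cst.
  have k0 t : (0 <= k t)%E by rewrite lee_fin mulr_ge0 ?sqm_ge0.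
  transitivity (\int[mu]_t k t)%E.
    by apply: eq_integral => t _; rewrite /h sqmM sqmJ.
  rewrite -(ge0_integral_shift x mk k0); apply: eq_integral => t _.
  by rewrite /k /K /= addrK.
have tot : (\int[mu]_x energy (h x) = (Re (inner f f) * Re (inner g g))%:E)%E.
  under eq_integral do rewrite energyE.
  apply: etrans (@fubini_tonelli _ _ _ _ R mu mu _ mK K0) _ => /=.
  have nf : (\int[mu]_t (sqm (f t))%:E = (Re (inner f f))%:E)%E by rewrite EFin_inner.
  have step t : (\int[mu]_x (K (x, t))%:E = (Re (inner f f))%:E * (sqm (g t))%:E)%E.
    rewrite -nf -(ge0_integral_shift t (f := fun t => (sqm (f t))%:E)); last first.
    - by move=> x; rewrite lee_fin sqm_ge0.
    - exact/measurable_EFinP.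
    rewrite -ge0_integralZr//; first last.
    - by rewrite lee_fin sqm_ge0.
    - by move=> x _; rewrite lee_fin sqm_ge0.
    - apply/measurable_EFinP; apply: (measurableT_comp msf).
      by apply: measurable_rV_add => //; exact: measurable_cst.
    by apply: eq_integral => x _; rewrite /K /= (addrC x) EFinM.
  under eq_integral do rewrite step.
  rewrite ge0_integralZl//; last 3 first.
  - exact/measurable_EFinP.
  - by move=> x _; rewrite lee_fin sqm_ge0.
  - by rewrite lee_fin inner_ge0.
  by rewrite -EFin_inner// EFinM.
rewrite -tot.
apply: ae_ge0_le_integral => //.
- by move=> x _; exact: energy_ge0.
- under eq_fun do rewrite energyE; exact: (measurable_fun_fubini_tonelli_F _ mK K0).
- by move=> x _; apply: integral_ge0 => w _.
- exact: (measurable_fun_fubini_tonelli_F _ mI I0).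
have mEn : mu.-integrable setT (fun x => energy (h x)).
  apply/integrableP; split.
    by under eq_fun do rewrite energyE; exact: (measurable_fun_fubini_tonelli_F _ mK K0).
  by under eq_integral do rewrite gee0_abs ?energy_ge0//; rewrite tot ltry.
have := integrable_ae measurableT mEn; apply: filterS => x /(_ I) hfin _.
have hL : L2 (h x).
  apply: cmeasurable_L2; first exact: cintegrable_measurable (hi x).
  by rewrite -ge0_fin_numE//; exact: energy_ge0.
apply: le_trans (plancherel_ge (hi x) hL) _.
by under eq_integral do rewrite -hE; exact: lexx.
Qed.
End moyal.

(** * Operators and traces *)

Section ae_invariance.
Context {R : realType} {d : nat}.
Local Notation E := 'rV[R]_d.
Local Notation C := R[i].
Local Notation mu := (@lebesgue_rV R d).
Implicit Types f g h : E -> C.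

Lemma inner_ae f f' g : L2 f -> L2 f' -> L2 g -> f = f' %[ae mu] ->
  inner f g = inner f' g.
Proof.
move=> fL fL' gL ff'.
have [m1R m1I] : cmeasurable (fun x => f x * conjc (g x)).
  by apply: cmeasurableM; [exact: L2_cmeasurable|apply/cmeasurableJ/L2_cmeasurable].
have [m2R m2I] : cmeasurable (fun x => f' x * conjc (g x)).
  by apply: cmeasurableM; [exact: L2_cmeasurable|apply/cmeasurableJ/L2_cmeasurable].
apply: eq_ReIm; rewrite /= /Rintegral; congr fine; apply: ae_eq_integral => //.
- exact/measurable_EFinP.
- exact/measurable_EFinP.
- by apply: filterS ff' => x /(_ I) e _; rewrite e.
- exact/measurable_EFinP.
- exact/measurable_EFinP.
- by apply: filterS ff' => x /(_ I) e _; rewrite e.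
Qed.

Lemma ae_inner f g : L2 f -> L2 g -> (forall h, L2 h -> inner f h = inner g h) ->
  f = g %[ae mu].
Proof.
move=> fL gL fg.
have dL : L2 (fun x => - 1 * g x + f x) by exact: L2_lin.
have := fg _ dL.
have := EFin_inner dL; rewrite inner_lin// fg// mulN1r addNr => /esym e0 _.
have ms : measurable_fun setT (fun x => (sqm (- 1 * g x + f x))%:E).
  by apply/measurable_EFinP; apply: measurable_sqm; exact: L2_cmeasurable.
have : ae_eq mu setT (fun x => (sqm (- 1 * g x + f x))%:E) (cst 0%E).
  apply/(ae_eq_integral_abs mu measurableT ms).
  by rewrite -[RHS]e0; apply: eq_integral => x _; rewrite gee0_abs// lee_fin sqm_ge0.
apply: filterS => x /(_ I) /= [] /sqm_eq0 e _.
by apply/esym/subr0_eq; rewrite -[RHS]oppr0 -e mulN1r opprD opprK.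
Qed.
End ae_invariance.

Section polarization.
Context {R : realType} {V : lmodType R[i]} (ip : V -> V -> R[i]).
Hypothesis H : hermitian ip.

Definition op_lin (T : V -> V) :=
  forall a f g h, ip (T (a *: f + g)) h = a * ip (T f) h + ip (T g) h.

(** Polarization: the form is real at [f + g] and at [i f + g]. *)
Lemma real_form_symmetric (T : V -> V) : op_lin T ->
  (forall f, Im (ip (T f) f) = 0) -> symmetric ip T.
Proof.
move=> linT realT f g; rewrite [RHS](herm_conj H (T g)).
have TD a : ip (T (a *: f + g)) (a *: f + g) =
    a * conjc a * ip (T f) f + a * ip (T f) g + conjc a * ip (T g) f + ip (T g) g.
  by rewrite linT !(ipDr H) !(ipZr H); ring.
have := realT (1 *: f + g); have := realT ('i%C *: f + g).
rewrite !TD !ReIm /= !(realT f) !(realT g) => h1 h2.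
by apply: eq_ReIm; rewrite ?ReIm; move: h1 h2; lra.
Qed.
End polarization.

Section lifted_operators.
Context {R : realType} {d : nat}.
Local Notation E := 'rV[R]_d.
Local Notation C := R[i].
Local Notation mu := (@lebesgue_rV R d).
Local Notation V := (@L2fun R d).
Local Notation ip := (@ipL R d).
Local Notation H := (@ipL_hermitian R d).
Local Notation Q := (qf ip).

(** Totalized by 0, so that no proof of boundedness enters the definition. *)
Definition lift_op (T : @operator R d) (f : V) : V := insubd (0 : V) (T f).

Lemma lift_opE (T : @operator R d) f : bounded_op T -> L2val (lift_op T f) = T f.
Proof.
case=> TL _ _; rewrite /lift_op; apply: (insubdK (0 : V)).
by apply/asboolP; apply: TL; exact: L2funP.
Qed.

Lemma ip_lift_op (T : @operator R d) f g : bounded_op T ->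
  ip (lift_op T f) g = inner (T f) g.
Proof. by move=> bT; rewrite /ipL lift_opE. Qed.

Lemma lift_op_lin (T : @operator R d) : bounded_op T -> op_lin ip (lift_op T).
Proof.
move=> bT a f g h; rewrite !ip_lift_op//; case: bT => TL Tlin _.
have fL := L2funP f; have gL := L2funP g; have hL' := L2funP h.
rewrite (inner_ae _ _ hL' (Tlin a f g fL gL)).
- by rewrite inner_lin//; exact: TL.
- by apply: TL; exact: L2_lin.
- by apply: L2_lin; exact: TL.
Qed.

Lemma positive_op_real (T : @operator R d) f : positive_op T ->
  0 <= Re (ip (lift_op T f) f) /\ Im (ip (lift_op T f) f) = 0.
Proof.
move=> [bT pT]; rewrite ip_lift_op//; have := pT _ (L2funP f).
by rewrite lecE /= => /andP[/eqP -> ->].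
Qed.

Lemma positive_op_symmetric (T : @operator R d) : positive_op T ->
  symmetric ip (lift_op T).
Proof.
move=> pT; apply: (real_form_symmetric H); first exact: lift_op_lin pT.1.
by move=> f; have [] := positive_op_real f pT.
Qed.

Lemma positive_op_positive (T : @operator R d) : positive_op T ->
  positive ip (lift_op T).
Proof. by move=> pT f; have [] := positive_op_real f pT. Qed.

Lemma bounded_op_form (T : @operator R d) : bounded_op T ->
  exists2 M : R, 0 <= M & forall f, Re (ip (lift_op T f) f) <= M * Q f.
Proof.
move=> bT; have [_ _ [M TM]] := bT; exists `|M| => // f.
have [|h0] := leP (Re (ip (lift_op T f) f)) 0.
  by move=> h; apply: le_trans h _; rewrite mulr_ge0//; exact: (qf_ge0 H).
rewrite -ler_sqr ?nnegrE ?(ltW h0)//; last by rewrite mulr_ge0//; exact: (qf_ge0 H).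
apply: le_trans (Re_sqr_le _) _; apply: le_trans (cauchy_schwarz H _ _) _.
rewrite exprMn real_normK ?num_real// (expr2 (Q f)) mulrA ler_wpM2r//.
  exact: (qf_ge0 H).
have := TM _ (L2funP f); rewrite /l2norm -/(ipL f f) -/(Q f).
have -> : inner (T f) (T f) = ip (lift_op T f) (lift_op T f) by rewrite /ipL lift_opE.
rewrite -/(Q _) => h.
have q1 := qf_ge0 H (lift_op T f); have q2 := qf_ge0 H f.
rewrite -(sqr_sqrtr q1) -(sqr_sqrtr q2) -exprMn ler_sqr ?nnegrE ?sqrtr_ge0//.
by apply: le_trans h; exact: sqrtr_ge0.
Qed.

Lemma sqm_tf_shift (z : phase_space R d) (f : E -> C) t :
  sqm (tf_shift z f t) = sqm (f (t - z.1)).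
Proof. by rewrite sqmM sqm_cis mul1r. Qed.

Lemma L2_tf_shift (z : phase_space R d) f : L2 f -> L2 (tf_shift z f : E -> C).
Proof.
move=> fL; have mf := L2_cmeasurable (L2_shift (- z.1) fL).
apply: cmeasurable_L2.
  by apply: cmeasurableM => //; apply: cmeasurable_cis; apply: measurable_funM;
    [exact: measurable_cst|apply: measurable_dot => //; exact: measurable_cst].
under eq_integral do rewrite sqm_tf_shift.
by rewrite -(EFin_inner (L2_shift (- z.1) fL)) ltry.
Qed.

Lemma L2_tf_shift_adj (z : phase_space R d) f : L2 f -> L2 (tf_shift_adj z f : E -> C).
Proof.
move=> fL; have mf := L2_cmeasurable (L2_shift z.1 fL).
apply: cmeasurable_L2.
  apply: cmeasurableM => //; apply: cmeasurable_cis; apply: measurable_funN.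
  apply: measurable_funM; first exact: measurable_cst.
  apply: measurable_dot; last exact: measurable_cst.
  by apply: measurable_rV_add => //; exact: measurable_cst.
under eq_integral do rewrite sqmM sqm_cis mul1r.
by rewrite -(EFin_inner (L2_shift z.1 fL)) ltry.
Qed.

Definition tfV (z : phase_space R d) (f : V) : V := mkL2 (L2_tf_shift z (L2funP f)).
Definition tfaV (z : phase_space R d) (f : V) : V := mkL2 (L2_tf_shift_adj z (L2funP f)).

Lemma tfVK z : cancel (tfV z) (tfaV z).
Proof. by move=> f; apply: val_inj; exact: tf_shiftK. Qed.

Lemma tfaVK z : cancel (tfaV z) (tfV z).
Proof. by move=> f; apply: val_inj; exact: tf_shift_adjK. Qed.

Lemma ip_tfV z f g : ip (tfV z f) g = ip f (tfaV z g).
Proof.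
pose k (t : E) := tf_shift z f t * conjc (g t).
have mk : cmeasurable k.
  by apply: cmeasurableM; [|apply: cmeasurableJ]; apply: L2_cmeasurable;
    [exact: L2_tf_shift (L2funP f)|exact: L2funP].
rewrite [LHS](_ : _ = cintegral mu k)// -(cintegral_shift z.1 mk).
apply: eq_cintegral => t.
rewrite /k /tf_shift /tf_shift_adj /= addrK conjcM conj_cis opprK; ring.
Qed.

Lemma ip_tfVV z f g : ip (tfV z f) (tfV z g) = ip f g.
Proof. by rewrite ip_tfV tfVK. Qed.

Lemma ip_tfaV z f g : ip (tfaV z f) g = ip f (tfV z g).
Proof. by rewrite -{2}(tfaVK z f) ip_tfVV. Qed.

Lemma ip_tfaVV z f g : ip (tfaV z f) (tfaV z g) = ip f g.
Proof. by rewrite ip_tfaV tfaVK. Qed.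

Lemma qf_tfV z f : Q (tfV z f) = Q f. Proof. by rewrite /qf ip_tfVV. Qed.
Lemma qf_tfaV z f : Q (tfaV z f) = Q f. Proof. by rewrite /qf ip_tfaVV. Qed.

Definition basis (e : nat -> V) : Prop :=
  (forall i j, ip (e i) (e j) = (i == j)%:R) /\
  (forall f, (forall k, ip f (e k) = 0) -> Q f = 0).

Lemma basis_lift (e : nat -> E -> C) : orthonormal_basis e ->
  exists2 e' : nat -> V, basis e' & forall k, L2val (e' k) = e k.
Proof.
move=> [[eL eON] ec]; exists (fun k => mkL2 (eL k)) => //; split.
  by move=> i j; exact: eON.
move=> f fe; rewrite /qf /ipL.
rewrite (inner_ae (L2funP f) (@L2_0 R d) (L2funP f)).
  exact: (congr1 (@complex.Re R) (ip0l H f)).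
exact: (ec f (L2funP f) fe).
Qed.

Lemma csum_unique (u : nat -> C) (a b : C) : csum u a -> csum u b -> a = b.
Proof.
move=> [aR aI] [bR bI]; apply: eq_ReIm.
  by rewrite -(cvg_lim _ aR)// -(cvg_lim _ bR).
by rewrite -(cvg_lim _ aI)// -(cvg_lim _ bI).
Qed.

(** One basis is enough to make the common value of the sums unique. *)
Lemma tr_eq (T : @operator R d) (c : C) (e0 : nat -> E -> C) : orthonormal_basis e0 ->
  (forall e, orthonormal_basis e -> csum (fun k => inner (T (e k)) (e k)) c) -> tr T = c.
Proof.
move=> b0 h; rewrite /tr; case: xgetP => [y _ hy|/(_ c)].
  exact: csum_unique (hy _ b0) (h _ b0).
by move=> /(_ h).
Qed.

(** The default value of [tr] is 0, so a trace equal to 1 is a genuine one. *)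
Lemma tr_csum (T : @operator R d) : tr T = 1 ->
  forall e, orthonormal_basis e -> csum (fun k => inner (T (e k)) (e k)) 1.
Proof.
rewrite /tr; case: xgetP => [y -> hy <-//|_ /esym/eqP].
by rewrite oner_eq0.
Qed.
End lifted_operators.

(** * The total correlation function and the spectrum of S *)

Section density_operator.
Context {R : realType} {d : nat}.
Local Notation E := 'rV[R]_d.
Local Notation C := R[i].
Local Notation V := (@L2fun R d).
Local Notation ip := (@ipL R d).
Local Notation H := (@ipL_hermitian R d).
Local Notation Q := (qf ip).
Local Notation P := (phase_space R d).

Lemma basis_drop (e : nat -> V) : basis e -> orthonormal_basis (fun k => L2val (e k)).
Proof.
move=> [eON ec]; split.
  by split=> [k|j k]; [exact: L2funP|exact: eON].
move=> f fL fe; apply: ae_inner => //; first exact: L2_0.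
move=> h hL; have q0 : Q (mkL2 fL) = 0 by apply: ec => k; exact: fe.
transitivity (ip (mkL2 fL) (mkL2 hL)) => //.
rewrite (ip_eq0 H (mkL2 hL) q0); exact: (esym (ip0l H (mkL2 hL))).
Qed.

Lemma basis_tfaV z (e : nat -> V) : basis e -> basis (fun k => tfaV z (e k)).
Proof.
move=> [eON ec]; split=> [i j|f fe]; first by rewrite ip_tfaVV.
rewrite -(qf_tfV z); apply: ec => k; rewrite ip_tfV; exact: fe.
Qed.

(** Time-frequency shifts compose up to a phase. *)
Lemma tfaV_tfV (w z : P) (g : V) :
  exists2 c : C, sqm c = 1 & tfaV w (tfV z g) = c *: tfV (z - w) g.
Proof.
have dotDr (a b c : E) : dot a (b - c) = dot a b - dot a c.
  by rewrite /dot -sumrB; apply: eq_bigr => i _; rewrite !mxE mulrBr.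
exists (cis (2 * pi * dot w.1 (z - w).2)); first exact: sqm_cis.
apply: val_inj; apply/funext => t.
transitivity (cis (- (2 * pi * dot (t + w.1) w.2)) *
  (cis (2 * pi * dot (t + w.1) z.2) * g (t + w.1 - z.1))) => //.
transitivity (cis (2 * pi * dot w.1 (z.2 - w.2)) *
  (cis (2 * pi * dot t (z.2 - w.2)) * g (t - (z.1 - w.1)))) => //.
rewrite !mulrA -!cisD opprB addrA !dotDl !dotDr; congr (_ * _); congr cis.
move: (@pi R) (dot t w.2) (dot w.1 w.2) (dot t z.2) (dot w.1 z.2) => p a b a1 b1; ring.
Qed.

Variable S : @operator R d.
Hypotheses (pS : positive_op S) (trS : tr S = 1).
Variable e0 : nat -> E -> C.
Hypothesis b0 : orthonormal_basis e0.

Local Notation S' := (lift_op S).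

Lemma density_trace (e : nat -> V) : basis e ->
  (\sum_(0 <= k <oo) (Re (ip (S' (e k)) (e k)))%:E = 1%:E)%E.
Proof.
move=> be; have [+ _] := tr_csum trS (basis_drop be).
pose x k := Re (ip (S' (e k)) (e k)).
have x0 k : 0 <= x k by exact: (positive_op_positive pS).
have E n : series (fun k => Re (inner (S (e k)) (e k))) n = \sum_(k < n) x k.
  by rewrite /series /= big_mkord; apply: eq_bigr => k _; rewrite /x ip_lift_op//; exact: pS.1.
by rewrite (eq_cvg _ _ E) => /(nnseries_cvgP _ x0).
Qed.

Lemma density_spectrum : exists s u, eigen_system ip S' s u 1.
Proof.
have [e [eON ec] _] := basis_lift b0.
have [M _ SM] := bounded_op_form pS.1.
apply: (spectral_decomposition H (@L2_complete R d) eON ec (positive_op_symmetric pS)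
  (positive_op_positive pS) SM).
by apply: density_trace; split.
Qed.

Variables (s : nat -> R) (u : nat -> V).
Hypothesis Su : eigen_system ip S' s u 1.

(** For [S] of rank one these are spectrograms of [g]. *)
Definition orbit_form (z : P) (g : V) : R := Re (ip (S' (tfV z g)) (tfV z g)).
Definition coorbit_form (z : P) (g : V) : R := Re (ip (S' (tfaV z g)) (tfaV z g)).

Let formZ (c : C) (g : V) : sqm c = 1 ->
  Re (ip (S' (c *: g)) (c *: g)) = Re (ip (S' g) g).
Proof.
move=> c1; rewrite (symmetricZ H _ _ _ (positive_op_symmetric pS)) (ipZr H) mulrA mulcJ c1.
by rewrite mul1r.
Qed.

Lemma coorbit_shift (w z : P) (g : V) : coorbit_form w (tfV z g) = orbit_form (z - w) g.
Proof. by rewrite /coorbit_form /orbit_form; have [c c1 ->] := tfaV_tfV w z g; exact: formZ. Qed.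

Lemma tfV0 (g : V) : tfV 0 g = g.
Proof.
apply: val_inj; apply/funext => t; rewrite /= /tf_shift /= subr0 /dot big1; last first.
  by move=> i _; rewrite mxE mulr0.
by rewrite mulr0 /cis cos0 sin0; apply: eq_ReIm; rewrite !ReIm /=; ring.
Qed.

Lemma coorbitN (z : P) (g : V) : coorbit_form z g = orbit_form (- z) g.
Proof. by rewrite -{1}(tfV0 g) coorbit_shift sub0r. Qed.

Lemma coorbit_ge0 z g : 0 <= coorbit_form z g.
Proof. exact: (positive_op_positive pS). Qed.

Lemma orbit_ge0 z g : 0 <= orbit_form z g.
Proof. exact: (positive_op_positive pS). Qed.

Lemma coorbit_le z g : coorbit_form z g <= Q g.
Proof.
by rewrite -(qf_tfaV z g); have := es_le H Su (tfaV z g); rewrite mul1r.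
Qed.

Lemma coorbitE z g :
  ((coorbit_form z g)%:E = \sum_(0 <= j <oo) (s j * sqm (ip g (tfV z (u j))))%:E)%E.
Proof.
by rewrite /coorbit_form -(es_diag Su); apply: eq_eseriesr => j _; rewrite ip_tfaV.
Qed.

Lemma orbitE z g :
  ((orbit_form z g)%:E = \sum_(0 <= j <oo) (s j * sqm (ip (u j) (tfV z g)))%:E)%E.
Proof.
by rewrite /orbit_form -(es_diag Su); apply: eq_eseriesr => j _; rewrite (sqm_ipC H).
Qed.

Lemma weights_sum_le1 (c : nat -> R) : (forall j, 0 <= c j <= 1) ->
  (\sum_(0 <= j <oo) (s j * c j)%:E <= 1)%E.
Proof.
move=> c01; rewrite -(es_sum Su); apply: lee_nneseries => j *; rewrite lee_fin; have /andP[c0 c1] := c01 j.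
  by rewrite mulr_ge0 ?(es_ge0 Su).
by rewrite ler_piMr ?(es_ge0 Su).
Qed.

Lemma qf_u_le1 i : Q (u i) <= 1.
Proof. by case: (es_normal Su i) => [->//|[_ ->]]; rewrite (qf0 H) ler01. Qed.

(** [trace_product] for the operator [pi(z) S pi(z)^*], whose form at the
    eigenvectors of [S] is [coorbit_form]. *)
Lemma total_correlation_coorbit z : ((total_correlation S z)%:E =
  \sum_(0 <= i <oo) (s i * coorbit_form z (u i))%:E)%E.
Proof.
set L := (\sum_(0 <= i <oo) _)%E.
have L0 : (0 <= L)%E.
  by apply: nneseries_ge0 => i _ _; rewrite lee_fin mulr_ge0 ?(es_ge0 Su) ?coorbit_ge0.
have L1 : (L <= 1)%E.
  apply: weights_sum_le1 => i; rewrite coorbit_ge0 /=.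
  exact: le_trans (coorbit_le z (u i)) (qf_u_le1 i).
have Lf : L \is a fin_num by rewrite ge0_fin_numE// (le_lt_trans L1)// ltry.
have bS := pS.1.
have checkK : check_op (check_op S) = S.
  apply/funext => f; apply/funext => t; rewrite /check_op /parity /= opprK.
  by congr (S _ _); apply/funext => x; rewrite opprK.
rewrite /total_correlation; suff -> : op_conv S (check_op S) z = (fine L)%:C by rewrite /= fineK.
rewrite /op_conv checkK; apply: (tr_eq b0) => e be.
have [e' [eON ec] ee] := basis_lift be.
pose T (g : V) : V := tfV z (S' (tfaV z g)).
have TE f g : ip (T f) g = ip (S' (tfaV z f)) (tfaV z g) by rewrite ip_tfV.
have sT : symmetric ip T.
  by move=> f g; rewrite TE (positive_op_symmetric pS) ip_tfaV.
have pT : positive ip T by move=> f; rewrite TE; exact: coorbit_ge0.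
have := @trace_product _ _ ip H (@L2_complete R d) _ s u 1 (positive_op_symmetric pS)
  (positive_op_positive pS) Su e' T 1 1 (fine L) eON ec
  (density_trace (conj eON ec)) sT pT ler01.
have -> : (fun k => ip (S' (T (e' k))) (e' k)) =
    (fun k => inner ((S \o alpha z S) (e k)) (e k)).
  apply/funext => k; rewrite ip_lift_op// /= ee; congr (inner (S _) _).
  by rewrite /alpha /= lift_opE//= ee.
apply.
- by move=> f; rewrite mul1r TE; exact: coorbit_le.
- move=> n; rewrite -lee_fin.
  rewrite -(density_trace (basis_tfaV z (conj eON ec))).
  under eq_bigr do rewrite TE.
  by apply: (le_nneseries n (x := fun k => coorbit_form z (e' k))) => k; exact: coorbit_ge0.
- by rewrite fineK// /L; apply: eq_eseriesr => i _; rewrite TE.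
Qed.

(** Both sides are sum_ij s_i s_j |<u_i, pi(z) u_j>|^2, summed in either order. *)
Lemma total_correlation_orbit z : ((total_correlation S z)%:E =
  \sum_(0 <= j <oo) (s j * orbit_form z (u j))%:E)%E.
Proof.
have ge0 i j : (0 <= (s i * (s j * sqm (ip (u i) (tfV z (u j)))))%:E)%E.
  by rewrite lee_fin !mulr_ge0 ?(es_ge0 Su) ?sqm_ge0.
rewrite total_correlation_coorbit.
transitivity (\sum_(0 <= i <oo) \sum_(0 <= j <oo)
    (s i * (s j * sqm (ip (u i) (tfV z (u j)))))%:E)%E.
  apply: eq_eseriesr => i _; rewrite EFinM coorbitE -nneseriesZl; last first.
    by move=> j _; rewrite lee_fin mulr_ge0 ?(es_ge0 Su) ?sqm_ge0.
  by apply: eq_eseriesr => j _; rewrite EFinM.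
rewrite nneseries_interchange//; apply: eq_eseriesr => j _.
rewrite EFinM orbitE -nneseriesZl; last first.
  by move=> i _; rewrite lee_fin mulr_ge0 ?(es_ge0 Su) ?sqm_ge0.
by apply: eq_eseriesr => i _; rewrite -EFinM mulrCA.
Qed.

Lemma total_correlationN z : total_correlation S (- z) = total_correlation S z.
Proof.
apply: EFin_inj.
apply: etrans (total_correlation_orbit (- z)) _.
apply: etrans _ (esym (total_correlation_coorbit z)).
by apply: eq_eseriesr => i _; rewrite coorbitN.
Qed.

Lemma total_correlation_ge0 z : 0 <= total_correlation S z.
Proof.
rewrite -lee_fin total_correlation_coorbit; apply: nneseries_ge0 => i _ _.
by rewrite lee_fin mulr_ge0 ?(es_ge0 Su) ?coorbit_ge0.
Qed.

(** A limit of finite sums of products of inner products with shifted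
    eigenvectors. *)
Lemma cmeasurable_coorbit (g h : V) :
  cmeasurable (fun z : P => ip (S' (tfaV z g)) (tfaV z h)).
Proof.
pose F n (z : P) := ip (finite_part ip s u n (tfaV z g)) (tfaV z h).
have mF n : cmeasurable (F n).
  rewrite (_ : F n = fun z => \sum_(i < n) (s i)%:C * (inner g (tf_shift z (u i)) *
      conjc (inner h (tf_shift z (u i))))).
    apply: cmeasurable_sum => i; apply: cmeasurableM; first exact: cmeasurable_cst.
    by apply: cmeasurableM; [|apply: cmeasurableJ]; apply: cmeasurable_inner_tf;
      exact: L2_cmeasurable (L2funP _).
  apply/funext => z; rewrite /F (ip_finite_part H); apply: eq_bigr => i _.
  by rewrite ip_tfaV -(ip_tfV z (u i) h) (herm_conj H h).
have cF z : sqm (F n z - ip (S' (tfaV z g)) (tfaV z h)) @[n --> \oo] --> 0.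
  exact: (finite_part_cvg H (positive_op_symmetric pS) Su).
split.
- apply: (measurable_fun_cvg (h := fun n z => Re (F n z))) => [n|z _]; first by case: (mF n).
  apply/subr_cvg0/(cvg_sqr_le0 _ (cF z)) => n.
  by rewrite -cReN -cReD; exact: Re_sqr_le.
- apply: (measurable_fun_cvg (h := fun n z => Im (F n z))) => [n|z _]; first by case: (mF n).
  apply/subr_cvg0/(cvg_sqr_le0 _ (cF z)) => n.
  by rewrite -cImN -cImD; exact: Im_sqr_le.
Qed.

Lemma measurable_coorbit_form g : measurable_fun setT (fun z : P => coorbit_form z g).
Proof. by case: (cmeasurable_coorbit g g). Qed.

Lemma measurable_total_correlation :
  measurable_fun setT (fun z : P => total_correlation S z).
Proof.
apply/measurable_EFinP; rewrite (_ : _ \o _ = fun z =>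
  (\sum_(0 <= i <oo) (s i * coorbit_form z (u i))%:E)%E); last first.
  by apply/funext => z; exact: total_correlation_coorbit.
apply: ge0_emeasurable_sum => [i z _ _|i _].
  by rewrite lee_fin mulr_ge0 ?(es_ge0 Su) ?coorbit_ge0.
apply/measurable_EFinP; apply: measurable_funM; first exact: measurable_cst.
exact: measurable_coorbit_form.
Qed.
End density_operator.

(** * The convolution of a probability density with S *)

Lemma Re_realM (R : realType) (x : R) (c : R[i]) : Re (x%:C * c) = x * Re c.
Proof. by rewrite cReM /= mul0r subr0. Qed.

Lemma Im_realM (R : realType) (x : R) (c : R[i]) : Im (x%:C * c) = x * Im c.
Proof. by rewrite cImM /= mul0r addr0. Qed.

Section convolution_operator.
Context {R : realType} {d : nat}.
Local Notation E := 'rV[R]_d.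
Local Notation C := R[i].
Local Notation V := (@L2fun R d).
Local Notation ip := (@ipL R d).
Local Notation H := (@ipL_hermitian R d).
Local Notation Q := (qf ip).
Local Notation P := (phase_space R d).
Local Notation lam := (@lebesgue_phase R d).

Variable S : @operator R d.
Hypotheses (pS : positive_op S) (trS : tr S = 1).
Variable e0 : nat -> E -> C.
Hypothesis b0 : orthonormal_basis e0.
Local Notation S' := (lift_op S).
Variables (s : nat -> R) (u : nat -> V).
Hypothesis Su : eigen_system ip S' s u 1.

Variable f : P -> R.
Hypotheses (f0 : forall z, 0 <= f z) (mf : measurable_fun setT f).
Hypothesis f1 : (\int[lam]_z (f z)%:E = 1)%E.

Local Notation co := (coorbit_form S).

Let fi : lam.-integrable setT (fun z => (f z)%:E).
Proof.
apply/integrableP; split; first exact/measurable_EFinP.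
by under eq_integral do rewrite gee0_abs ?lee_fin//; rewrite f1 ltry.
Qed.

Lemma sqm_coorbit_le (z : P) (g h : V) :
  sqm (ip (S' (tfaV z g)) (tfaV z h)) <= Q g * Q h.
Proof.
have := cauchy_schwarz (positive_hermitian H (positive_op_symmetric pS)
  (positive_op_positive pS)) (tfaV z g) (tfaV z h).
move=> /le_trans; apply; apply: ler_pM.
- exact: (coorbit_ge0 pS z g).
- exact: (coorbit_ge0 pS z h).
- exact: (coorbit_le Su z g).
- exact: (coorbit_le Su z h).
Qed.

Definition conv_form (g h : V) : C :=
  cintegral lam (fun z => (f z)%:C * ip (S' (tfaV z g)) (tfaV z h)).

Let bound (g h : V) := Num.sqrt (Q g * Q h).

Let kernel_le g h z : sqm ((f z)%:C * ip (S' (tfaV z g)) (tfaV z h)) <= (f z * bound g h) ^+ 2.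
Proof.
rewrite sqmM sqm_real exprMn ler_wpM2l ?sqr_ge0// sqr_sqrtr; first exact: sqm_coorbit_le.
by rewrite mulr_ge0// (qf_ge0 H).
Qed.

Let bound_int g h : lam.-integrable setT (fun z => (f z * bound g h)%:E).
Proof.
by under eq_fun do rewrite EFinM muleC; exact: integrableZl.
Qed.

Let bound_ge0 g h z : 0 <= f z * bound g h.
Proof. by rewrite mulr_ge0// sqrtr_ge0. Qed.

Lemma cintegrable_conv g h :
  cintegrable lam (fun z => (f z)%:C * ip (S' (tfaV z g)) (tfaV z h)).
Proof.
apply: (cintegrable_dominated _ (@bound_ge0 g h) (@kernel_le g h) (@bound_int g h)).
apply: cmeasurableM; first exact: cmeasurable_real.
exact: (cmeasurable_coorbit pS Su).
Qed.

Lemma sqm_conv_form_le g h : sqm (conv_form g h) <= Q g * Q h.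
Proof.
apply: le_trans (sqm_cintegral_le (cintegrable_conv g h) (@bound_ge0 g h)
  (@kernel_le g h) (@bound_int g h)) _.
rewrite /Rintegral; under eq_integral do rewrite EFinM muleC.
by rewrite integralZl// f1 mule1 /= sqr_sqrtr// mulr_ge0// (qf_ge0 H).
Qed.

Let tfaV_lin z (a : C) (g h : V) : tfaV z (a *: g + h) = a *: tfaV z g + tfaV z h.
Proof.
apply: val_inj; apply/funext => t; rewrite /= /tf_shift_adj.
by rewrite [LHS]mulrDr; congr (_ + _); rewrite mulrCA.
Qed.

Lemma conv_form_linl (a : C) g h k :
  conv_form (a *: g + h) k = a * conv_form g k + conv_form h k.
Proof.
rewrite -(cintegralZ a (cintegrable_conv g k)).
rewrite -(cintegralD (cintegrableZ a (cintegrable_conv g k)) (cintegrable_conv h k)).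
apply: eq_cintegral => z.
by rewrite tfaV_lin (lift_op_lin pS.1) mulrDr (mulrCA a).
Qed.

Lemma conv_form_linr (a : C) g h k :
  conv_form k (a *: g + h) = conjc a * conv_form k g + conv_form k h.
Proof.
rewrite -(cintegralZ (conjc a) (cintegrable_conv k g)).
rewrite -(cintegralD (cintegrableZ (conjc a) (cintegrable_conv k g)) (cintegrable_conv k h)).
apply: eq_cintegral => z.
by rewrite tfaV_lin (ipDr H) (ipZr H) mulrDr (mulrCA (conjc a)).
Qed.

Lemma conv_form_riesz g : exists a : V, forall h, conv_form g h = ip a h.
Proof.
have [e [eON ec] _] := basis_lift b0.
apply: (riesz H (@L2_complete R d) eON ec (M := Q g)).
- exact: (qf_ge0 H).
- by move=> a h k; exact: conv_form_linr.
- by move=> h; exact: sqm_conv_form_le.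
Qed.

Let rep (g : V) : V := sval (cid (conv_form_riesz g)).

Let repE g h : ip (rep g) h = conv_form g h.
Proof. by rewrite /rep; case: cid => a /= ->. Qed.

Let repQ g : Q (rep g) <= Q g.
Proof.
have := sqm_conv_form_le g (rep g); rewrite -repE (qfE H) sqm_real expr2.
have [->|h0] := eqVneq (Q (rep g)) 0; first by rewrite (qf_ge0 H).
by rewrite ler_pM2r// lt_neqAle eq_sym h0 (qf_ge0 H).
Qed.

Lemma inner_alpha z (g h : V) : inner (alpha z S g) h = ip (S' (tfaV z g)) (tfaV z h).
Proof. by rewrite -ip_tfV /ipL /alpha /= lift_opE//; exact: pS.1. Qed.

(** The weak integral is a bounded sesquilinear form, hence is represented by an
    operator; any operator chosen in the definition has the same form. *)
Lemma fun_op_conv_spec : bounded_op (fun_op_conv f S) /\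
  forall g h : V, ip (lift_op (fun_op_conv f S) g) h = conv_form g h.
Proof.
pose A : @operator R d := fun g => L2val (rep (insubd (0 : V) g)).
have AE (g : E -> C) (gL : L2 g) : A g = rep (mkL2 gL).
  rewrite /A; congr (L2val (rep _)); apply: val_inj; rewrite /= (insubdK (0 : V))//.
  exact/asboolP.
have := @xgetPex _ (cst (cst 0) : @operator R d) [set A | bounded_op A /\
    forall g h, L2 g -> L2 h -> inner (A g) h =
      cintegral lam (fun z => (f z)%:C * inner (alpha z S g) h)].
rewrite -/(fun_op_conv f S) => -[].
  exists A; split.
    split.
    - by move=> g gL; rewrite AE; exact: L2funP.
    - move=> a g h gL hL; have lL : L2 (fun x => a * g x + h x) by exact: L2_lin.
      rewrite !AE; apply: ae_inner => [||k kL].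
      + exact: L2funP.
      + by apply: L2_lin; exact: L2funP.
      + rewrite inner_lin//; [|exact: L2funP|exact: L2funP].
        have := conv_form_linl a (mkL2 gL) (mkL2 hL) (mkL2 kL).
        rewrite -!repE => <-; congr inner; congr (L2val (rep _)).
        exact: val_inj.
    - exists 1 => g gL; rewrite AE mul1r /l2norm ler_wsqrtr//.
      exact: (repQ (mkL2 gL)).
  move=> g h gL hL; rewrite AE; apply: etrans (repE (mkL2 gL) (mkL2 hL)) _.
  by apply: eq_cintegral => z; rewrite -inner_alpha.
move=> bA AS; split=> // g h; rewrite ip_lift_op// AS; try exact: L2funP.
by apply: eq_cintegral => z; rewrite -inner_alpha.
Qed.

Local Notation A' := (lift_op (fun_op_conv f S)).

Let AE g h : ip (A' g) h = conv_form g h. Proof. exact: fun_op_conv_spec.2. Qed.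

Lemma conv_op_form g :
  ((Re (ip (A' g) g))%:E = \int[lam]_z (f z * co z g)%:E)%E.
Proof.
rewrite AE; have [iR _] := cintegrable_conv g g.
have -> : Re (conv_form g g) =
    \int[lam]_z Re ((f z)%:C * ip (S' (tfaV z g)) (tfaV z g)) by [].
rewrite /Rintegral fineK; last exact: integrable_fin_num iR.
by apply: eq_integral => z _; rewrite Re_realM.
Qed.

Lemma conv_op_symmetric : symmetric ip A'.
Proof.
apply: (real_form_symmetric H); first exact: lift_op_lin fun_op_conv_spec.1.
move=> g; rewrite AE.
have -> : Im (conv_form g g) =
    \int[lam]_z Im ((f z)%:C * ip (S' (tfaV z g)) (tfaV z g)) by [].
rewrite /Rintegral (eq_integral (cst 0%E)) ?integral0// => z _.
by rewrite Im_realM (positive_op_real (tfaV z g) pS).2 mulr0.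
Qed.

Lemma conv_op_positive : positive ip A'.
Proof.
move=> g; rewrite -lee_fin conv_op_form; apply: integral_ge0 => z _.
by rewrite lee_fin mulr_ge0// (coorbit_ge0 pS).
Qed.

Let mfco g : measurable_fun setT (fun z => (f z * co z g)%:E).
Proof.
apply/measurable_EFinP; apply: measurable_funM => //.
exact: (measurable_coorbit_form pS Su).
Qed.

Lemma conv_op_le g : Re (ip (A' g) g) <= Q g.
Proof.
rewrite -lee_fin conv_op_form -[leRHS]mul1e -f1 muleC.
rewrite -integralZl//.
apply: ge0_le_integral => //.
- by move=> z _; rewrite lee_fin mulr_ge0// (coorbit_ge0 pS).
- by apply: measurable_funeM; exact/measurable_EFinP.
- by move=> z _; rewrite -EFinM lee_fin mulrC ler_wpM2r// (coorbit_le Su).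
Qed.

(** For every [z] the vectors [pi(z)^* e k] form a basis too. *)
Lemma conv_op_trace (e : nat -> V) : basis e ->
  (\sum_(0 <= k <oo) (Re (ip (A' (e k)) (e k)))%:E = 1%:E)%E.
Proof.
move=> be.
transitivity (\sum_(0 <= k <oo) \int[lam]_z (f z * co z (e k))%:E)%E.
  by apply: eq_eseriesr => k _; rewrite conv_op_form.
rewrite -integral_nneseries//; last first.
  by move=> k z _; rewrite lee_fin mulr_ge0// (coorbit_ge0 pS).
rewrite -[RHS]f1; apply: eq_integral => z _.
under eq_eseriesr do rewrite EFinM.
rewrite nneseriesZl; last by move=> k _; rewrite lee_fin (coorbit_ge0 pS).
by rewrite (density_trace pS trS (basis_tfaV z be)) mule1.
Qed.

Lemma conv_op_spectrum : exists mu v, eigen_system ip A' mu v 1.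
Proof.
have [e be _] := basis_lift b0; have [eON ec] := be.
apply: (spectral_decomposition H (@L2_complete R d) eON ec conv_op_symmetric
  conv_op_positive (M := 1)); last exact: conv_op_trace.
by move=> g; rewrite mul1r; exact: conv_op_le.
Qed.
End convolution_operator.

(** * The averaged correlation function *)

Section convolution_density.
Context {R : realType} {d : nat}.
Local Notation E := 'rV[R]_d.
Local Notation C := R[i].
Local Notation V := (@L2fun R d).
Local Notation ip := (@ipL R d).
Local Notation H := (@ipL_hermitian R d).
Local Notation Q := (qf ip).
Local Notation P := (phase_space R d).
Local Notation lam := (@lebesgue_phase R d).

Variable S : @operator R d.
Hypotheses (pS : positive_op S) (trS : tr S = 1).
Variable e0 : nat -> E -> C.
Hypothesis b0 : orthonormal_basis e0.
Local Notation S' := (lift_op S).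
Variables (s : nat -> R) (u : nat -> V).
Hypothesis Su : eigen_system ip S' s u 1.

Variable f : P -> R.
Hypotheses (f0 : forall z, 0 <= f z) (mf : measurable_fun setT f).
Hypothesis f1 : (\int[lam]_z (f z)%:E = 1)%E.

Local Notation co := (coorbit_form S).
Local Notation A' := (lift_op (fun_op_conv f S)).
Local Notation x := (fun_conv f (total_correlation S)).

Let s0 := es_ge0 Su.
Let A0 := conv_op_positive pS b0 Su f0 mf f1.
Let A1 := conv_op_le pS b0 Su f0 mf f1.
Let Aform := conv_op_form pS b0 Su f0 mf f1.

Lemma conv_sum_le1 z :
  (\sum_(0 <= j <oo) (s j * Re (ip (A' (tfV z (u j))) (tfV z (u j))))%:E <= 1)%E.
Proof.
apply: (weights_sum_le1 Su) => j; rewrite (A0 (tfV z (u j))) /=.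
apply: le_trans (A1 (tfV z (u j))) _; rewrite qf_tfV; exact: (qf_u_le1 Su).
Qed.

Lemma measurable_phase_sub : measurable_fun setT (fun p : P * P => p.1 - p.2 : P).
Proof.
apply: measurable_fun_pair => /=.
  apply: measurable_rV_add; first exact: (measurableT_comp measurable_fst measurable_fst).
  by apply: measurable_rV_opp; exact: (measurableT_comp measurable_fst measurable_snd).
apply: measurable_rV_add; first exact: (measurableT_comp measurable_snd measurable_fst).
by apply: measurable_rV_opp; exact: (measurableT_comp measurable_snd measurable_snd).
Qed.

(** As [pi(w)^* pi(z)] is [pi(z - w)] up to a phase, averaging the correlation
    function amounts to averaging the operator. *)
Lemma conv_integral z : (\int[lam]_w (f w * total_correlation S (z - w))%:E =
  \sum_(0 <= j <oo) (s j * Re (ip (A' (tfV z (u j))) (tfV z (u j))))%:E)%E.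
Proof.
transitivity (\int[lam]_w \sum_(0 <= j <oo) (f w * (s j * co w (tfV z (u j))))%:E)%E.
  apply: eq_integral => w _; rewrite EFinM.
  have -> := total_correlation_orbit pS trS b0 Su (z - w).
  rewrite -nneseriesZl; last by move=> j _; rewrite lee_fin mulr_ge0 ?s0 ?(orbit_ge0 pS).
  by apply: eq_eseriesr => j _; rewrite EFinM (coorbit_shift pS).
have mco j : measurable_fun setT (fun w => f w * (s j * co w (tfV z (u j)))).
  apply: measurable_funM => //; apply: measurable_funM; first exact: measurable_cst.
  exact: (measurable_coorbit_form pS Su).
rewrite integral_nneseries//; last 2 first.
- by move=> j; exact/measurable_EFinP.
- by move=> j w _; rewrite lee_fin !mulr_ge0 ?s0 ?(coorbit_ge0 pS).
apply: eq_eseriesr => j _.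
rewrite EFinM Aform -ge0_integralZl//; last 3 first.
- apply/measurable_EFinP; apply: measurable_funM => //.
  exact: (measurable_coorbit_form pS Su).
- by move=> w _; rewrite lee_fin mulr_ge0 ?(coorbit_ge0 pS).
- by rewrite lee_fin s0.
by apply: eq_integral => w _; rewrite -EFinM mulrCA.
Qed.

Lemma fun_conv_orbit z : ((x z)%:E =
  \sum_(0 <= j <oo) (s j * Re (ip (A' (tfV z (u j))) (tfV z (u j))))%:E)%E.
Proof.
rewrite -conv_integral /fun_conv /Rintegral fineK// conv_integral ge0_fin_numE.
  exact: le_lt_trans (conv_sum_le1 z) (ltry _).
by apply: nneseries_ge0 => j _ _; rewrite lee_fin mulr_ge0 ?s0//; exact: A0.
Qed.

Lemma fun_conv_bound z : 0 <= x z <= 1.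
Proof.
rewrite -!lee_fin fun_conv_orbit conv_sum_le1 andbT.
by apply: nneseries_ge0 => j _ _; rewrite lee_fin mulr_ge0 ?s0//; exact: A0.
Qed.

Lemma measurable_fun_conv : measurable_fun setT x.
Proof.
have mF : measurable_fun setT (fun p : P * P => f p.2 * total_correlation S (p.1 - p.2)).
  apply: measurable_funM; first exact: (measurableT_comp mf measurable_snd).
  exact: (measurableT_comp (measurable_total_correlation pS trS b0 Su) measurable_phase_sub).
exact: (@measurable_Rintegral _ _ _ _ R lam _ mF).
Qed.

Lemma cvg_of_nneseries (a : nat -> R) (l : R) : (forall n, 0 <= a n) ->
  (l%:E = \sum_(0 <= k <oo) (a k)%:E)%E -> \sum_(k < n) a k @[n --> \oo] --> l.
Proof. by move=> a0 e; apply/(nnseries_cvgP _ a0). Qed.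

(** Eigenvectors of the convolution resolve the averaged density: each orbit
    point obeys the operator inequality 0 <= A <= 1, and averaging over the
    spectrum of [S] keeps it. *)
Lemma conv_eigen_gap (I : finType) (v : I -> V) (m : I -> R) z :
  (forall i j, ip (v i) (v j) = (i == j)%:R) ->
  (forall i h, ip (A' (v i)) h = (m i)%:C * ip (v i) h) ->
  0 <= x z - \sum_i co z (v i) * m i <= 1 - \sum_i co z (v i).
Proof.
move=> vON vE.
pose g j := tfV z (u j).
pose a j := Re (ip (A' (g j)) (g j)).
pose b j i := sqm (ip (g j) (v i)).
have gap j := finite_eigen_gap H (g j) vON vE (conv_op_symmetric pS b0 Su f0 mf f1) A0 A1.
have xc : \sum_(j < n) s j * a j @[n --> \oo] --> x z.
  apply: (cvg_of_nneseries (a := fun j => s j * a j)); last exact: fun_conv_orbit.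
  by move=> j; rewrite mulr_ge0 ?s0//; exact: A0.
have bc i : \sum_(j < n) s j * b j i @[n --> \oo] --> co z (v i).
  apply: (cvg_of_nneseries (a := fun j => s j * b j i)).
    by move=> j; rewrite mulr_ge0 ?s0 ?sqm_ge0.
  rewrite (coorbitE Su); apply: eq_eseriesr => j _.
  by rewrite (sqm_ipC H).
have qc : \sum_(j < n) s j * Q (g j) @[n --> \oo] --> (1 : R).
  apply: (cvg_of_nneseries (a := fun j => s j * Q (g j))).
    by move=> j; rewrite mulr_ge0 ?s0//; exact: (qf_ge0 H).
  rewrite -(es_sum Su); apply: eq_eseriesr => j _; rewrite qf_tfV.
  by case: (es_normal Su j) => [->|[-> _]]; rewrite ?mulr1 ?mul0r.
pose w1 n := \sum_(j < n) s j * a j - \sum_i (\sum_(j < n) s j * b j i) * m i.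
pose w2 n := \sum_(j < n) s j * Q (g j) - \sum_i \sum_(j < n) s j * b j i.
have w1c : w1 n @[n --> \oo] --> x z - \sum_i co z (v i) * m i.
  apply: cvgB => //; apply: cvg_big => [|i _]; first exact: add_continuous.
  by apply: cvgM; [exact: bc|exact: cvg_cst].
have w2c : w2 n @[n --> \oo] --> 1 - \sum_i co z (v i).
  by apply: cvgB => //; apply: cvg_big => [|i _]; [exact: add_continuous|exact: bc].
have w1E n : w1 n = \sum_(j < n) s j * (a j - \sum_i b j i * m i).
  rewrite /w1; under [X in _ - X]eq_bigr do rewrite mulr_suml.
  rewrite exchange_big -sumrB; apply: eq_bigr => j _.
  by rewrite mulrBr mulr_sumr; congr (_ - _); apply: eq_bigr => i _; rewrite mulrA.
have w2E n : w2 n = \sum_(j < n) s j * (Q (g j) - \sum_i b j i).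
  rewrite /w2 exchange_big -sumrB; apply: eq_bigr => j _.
  by rewrite mulrBr mulr_sumr.
apply/andP; split.
  rewrite -(cvg_lim _ w1c)//; apply: limr_ge; first by apply/cvg_ex; eexists; exact: w1c.
  near=> n; rewrite w1E sumr_ge0// => j _; rewrite mulr_ge0 ?s0//.
  by have /andP[] := gap j.
rewrite -(cvg_lim _ w1c)// -(cvg_lim _ w2c)//; apply: ler_lim.
- by apply/cvg_ex; eexists; exact: w1c.
- by apply/cvg_ex; eexists; exact: w2c.
- near=> n; rewrite w1E w2E; apply: ler_sum => j _; rewrite ler_wpM2l ?s0//.
  by have /andP[] := gap j.
Unshelve. all: by end_near.
Qed.

(** Moyal's inequality, averaged over the spectrum of [S]. *)
Lemma integral_coorbit_ge (v : V) : Q v = 1 -> (1 <= \int[lam]_z (co z v)%:E)%E.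
Proof.
move=> v1.
have -> : (\int[lam]_z (co z v)%:E =
    \sum_(0 <= j <oo) \int[lam]_z (s j * sqm (ip v (tfV z (u j))))%:E)%E.
  rewrite -integral_nneseries//.
  - by apply: eq_integral => z _; rewrite (coorbitE Su).
  - move=> j; apply/measurable_EFinP; apply: measurable_funM; first exact: measurable_cst.
    by apply: measurable_sqm; apply: cmeasurable_inner_tf; exact: L2_cmeasurable (L2funP _).
  - by move=> j z _; rewrite lee_fin mulr_ge0 ?s0 ?sqm_ge0.
rewrite -(es_sum Su); apply: lee_nneseries => j *; first by rewrite lee_fin s0.
under eq_integral do rewrite EFinM.
rewrite ge0_integralZl//; last 3 first.
- apply/measurable_EFinP.
  by apply: measurable_sqm; apply: cmeasurable_inner_tf; exact: L2_cmeasurable (L2funP _).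
- by move=> z _; rewrite lee_fin sqm_ge0.
- by rewrite lee_fin s0.
have hm : ((Q (u j))%:E <= \int[lam]_z (sqm (ip v (tfV z (u j))))%:E)%E.
  have := moyal_ge (L2funP v) (L2funP (u j)).
  by rewrite -/(ipL v v) -/(Q v) v1 mul1r.
case: (es_normal Su j) => [u1|[-> _]]; last by rewrite mul0e.
rewrite u1 in hm; rewrite -[leLHS]mule1.
by apply: lee_wpmul2l; first by rewrite lee_fin s0.
Qed.
End convolution_density.

(** * Multiplicities and the von Neumann entropy *)

Section multiplicities.
Context {R : realType} {d : nat}.
Local Notation E := 'rV[R]_d.
Local Notation C := R[i].
Local Notation V := (@L2fun R d).
Local Notation ip := (@ipL R d).
Local Notation H := (@ipL_hermitian R d).
Local Notation Q := (qf ip).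

Variable A : @operator R d.
Hypothesis bA : bounded_op A.
Local Notation A' := (lift_op A).
Hypotheses (A0 : positive ip A') (A1 : forall f, Re (ip (A' f) f) <= Q f).
Hypothesis sA : symmetric ip A'.
Variables (mu : nat -> R) (v : nat -> V).
Hypothesis Av : eigen_system ip A' mu v 1.

Definition eigen_family (I : finType) (m : I -> R) (e : I -> V) : Prop :=
  (forall i j, ip (e i) (e j) = (i == j)%:R) /\
  (forall i h, ip (A' (e i)) h = (m i)%:C * ip (e i) h).

Lemma eigen_family_form (I : finType) (m : I -> R) (e : I -> V) i :
  eigen_family m e -> Q (e i) = 1 /\ Re (ip (A' (e i)) (e i)) = m i.
Proof.
move=> [eON eE]; have q1 : Q (e i) = 1 by rewrite /qf eON eqxx.
by rewrite eE (qfE H) q1 mulr1.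
Qed.

Lemma eigen_family_bound (I : finType) (m : I -> R) (e : I -> V) i :
  eigen_family m e -> 0 <= m i <= 1.
Proof.
by move=> /(eigen_family_form i)[q1 <-]; rewrite (A0 (e i)) -q1 A1.
Qed.

(** By Bessel, the form of [A] summed over an orthonormal family is at most the
    trace. *)
Lemma eigen_family_card n (m : R) (e : 'I_n -> V) :
  eigen_family (fun=> m) e -> n%:R * m <= 1.
Proof.
move=> fe; have [eON _] := fe.
have step N : n%:R * m <= 1 + n%:R * mu N.
  have -> : n%:R * m = \sum_(k < n) Re (ip (A' (e k)) (e k)).
    rewrite (eq_bigr (fun=> m)) ?sumr_const ?card_ord ?mulr_natl// => k _.
    by have [] := eigen_family_form k fe.
  apply: (@le_trans _ _ (\sum_(k < n) (\sum_(i < N) mu i * sqm (ip (e k) (v i)) + mu N))).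
    apply: ler_sum => k _; have /andP[_] := es_rem Av N (e k).
    by have [-> _] := eigen_family_form k fe; rewrite mulr1 lerBlDl.
  rewrite big_split /= sumr_const card_ord mulr_natl lerD2r exchange_big /=.
  apply: le_trans (es_partial_le Av N); apply: ler_sum => i _.
  rewrite -mulr_sumr ler_piMr ?(es_ge0 Av)//.
  have := bessel H eON (v i); under eq_bigr do rewrite (sqm_ipC H).
  move=> /le_trans; apply.
  by case: (es_normal Av i) => [->//|[_ ->]]; rewrite (qf0 H) ler01.
have c : 1 + n%:R * mu N @[N --> \oo] --> (1 + n%:R * 0 : R).
  apply: cvgD; first exact: cvg_cst.
  by apply: cvgM; [exact: cvg_cst|exact: (es_cvg0 Av)].
rewrite -[leRHS]addr0 -[X in _ <= _ + X](mulr0 (n%:R : R)) -(cvg_lim _ c)//.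
apply: limr_ge; first by apply/cvg_ex; eexists; exact: c.
by near=> N; exact: step.
Unshelve. all: by end_near.
Qed.

Definition has_family (m : R) (n : nat) : Prop :=
  exists e : 'I_n -> E -> C, orthonormal e /\
    forall k, A (e k) = (fun x => m%:C * e k x) %[ae lebesgue_rV d].

Lemma has_familyP m n : has_family m n <->
  exists e : 'I_n -> V, eigen_family (fun=> m) e.
Proof.
split=> [[e [[eL eON] eE]]|[e [eON eE]]].
  exists (fun k => mkL2 (eL k)); split=> [i j|i h]; first exact: eON.
  rewrite ip_lift_op// -(ipZl H); apply: inner_ae (eE i); last exact: L2funP.
    by case: bA => AL _ _; exact: AL.
  exact: (L2funP (m%:C *: mkL2 (eL i))).
exists (fun k => L2val (e k)); split.
  by split=> [k|j k]; [exact: L2funP|exact: eON].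
move=> k; apply: ae_inner.
- by case: bA => AL _ _; apply: AL; exact: L2funP.
- exact: (L2funP (m%:C *: e k)).
- move=> h hL; have := eE k (mkL2 hL); rewrite ip_lift_op// => ->.
  by rewrite -(ipZl H).
Qed.

Lemma has_family_le_multiplicity m n : has_family m n ->
  ((n%:R)%:E <= multiplicity A m)%E.
Proof. by move=> h; apply: ereal_sup_ubound; exists n. Qed.

(** The sizes of the families are bounded by [eigen_family_card]. *)
Lemma multiplicity_attained m : 0 < m -> exists n (e : 'I_n -> V),
  eigen_family (fun=> m) e /\ multiplicity A m = (n%:R)%:E.
Proof.
move=> m0; pose Pb n := `[< has_family m n >].
have P0 : exists n, Pb n.
  by exists 0%N; apply/asboolP/has_familyP; exists (fun=> 0); split=> -[].
have Pub n : Pb n -> (n <= Num.bound m^-1)%N.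
  move=> /asboolP/has_familyP[e /eigen_family_card nm].
  have i0 : 0 <= m^-1 by rewrite invr_ge0 ltW.
  rewrite -(ler_nat R) (le_trans _ (ltW (archi_boundP i0)))//.
  by rewrite -(ler_pM2r m0) mulVf ?gt_eqF.
case: (ex_maxnP P0 Pub) => n /asboolP Pn nmax.
have [e ee] := (has_familyP m n).1 Pn.
exists n, e; split=> //; apply/eqP; rewrite eq_le has_family_le_multiplicity// andbT.
apply: ge_ereal_sup => _ [k hk <-]; rewrite lee_fin ler_nat.
by apply: nmax; exact/asboolP.
Qed.

Lemma multiplicity_entropy m : exists n, exists e : 'I_n -> V,
  [/\ eigen_family (fun=> m) e &
      (multiplicity A m * (ent m)%:E = (n%:R * ent m)%:E)%E].
Proof.
have [m0|m0] := leP m 0.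
  exists 0%N, (fun=> 0); split; first by split=> -[].
  by rewrite /ent ln0// mulr0 oppr0 mule0 mulr0.
have [n [e [fe ->]]] := multiplicity_attained m0.
by exists n, e; split.
Qed.

Lemma eigen_orth (f g : V) (a b : R) : a != b ->
  (forall h, ip (A' f) h = a%:C * ip f h) ->
  (forall h, ip (A' g) h = b%:C * ip g h) -> ip f g = 0.
Proof.
move=> ab fE gE.
have e : a%:C * ip f g = b%:C * ip f g.
  rewrite -fE sA (herm_conj H (A' g)) gE conjcM conjc_real.
  by rewrite -(herm_conj H).
have abC : (a%:C - b%:C : C) != 0.
  by rewrite -rmorphB; apply/eqP => /(congr1 (@complex.Re R)) /= /eqP; rewrite subr_eq0 (negbTE ab).
apply/eqP; have := subrr (b%:C * ip f g); rewrite -{1}e -mulrBl => /eqP.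
by rewrite mulf_eq0 (negbTE abC).
Qed.

(** Eigenvectors for distinct values are orthogonal, so the families of
    [multiplicity_entropy] glue together. *)
Lemma entropy_partial (r : seq R) : uniq r -> exists (I : finType) (m : I -> R) (e : I -> V),
  eigen_family m e /\
  (\sum_(x <- r) multiplicity A x * (ent x)%:E = (\sum_i ent (m i))%:E)%E.
Proof.
move=> ur.
have ex x : exists p : {n & 'I_n -> V}, eigen_family (fun=> x) (tagged p) /\
    (multiplicity A x * (ent x)%:E = ((tag p)%:R * ent x)%:E)%E.
  by have [n [e [fe me]]] := multiplicity_entropy x; exists (Tagged _ e).
pose D x := sval (cid (ex x)); pose N x := tag (D x).
pose e x : 'I_(N x) -> V := tagged (D x).
have eP x : eigen_family (fun=> x) (e x) /\
    (multiplicity A x * (ent x)%:E = ((N x)%:R * ent x)%:E)%E.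
  exact: (svalP (cid (ex x))).
pose val (i : 'I_(size r)) := nth 0 r i.
pose I : finType := {i : 'I_(size r) & 'I_(N (val i))}.
exists I, (fun p => val (tag p)), (fun p => e (val (tag p)) (tagged p)); split.
  split=> [[i a] [j b]|[i a] h] /=; last by case: (eP (val i)) => -[_ +] _; exact.
  have [ij|ij] := eqVneq i j.
    by subst j; rewrite eq_Tagged /=; case: (eP (val i)) => -[+ _] _; exact.
  have -> : (Tagged (fun i => 'I_(N (val i))) a == Tagged (fun i => 'I_(N (val i))) b) = false.
    by apply/negbTE; apply: contra ij => /eqP /(congr1 (@tag _ _)) /= ->.
  apply: (@eigen_orth _ _ (val i) (val j)).
  - by rewrite /val nth_uniq.
  - by case: (eP (val i)) => -[_ +] _; exact.
  - by case: (eP (val j)) => -[_ +] _; exact.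
rewrite (big_nth 0) big_mkord.
have := @sig_big_dep _ _ (@GRing.add R) 'I_(size r) (fun i => 'I_(N (val i)) : finType)
  xpredT (fun i => xpredT) (fun i _ => ent (val i)).
move=> /= <-; rewrite -sumEFin; apply: eq_bigr => i _.
by rewrite (eP _).2 sumr_const card_ord mulr_natl.
Qed.

Lemma entropy_le (B : \bar R) :
  (forall (I : finType) (m : I -> R) (e : I -> V), eigen_family m e ->
    ((\sum_i ent (m i))%:E <= B)%E) -> (von_neumann_entropy A <= B)%E.
Proof.
move=> h; apply: ge_ereal_sup => _ [X [finX _] <-].
rewrite (fsbig_finite _ _ finX).
have [I [m [e [fe E0]]]] := entropy_partial (finmap.fset_uniq (fset_set X)).
rewrite [leLHS]E0; exact: h fe.
Qed.
Lemma le_entropy (r : seq R) : uniq r ->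
  (\sum_(x <- r) multiplicity A x * (ent x)%:E <= von_neumann_entropy A)%E.
Proof.
move=> ur; apply: ereal_sup_ubound; exists [set` r]; last by rewrite -fsbig_seq.
by split=> //; exact: finite_seq.
Qed.

Lemma spectral_value_le1 k : mu k <= 1.
Proof.
have := es_partial_le Av k.+1; rewrite big_ord_recr /=; apply: le_trans.
by rewrite lerDr sumr_ge0// => i _; exact: (es_ge0 Av).
Qed.

Lemma spectral_family n (K : {set 'I_n}) : (forall k, k \in K -> mu k != 0) ->
  eigen_family (fun i : 'I_#|K| => mu (enum_val i)) (fun i : 'I_#|K| => v (enum_val i)).
Proof.
move=> K0; split=> [i j|i h]; last exact: (es_eigen Av).
have [->|ij] := eqVneq i j.
  case: (es_normal Av (enum_val j)) => [q1|[m0 _]]; first by rewrite (qfE H) q1.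
  by have := K0 _ (enum_valP j); rewrite m0 eqxx.
apply: (es_orth Av); apply: contra ij => /eqP e; apply/eqP/enum_val_inj.
exact: val_inj.
Qed.

(** The indices sharing an eigenvalue form a family, so they are at most as many
    as its multiplicity. *)
Lemma entropy_ge n : ((\sum_(k < n) ent (mu k))%:E <= von_neumann_entropy A)%E.
Proof.
pose r := undup [seq mu k | k <- iota 0 n].
have ur : uniq r by exact: undup_uniq.
apply: le_trans (le_entropy ur).
pose cnt x := #|[set k : 'I_n | mu k == x]%SET|.
have -> : \sum_(k < n) ent (mu k) = \sum_(x <- r) (cnt x)%:R * ent x.
  transitivity (\sum_(k < n) \sum_(x <- r) if mu k == x then ent x else 0).
    apply: eq_bigr => k _; have kr : mu k \in r.
      by rewrite mem_undup; apply: map_f; rewrite mem_iota ltn_ord.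
    rewrite (bigD1_seq (mu k))//= eqxx big1 ?addr0// => x.
    by rewrite eq_sym => /negbTE ->.
  rewrite exchange_big /=; apply: eq_bigr => x _.
  rewrite -big_mkcond /= sumr_const mulr_natl; congr (_ *+ _).
  by rewrite /cnt cardsE.
rewrite -sumEFin; apply: lee_sum => x _; rewrite EFinM.
have [->|x0] := eqVneq x 0; first by rewrite /ent mul0r oppr0 !mule0.
have [c0|c0] := eqVneq (cnt x) 0%N.
  rewrite c0 mul0e.
  have [xneg|xpos] := leP x 0; first by rewrite /ent ln0// mulr0 oppr0 mule0.
  have [n' [e [fe ->]]] := multiplicity_attained xpos.
  case: n' e fe => [|n'] e fe; first by rewrite mul0e.
  have /andP[_ x1] := eigen_family_bound ord0 fe.
  by rewrite mule_ge0// lee_fin ?ler0n// ent_ge0.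
have /card_gt0P[k] : (0 < #|[set k : 'I_n | mu k == x]%SET|)%N by rewrite lt0n.
rewrite inE => /eqP kx; apply: lee_wpmul2r.
  by rewrite lee_fin ent_ge0// -kx spectral_value_le1.
apply: has_family_le_multiplicity; apply/has_familyP.
exists (fun i : 'I_(cnt x) => v (enum_val i)).
have K0 (i : 'I_n) : i \in [set k : 'I_n | mu k == x]%SET -> mu i != 0.
  by rewrite inE => /eqP ->.
have [fON fE] := spectral_family K0.
split; first exact: fON.
move=> i h; rewrite (fE i h); congr (_%:C * _).
by have := enum_valP i; rewrite inE => /eqP.
Qed.
End multiplicities.

(** * The two entropies *)

Section entropy_bounds.
Context {R : realType} {d : nat}.
Local Notation E := 'rV[R]_d.
Local Notation C := R[i].
Local Notation V := (@L2fun R d).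
Local Notation ip := (@ipL R d).
Local Notation H := (@ipL_hermitian R d).
Local Notation Q := (qf ip).
Local Notation P := (phase_space R d).
Local Notation lam := (@lebesgue_phase R d).

Variable S : @operator R d.
Hypotheses (pS : positive_op S) (trS : tr S = 1).
Variable e0 : nat -> E -> C.
Hypothesis b0 : orthonormal_basis e0.
Local Notation S' := (lift_op S).
Variables (s : nat -> R) (u : nat -> V).
Hypothesis Su : eigen_system ip S' s u 1.

Variable f : P -> R.
Hypotheses (f0 : forall z, 0 <= f z) (mf : measurable_fun setT f).
Hypothesis f1 : (\int[lam]_z (f z)%:E = 1)%E.

Local Notation co := (coorbit_form S).
Local Notation A := (fun_op_conv f S).
Local Notation A' := (lift_op A).
Local Notation x := (fun_conv f (total_correlation S)).

Let bA : bounded_op A := (fun_op_conv_spec pS b0 Su f0 mf f1).1.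
Let A0 := conv_op_positive pS b0 Su f0 mf f1.
Let A1 := conv_op_le pS b0 Su f0 mf f1.
Let sA := conv_op_symmetric pS b0 Su f0 mf f1.
Let mco g : measurable_fun setT (fun z => (co z g)%:E).
Proof. by apply/measurable_EFinP; exact: (measurable_coorbit_form pS Su). Qed.
Let co0 z g : 0 <= co z g := coorbit_ge0 pS z g.

Lemma measurable_ent : measurable_fun setT (@ent R).
Proof.
apply: measurable_funN; apply: measurable_funM => //; exact: measurable_ln.
Qed.

Let ent0 z : 0 <= ent (x z).
Proof. by apply: ent_ge0; have /andP[] := fun_conv_bound pS trS b0 Su f0 mf f1 z. Qed.

Let mentx : measurable_fun setT (fun z => (ent (x z))%:E).
Proof.
apply/measurable_EFinP; apply: (measurableT_comp measurable_ent).
exact: (measurable_fun_conv pS trS b0 Su mf).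
Qed.

(** Concavity of the entropy function, averaged over phase space; the weights
    [co z (e i)] have total mass at least one by Moyal's identity. *)
Lemma eigen_family_entropy_le (I : finType) (m : I -> R) (e : I -> V) :
  eigen_family A m e -> ((\sum_i ent (m i))%:E <= \int[lam]_z (ent (x z))%:E)%E.
Proof.
move=> fe; have [eON eE] := fe.
have m01 i : 0 <= m i <= 1 by exact: (eigen_family_bound A0 A1 i fe).
have em0 i : 0 <= ent (m i) by apply: ent_ge0; have /andP[] := m01 i.
apply: (@le_trans _ _ (\int[lam]_z (\sum_i (co z (e i) * ent (m i))%:E))%E).
  rewrite ge0_integral_sum//; last 2 first.
  - move=> i; apply/measurable_EFinP; apply: measurable_funM => //.
    exact: (measurable_coorbit_form pS Su).
  - by move=> i z _; rewrite lee_fin mulr_ge0// co0.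
  rewrite -sumEFin; apply: lee_sum => i _.
  under eq_integral do rewrite EFinM.
  rewrite ge0_integralZr//; last 2 first.
  - by move=> z _; rewrite lee_fin co0.
  - by rewrite lee_fin.
  rewrite -[leLHS]mul1e; apply: lee_wpmul2r; first by rewrite lee_fin.
  apply: (integral_coorbit_ge Su).
  by have [] := eigen_family_form i fe.
apply: ge0_le_integral => //.
- by move=> z _; apply: sume_ge0 => i _; rewrite lee_fin mulr_ge0// co0.
- apply: emeasurable_sum => i; apply/measurable_EFinP; apply: measurable_funM => //.
  exact: (measurable_coorbit_form pS Su).
move=> z _; rewrite sumEFin lee_fin; apply: ent_jensen.
- by move=> i; exact: co0.
- by move=> i; have /andP[] := m01 i.
- exact: (fun_conv_bound pS trS b0 Su f0 mf f1).
- exact: (conv_eigen_gap pS trS b0 Su f0 mf f1 z eON eE).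
Qed.

Lemma entropy_upper : (von_neumann_entropy A <= \int[lam]_z (ent (x z))%:E)%E.
Proof.
have [mu [v Av]] := conv_op_spectrum pS trS b0 Su f0 mf f1.
apply: (entropy_le bA sA Av) => I m e fe.
exact: eigen_family_entropy_le fe.
Qed.

(** The weights [co z (v k)], integrated against [f], give <A v_k, v_k> = mu_k;
    by [conv_eigen_gap] they resolve at most [x z]. *)
Lemma spectral_square_le mu v n : eigen_system ip A' mu v 1 ->
  ((\sum_(k < n) mu k ^+ 2)%:E <= \int[lam]_z (f z * x z)%:E)%E.
Proof.
move=> Av; pose K := [set k : 'I_n | mu k != 0]%SET.
have K0 (k : 'I_n) : k \in K -> mu k != 0 by rewrite inE.
have fe := spectral_family Av K0.
have [eON eE] := fe.
pose e (i : 'I_#|K|) := v (enum_val i); pose m (i : 'I_#|K|) := mu (enum_val i).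
have -> : \sum_(k < n) mu k ^+ 2 = \sum_(i < #|K|) m i ^+ 2.
  rewrite -(big_enum_val (fun k : 'I_n => mu k ^+ 2)) /= [RHS]big_mkcond /=.
  apply: eq_bigr => k _; rewrite inE; have [->|//] := eqVneq (mu k) 0.
  by rewrite expr0n.
have m0 i : 0 <= m i by exact: (es_ge0 Av).
have mfc i : measurable_fun setT (fun z => f z * (co z (e i) * m i)).
  apply: measurable_funM => //; apply: measurable_funM => //.
  exact: (measurable_coorbit_form pS Su).
apply: (@le_trans _ _ (\int[lam]_z (\sum_(i < #|K|) (f z * (co z (e i) * m i))%:E))%E).
  rewrite ge0_integral_sum//; last 2 first.
  - by move=> i; exact/measurable_EFinP.
  - by move=> i z _; rewrite lee_fin !mulr_ge0// co0.
  rewrite -sumEFin; apply: lee_sum => i _.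
  under eq_integral do rewrite mulrA EFinM.
  rewrite ge0_integralZr//; last 3 first.
  - apply/measurable_EFinP; apply: measurable_funM => //.
    exact: (measurable_coorbit_form pS Su).
  - by move=> z _; rewrite lee_fin mulr_ge0// co0.
  - by rewrite lee_fin.
  have := conv_op_form pS b0 Su f0 mf f1 (e i); move=> <-.
  have [_ ->] := eigen_family_form i fe.
  by rewrite expr2 EFinM.
have mx := measurable_fun_conv pS trS b0 Su mf.
apply: ge0_le_integral => //.
- by move=> z _; apply: sume_ge0 => i _; rewrite lee_fin !mulr_ge0// co0.
- by apply: emeasurable_sum => i; exact/measurable_EFinP.
- by apply/measurable_EFinP; exact: measurable_funM.
move=> z _; rewrite sumEFin lee_fin -mulr_sumr ler_wpM2l//.
by have /andP[+ _] := conv_eigen_gap pS trS b0 Su f0 mf f1 z eON eE; rewrite subr_ge0.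
Qed.
End entropy_bounds.

(** * Measurability and finite measure of compact sets *)

(** Provides phase space with the pointed structure asked for by the equivalence
    of compactness with the existence of finite subcovers. *)
HB.instance Definition _ (T U : ptopologicalType) := Pointed.on (T * U)%type.

Section compact_sets.
Context {R : realType} {d : nat}.
Local Notation E := 'rV[R]_d.
Local Notation P := (phase_space R d).
Local Notation lam := (@lebesgue_phase R d).

Definition phase_cube (z : P) (e : R) : set P :=
  box (fun i => z.1 ord0 i - e) (fun i => z.1 ord0 i + e) `*`
  box (fun i => z.2 ord0 i - e) (fun i => z.2 ord0 i + e).

Lemma ball_phase_cube (z y : P) (e : R) : 0 < e -> ball z e y <-> phase_cube z e y.
Proof.
move=> e0.
have key (a b : E) : ball a e b <-> box (fun i => a ord0 i - e) (fun i => a ord0 i + e) b.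
  split=> [[_ ab] i|ab].
    by have := ab ord0 i; rewrite /ball /= in_itv /= ltr_distlC.
  split=> // i j; rewrite (ord1 i).
  by have := ab j; rewrite /ball /= in_itv /= ltr_distlC.
by split=> -[/key h1 /key h2].
Qed.

Lemma measurable_phase_cube z e : measurable (phase_cube z e).
Proof. by apply: measurableX; exact: measurable_box. Qed.

Lemma phase_cube_lty z e : (lam (phase_cube z e) < +oo)%E.
Proof.
rewrite /lebesgue_phase product_measure1E; [|exact: measurable_box|exact: measurable_box].
by rewrite lte_mul_pinfty// ?ge0_fin_numE// box_lty.
Qed.

Lemma phase_hausdorff : hausdorff_space P.
Proof.
rewrite ball_hausdorff => a b ab.
have [i [del del0 sep]] : exists i : 'I_d, exists2 e : R, 0 < e &
    2 * e <= `|a.1 ord0 i - b.1 ord0 i| \/ 2 * e <= `|a.2 ord0 i - b.2 ord0 i|.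
  have key (p q : E) : p != q -> exists i : 'I_d, exists2 e : R, 0 < e &
      2 * e <= `|p ord0 i - q ord0 i|.
    move=> pq; have [/forallP h|] := boolP [forall i, p ord0 i == q ord0 i].
      by case/eqP: pq; apply/rowP => i; exact/eqP.
    rewrite negb_forall => /existsP[i hi]; exists i, (`|p ord0 i - q ord0 i| / 2).
      by rewrite divr_gt0// normr_gt0 subr_eq0.
    by rewrite mulrC divfK.
  have [h|h] := eqVneq a.1 b.1; last by have [i [e e0 he]] := key _ _ h; exists i, e => //; left.
  have h2 : a.2 != b.2 by apply: contra ab => /eqP h2; rewrite (surjective_pairing a) h h2 -surjective_pairing.
  by have [i [e e0 he]] := key _ _ h2; exists i, e => //; right.
exists (PosNum del0, PosNum del0) => /=.
apply/eqP; rewrite -subset0 => y [[[_ /= a1] [_ a2]] [[_ /= b1] [_ b2]]].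
have tri (p q r : R) : ball p del r -> ball q del r -> 2 * del <= `|p - q| -> False.
  rewrite /ball /= => pr qr; apply/negP; rewrite -ltNge.
  have -> : p - q = (p - r) - (q - r) by ring.
  apply: le_lt_trans (ler_normB _ _) _.
  by move: pr qr => /= pr qr; lra.
by case: sep => h; [exact: tri (a1 ord0 i) (b1 ord0 i) h|exact: tri (a2 ord0 i) (b2 ord0 i) h].
Qed.

Lemma compact_cubes (O : set P) (e : R) : compact O -> 0 < e ->
  exists r : seq P, (forall z, z \in r -> O z) /\
    O `<=` \big[setU/set0]_(z <- r) phase_cube z e.
Proof.
move=> cO e0; have coverO : cover_compact (O : set (P : ptopologicalType)).
  by rewrite -(@compact_cover (P : ptopologicalType)).
case: (coverO _ O (fun z : P => (ball z e)^°)).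
- by move=> z _; exact: open_interior.
- by move=> z Oz; exists z => //; exact: nbhsx_ballx.
move=> D DO cov; exists (finmap.enum_fset D); split.
  by move=> z zD; have := DO z zD; rewrite inE.
move=> y /cov; rewrite /cover bigcup_seq => hy.
move: hy; rewrite -!bigcup_seq => -[z zD /interior_subset /ball_phase_cube hz].
by exists z => //; exact: hz.
Qed.

(** A compact set is the intersection of finite unions of small cubes centred
    in it, the measurable sets being generated by coordinates, not by open
    sets. *)
Lemma compact_measurable (O : set P) : compact O -> measurable O.
Proof.
move=> cO.
have ex n : {r : seq P | (forall z, z \in r -> O z) /\
    O `<=` \big[setU/set0]_(z <- r) phase_cube z n.+1%:R^-1}.
  by apply: cid; apply: compact_cubes => //; rewrite invr_gt0.
pose U n := \big[setU/set0]_(z <- sval (ex n)) phase_cube z n.+1%:R^-1.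
rewrite (_ : O = \bigcap_n U n).
  apply: bigcap_measurable; first by exists 0%N.
  by move=> n _; apply: bigsetU_measurable => z _; exact: measurable_phase_cube.
apply/seteqP; split=> [z Oz n _|y Uy]; first by have [_] := svalP (ex n); exact.
apply: (compact_closed phase_hausdorff cO) => B /nbhs_ballP[e /= e0 eB].
pose n := Num.bound e^-1.
have ne : n.+1%:R^-1 <= e.
  have i0 : 0 <= e^-1 by rewrite invr_ge0 ltW.
  rewrite -[leRHS]invrK lef_pV2 ?posrE ?invr_gt0//.
  by rewrite (le_trans (ltW (archi_boundP i0)))// ler_nat.
have := Uy n I; rewrite /U -bigcup_seq => -[z /= zr yz].
have [rO _] := svalP (ex n); exists z; split; first exact: rO.
by apply: eB; apply: ball_sym; apply: (le_ball ne); apply/ball_phase_cube.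
Qed.

Lemma compact_lty (O : set P) : compact O -> (lam O < +oo)%E.
Proof.
move=> cO; have [r [_ rO]] := compact_cubes cO ltr01.
have mU (l : seq P) : measurable (\big[setU/set0]_(z <- l) phase_cube z 1).
  by apply: bigsetU_measurable => z _; exact: measurable_phase_cube.
apply: le_lt_trans (le_measure lam _ _ rO) _; rewrite ?inE//; first exact: compact_measurable.
elim: r {rO} => [|z r IH]; first by rewrite big_nil measure0.
rewrite big_cons (le_lt_trans (measureU2 _ _ _))//; first exact: measurable_phase_cube.
by rewrite lte_add_pinfty// phase_cube_lty.
Qed.
End compact_sets.

(** * The average lack of concentration *)

Section lack_of_concentration.
Context {R : realType} {d : nat}.
Local Notation E := 'rV[R]_d.
Local Notation C := R[i].
Local Notation V := (@L2fun R d).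
Local Notation ip := (@ipL R d).
Local Notation P := (phase_space R d).
Local Notation lam := (@lebesgue_phase R d).

Variable S : @operator R d.
Hypotheses (pS : positive_op S) (trS : tr S = 1).
Variable e0 : nat -> E -> C.
Hypothesis b0 : orthonormal_basis e0.
Variables (s : nat -> R) (u : nat -> V).
Hypothesis Su : eigen_system ip (lift_op S) s u 1.

Variable O : set P.
Hypotheses (mO : measurable O) (O_gt0 : (0 < lam O)%E) (O_lty : (lam O < +oo)%E).

Local Notation vol := (volume O).
Local Notation f := (uniform_density O).
Local Notation tc := (total_correlation S).
Local Notation x := (fun_conv f tc).

Lemma volumeE : lam O = vol%:E.
Proof. by rewrite /volume fineK// ge0_fin_numE. Qed.

Lemma volume_gt0 : 0 < vol. Proof. by rewrite -lte_fin -volumeE. Qed.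

Let vol0 : vol != 0. Proof. by rewrite gt_eqF// volume_gt0. Qed.

Lemma uniform_density_ge0 z : 0 <= f z.
Proof. by rewrite /uniform_density divr_ge0// ltW// volume_gt0. Qed.

Lemma measurable_uniform_density : measurable_fun setT f.
Proof. by apply: measurable_funM => //; exact: measurable_indic. Qed.

Lemma integral_uniform_density : (\int[lam]_z (f z)%:E = 1)%E.
Proof.
rewrite /uniform_density; under eq_integral do rewrite EFinM.
rewrite ge0_integralZr//; last first.
- by rewrite lee_fin invr_ge0 ltW// volume_gt0.
- by apply/measurable_EFinP; exact: measurable_indic.
by rewrite integral_indic// setIT [X in (X * _)%E]volumeE -EFinM divff.
Qed.

Let f0 := uniform_density_ge0.
Let mf := measurable_uniform_density.
Let f1 := integral_uniform_density.

Let tcC (a b : P) : tc (a - b) = tc (b - a).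
Proof. by rewrite -opprB; exact: (total_correlationN pS trS b0 Su). Qed.

(** The change of variables z' = w - z and the evenness of the correlation
    function turn the mass of a translate into a convolution. *)
Lemma translate_integral z : \int[lam]_(z' in [set w - z | w in O]) tc z' = vol * x z.
Proof.
have mtc : measurable_fun setT (fun z => (tc z)%:E).
  by apply/measurable_EFinP; exact: (measurable_total_correlation pS trS b0 Su).
have imE : [set w - z | w in O] = (fun y => y + z) @^-1` O.
  apply/seteqP; split=> [_ [w Ow <-]|y Oy] /=; first by rewrite subrK.
  by exists (y + z) => //; rewrite addrK.
set D := [set _ | _ in O].
have mD : measurable D.
  by rewrite /D imE -[X in measurable X]setTI; exact: measurable_phase_add.
pose g := (fun z' => (tc z')%:E) \_ D.
have g0 y : (0 <= g y)%E.
  by rewrite /g patchE; case: ifP => // _; rewrite lee_fin (total_correlation_ge0 pS trS b0 Su).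
have mg : measurable_fun setT g.
  by apply/(measurable_restrictT _ mD); exact: measurable_funTS.
have xE : ((x z)%:E = \int[lam]_w (f w * tc (z - w))%:E)%E.
  apply: etrans (fun_conv_orbit pS trS b0 Su f0 mf f1 z) _.
  exact: esym (conv_integral pS trS b0 Su f0 mf f1 z).
suff -> : \int[lam]_(z' in D) tc z' = fine (vol%:E * (x z)%:E)%E by [].
congr fine; rewrite integral_mkcond -/g -(ge0_integral_phase_shift (- z) mg g0) xE.
have mfx : measurable_fun setT (fun w => (f w * tc (z - w))%:E).
  apply/measurable_EFinP; apply: measurable_funM; first exact: mf.
  have -> : (fun w => tc (z - w)) = (fun w => tc (w - z)).
    by apply/funext => w; exact: tcC.
  have /measurable_EFinP m1 := mtc.
  exact: (measurableT_comp m1 (measurable_phase_add (- z))).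
rewrite -ge0_integralZl//; last 2 first.
- by move=> w _; rewrite lee_fin mulr_ge0 ?f0// (total_correlation_ge0 pS trS b0 Su).
- by rewrite lee_fin ltW// volume_gt0.
apply: eq_integral => w _; rewrite /g patchE -EFinM mulrA.
have -> : vol * f w = \1_O w by rewrite mulrC divfK.
have -> : (w - z \in D) = (w \in O).
  by apply/idP/idP; rewrite !inE /D imE /= subrK.
rewrite indicE; move: (w \in O) => [] /=; congr _%:E.
  by apply: etrans (tcC w z) _; exact: esym (mul1r _).
exact: esym (mul0r _).
Qed.

Let fxi : lam.-integrable setT (fun z => (f z * x z)%:E).
Proof.
have fi : lam.-integrable setT (fun z => (f z)%:E).
  apply/integrableP; split; first exact/measurable_EFinP.
  by under eq_integral do rewrite gee0_abs ?lee_fin ?f0//; rewrite f1 ltry.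
apply: (le_integrable measurableT _ _ fi).
  apply/measurable_EFinP; apply: measurable_funM; first exact: mf.
  exact: (measurable_fun_conv pS trS b0 Su mf).
move=> z _; have /andP[x0 x1] := fun_conv_bound pS trS b0 Su f0 mf f1 z.
rewrite !gee0_abs ?lee_fin ?f0//; last by rewrite mulr_ge0 ?f0.
by rewrite ler_piMr ?f0.
Qed.

(** Averaging the previous identity over [O]. *)
Lemma ALC_overlap : ALC tc O = 1 - vol * \int[lam]_z (f z * x z).
Proof.
have fi : lam.-integrable setT (fun z => (f z)%:E).
  apply/integrableP; split; first exact/measurable_EFinP.
  by under eq_integral do rewrite gee0_abs ?lee_fin ?f0//; rewrite f1 ltry.
rewrite /ALC.
have -> : \int[lam]_(z in O) (1 - \int[lam]_(z' in [set w - z | w in O]) tc z') =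
    vol * (1 - vol * \int[lam]_z (f z * x z)).
  transitivity (\int[lam]_z (vol * f z - vol ^+ 2 * (f z * x z))).
    apply: (congr1 fine); rewrite integral_mkcond; apply: eq_integral => z _.
    rewrite patchE translate_integral.
    have fE : vol * f z = \1_O z by rewrite mulrC divfK.
    rewrite expr2 -[vol * vol * _]mulrA (mulrA vol (f z)) fE indicE.
    case: ifP => _; first by rewrite mul1r.
    by rewrite !mul0r mulr0 subr0.
  rewrite RintegralB//.
  - rewrite !RintegralZl// [X in vol * X - _](_ : _ = 1); first by ring.
    by rewrite /Rintegral f1.
  - by rewrite (_ : _ \o _ = (fun z => vol%:E * (f z)%:E)%E)//; exact: integrableZl.
  - rewrite (_ : _ \o _ = (fun z => (vol ^+ 2)%:E * (f z * x z)%:E)%E)//.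
    exact: integrableZl.
by rewrite mulrA mulVf// mul1r.
Qed.

(** By the tangent of the logarithm, ent mu >= (ln vol + 1) mu - vol mu^2; sum over
    the spectrum, where the mu add up to 1 and their squares are controlled by
    the overlap in [ALC_overlap]. *)
Lemma entropy_lower :
  ((ln vol + ALC tc O)%:E <= von_neumann_entropy (fun_op_conv f S))%E.
Proof.
have [mu [v Av]] := conv_op_spectrum pS trS b0 Su f0 mf f1.
have bA := (fun_op_conv_spec pS b0 Su f0 mf f1).1.
have A0 := conv_op_positive pS b0 Su f0 mf f1.
have A1 := conv_op_le pS b0 Su f0 mf f1.
have ge n := entropy_ge bA A0 A1 Av n.
set h := von_neumann_entropy _ in ge *.
have h0 : (0 <= h)%E by have := ge 0%N; rewrite big_ord0.
have [->|hy] := eqVneq h +oo%E; first by rewrite leey.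
have hf : h \is a fin_num by rewrite ge0_fin_numE// ltey.
rewrite -(fineK hf) lee_fin ALC_overlap.
set X := \int[lam]_z (f z * x z).
have sq n : \sum_(k < n) mu k ^+ 2 <= X.
  rewrite -lee_fin /X /Rintegral fineK; last exact: integrable_fin_num fxi.
  exact: (spectral_square_le pS trS b0 Su f0 mf f1 n Av).
(* ln (vol mu) <= vol mu - 1: the tangent of the logarithm at 1 / vol *)
have tangent k : (ln vol + 1) * mu k - vol * mu k ^+ 2 <= ent (mu k).
  have := es_ge0 Av k; rewrite le_eqVlt => /predU1P[<-|m0].
    by rewrite /ent expr0n /= !mulr0 mul0r subrr oppr0.
  have := ln_le_subr1 (mulr_gt0 volume_gt0 m0).
  rewrite lnM ?posrE ?volume_gt0// /ent => hl.
  have := ler_wpM2l (ltW m0) hl; rewrite expr2; nra.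
have bound n : (ln vol + 1) * \sum_(k < n) mu k - vol * X <= fine h.
  rewrite -lee_fin fineK//; apply: le_trans (ge n); rewrite lee_fin.
  apply: (@le_trans _ _ (\sum_(k < n) ((ln vol + 1) * mu k - vol * mu k ^+ 2))); last first.
    by apply: ler_sum => k _; exact: tangent.
  rewrite sumrB -!mulr_sumr lerB// ler_wpM2l//; first by rewrite ltW// volume_gt0.
have c1 : \sum_(k < n) mu k @[n --> \oo] --> (1 : R).
  by apply/(nnseries_cvgP _ (es_ge0 Av)); exact: (es_sum Av).
have c : (ln vol + 1) * \sum_(k < n) mu k - vol * X @[n --> \oo] -->
    ((ln vol + 1) * 1 - vol * X : R).
  apply: cvgB; last exact: cvg_cst.
  by apply: cvgM; [exact: cvg_cst|exact: c1].
rewrite addrA -[ln vol + 1]mulr1 -(cvg_lim _ c)//.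
apply: limr_le; first by apply/cvg_ex; eexists; exact: c.
by near=> n; exact: bound.
Unshelve. all: by end_near.
Qed.
End lack_of_concentration.

Theorem theorem3p7 (R : realType) (d : nat) (hd : (0 < d)%N)
  (Omega : set (phase_space R d)) (S : @operator R d)
  (cOmega : compact Omega) (Omega_gt0 : (0 < lebesgue_phase Omega)%E)
  (S_pos : positive_op S) (S_tc : trace_class S) (S_tr : tr S = 1) :
  ((ln (volume Omega) + ALC (total_correlation S) Omega)%:E
     <= von_neumann_entropy (fun_op_conv (uniform_density Omega) S))%E /\
  (von_neumann_entropy (fun_op_conv (uniform_density Omega) S)
     <= differential_entropy
          (fun_conv (uniform_density Omega) (total_correlation S)))%E.
Proof.
have [_ [_ [e [_ be _]]]] := S_tc.
have [s [u Su]] := density_spectrum S_pos S_tr be.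
have mO := compact_measurable cOmega; have O_lty := compact_lty cOmega.
split; first exact: (entropy_lower S_pos S_tr be Su mO Omega_gt0 O_lty).
apply: (entropy_upper S_pos S_tr be Su).
- exact: (uniform_density_ge0 Omega_gt0 O_lty).
- exact: measurable_uniform_density.
- exact: (integral_uniform_density mO Omega_gt0 O_lty).
Qed.
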